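(* Let $\Lambda\subset\mathbf{R}^n$ be an even lattice, with $n$ odd, and consider the orthogonal direct sum $\Lambda'=\Lambda\perp A_1$. Let $\ell'$ be the level of $\Lambda'$, and let $\mathcal{B}'$ be a basis of the space of modular forms $\mathcal{M}_{(n+1)/2+2}(\Gamma_1(\ell'))$, in row echelon form with respect to the powers of $q$ in the $q$-expansions. Let $N$ be the exponent of $q$ in the last row pivot of $\mathcal{B}'$. If the (nonempty) layers $\{x\in\Lambda : (x\cdot x)=m\}$ of $\Lambda$ with $0<m\le 2N$ are spherical $2$-designs, then all the layers of $\Lambda$ are spherical $2$-designs.
   Context: A lattice in $\mathbf{R}^n$ is a full-rank lattice $\Lambda=\mathbf{Z}v_1\oplus\cdots\oplus\mathbf{Z}v_n$ with $(v_i)$ a basis of $\mathbf{R}^n$; $(x\cdot y)$ is the standard inner product. $\Lambda$ is integral if $(x\cdot y)\in\mathbf{Z}$ for all $x,y\in\Lambda$, and even if it is integral and $(x\cdot x)\in2\mathbf{Z}$ for all $x\in\Lambda$. $A_1=\sqrt2\,\mathbf{Z}\subset\mathbf{R}$ is the one-dimensional lattice with Gram matrix $(2)$; $\Lambda\perp A_1\subset\mathbf{R}^{n+1}$ is the orthogonal direct sum. The dual of a lattice $L\subset\mathbf{R}^d$ is $L^*=\{y\in\mathbf{R}^d:(x\cdot y)\in\mathbf{Z}\ \forall x\in L\}$. The level of an even lattice $L$ of even dimension is the smallest positive integer $\ell$ such that $\sqrt{\ell}\,L^*$ is even. The layers of $\Lambda$ are the nonempty sets $\{x\in\Lambda : (x\cdot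 x)=m\}$, $m>0$. A nonempty finite subset $X$ of a sphere $\mathbf{S}\subset\mathbf{R}^n$ centred at the origin is a spherical $t$-design if $\int_{\mathbf{S}} f(x)\,dx=\frac{1}{|X|}\sum_{x\in X}f(x)$ for every homogeneous polynomial $f$ of degree $\le t$, where $dx$ is the $O(n)$-invariant measure on $\mathbf{S}$ of total mass $1$. $\Gamma_1(\ell)=\{\begin{pmatrix}a&b\\c&d\end{pmatrix}\in\mathrm{SL}_2(\mathbf{Z}) : a\equiv d\equiv1,\ c\equiv0 \bmod \ell\}$, and $\mathcal{M}_k(\Gamma_1(\ell))$ is the (finite-dimensional) space of modular forms of weight $k$ for $\Gamma_1(\ell)$, with $q$-expansions in $q=e^{2\pi i\tau}$ at the cusp $\infty$. A basis is in row echelon form if its elements have $q$-expansions with strictly increasing leading exponents $k_{1,1}<k_{2,1}<\cdots<k_{\dim M,1}$ and leading coefficients $1$; the last pivot exponent is $N=k_{\dim M,1}$. *)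

(* Defs.v *)
From HB Require Import structures.
From mathcomp Require Import all_boot all_order all_algebra.
From mathcomp Require Import all_classical all_reals all_analysis.
From mathcomp Require Import finmap complex.
(* The notations of mpoly clash with those of Analysis. *)
From mathcomp Require Import -(notations) mpoly.

Set Implicit Arguments.
Unset Strict Implicit.
Unset Printing Implicit Defensive.

Import Order.TTheory GRing.Theory Num.Theory.
Import numFieldNormedType.Exports.

Local Open Scope classical_set_scope.
Local Open Scope ring_scope.

Section Lattices.
Context {R : realType}.

(* Vectors of R^n are row vectors. *)
Definition dot n (x y : 'rV[R]_n) : R := (x *m y^T) 0 0.

(* The rows of B are the basis v_1, ..., v_n. *)
Definition is_lattice n (L : set 'rV[R]_n) : Prop :=
  exists B : 'M[R]_n, B \in unitmx /\
    L = [set x | exists z : 'rV[int]_n, x = map_mx intr z *m B].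

Definition integral_lattice n (L : set 'rV[R]_n) : Prop :=
  is_lattice L /\ forall x y, L x -> L y -> dot x y \is a Num.int.

Definition even_lattice n (L : set 'rV[R]_n) : Prop :=
  integral_lattice L /\
  forall x, L x -> exists z : int, dot x x = 2 * z%:~R.

Definition dual_lattice n (L : set 'rV[R]_n) : set 'rV[R]_n :=
  [set y | forall x, L x -> dot x y \is a Num.int].

Definition scale_set n (c : R) (L : set 'rV[R]_n) : set 'rV[R]_n :=
  [set c *: x | x in L].

Definition is_level n (L : set 'rV[R]_n) (l : nat) : Prop :=
  [/\ (0 < l)%N,
      even_lattice (scale_set (Num.sqrt l%:R) (dual_lattice L)) &
      forall m : nat, (0 < m)%N ->
        even_lattice (scale_set (Num.sqrt m%:R) (dual_lattice L)) ->
        (l <= m)%N].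

Definition latticeA1 : set 'rV[R]_1 :=
  [set x | exists z : int, x = const_mx (Num.sqrt 2 * z%:~R)].

Definition orth_sum n1 n2 (L1 : set 'rV[R]_n1) (L2 : set 'rV[R]_n2) :
    set 'rV[R]_(n1 + n2) :=
  [set x | exists x1 x2, [/\ L1 x1, L2 x2 & x = row_mx x1 x2]].

Definition layer n (L : set 'rV[R]_n) (m : R) : set 'rV[R]_n :=
  [set x | L x /\ dot x x = m].

End Lattices.

Section SphericalDesigns.
Context {R : realType}.

(* R^n with its Borel sigma-algebra. *)
Definition borelRV n := g_sigma_algebraType (@open 'rV[R]_n).

Definition sphere n (r : R) : set 'rV[R]_n := [set x | dot x x = r ^+ 2].

(* Measures on the sphere are seen as measures on R^n concentrated on it;
   the conditions determine mu uniquely for n >= 1 and r > 0. *)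
Definition is_sphere_measure n (r : R) (mu : probability (borelRV n) R) :
    Prop :=
  mu (sphere r) = 1%E /\
  forall g : 'M[R]_n, g *m g^T = 1%:M ->
  forall A : set (borelRV n), measurable A ->
    mu ((fun x : 'rV[R]_n => x *m g) @^-1` A) = mu A.

Definition poly_eval n (f : mpoly n R) (x : 'rV[R]_n) : R :=
  meval (fun i => x 0 i) f.

Definition spherical_design n (t : nat) (X : set 'rV[R]_n) : Prop :=
  [/\ finite_set X, X !=set0 &
      exists r : R, [/\ 0 < r, X `<=` sphere r &
        exists mu : probability (borelRV n) R, is_sphere_measure r mu /\
        forall (j : nat) (f : mpoly n R),
          (j <= t)%N -> f \is ishomog1 j mdeg ->
          (\int[mu]_(x in sphere r) (poly_eval f x)%:E)%E =
          ((#|` fset_set X|%:R)^-1 * \sum_(x \in X) poly_eval f x)%:E]].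

End SphericalDesigns.

(* Topological notions over an abstract numFieldType, to be used at R[i]:
   derivability there is complex differentiability. *)
Section NumField.
Context {K : numFieldType}.

Definition differentiable_at (f : K -> K) (z : K) : Prop := derivable f z 1.

Definition has_sum (u : nat -> K) (s : K) : Prop := series u @ \oo --> s.

End NumField.

Section ModularForms.
Context {R : realType}.
Local Notation C := R[i].

Definition upper (tau : C) : Prop := 0 < complex.Im tau.

Definition cexp (z : C) : C :=
  (expR (complex.Re z))%:C%C
  * Complex (cos (complex.Im z)) (sin (complex.Im z)).

(* exp(2 pi i tau / h); h = 1 gives q. *)
Definition qroot (h : nat) (tau : C) : C :=
  cexp (Complex 0 (2 * pi / h%:R) * tau).

Definition q_expansion (h : nat) (f : C -> C) (a : nat -> C) : Prop :=
  forall tau, upper tau -> has_sum (fun j => a j * qroot h tau ^+ j) (f tau).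

Definition Gamma1 (l : nat) (g : 'M[int]_2) : Prop :=
  [/\ \det g = 1, (g 0%R 0%R = 1 %[mod l%:Z])%Z, (g 1%R 1%R = 1 %[mod l%:Z])%Z &
      (g 1%R 0%R = 0 %[mod l%:Z])%Z].

Definition slash (k : nat) (g : 'M[int]_2) (f : C -> C) (tau : C) : C :=
  ((g 1 0)%:~R * tau + (g 1 1)%:~R) ^- k
  * f (((g 0 0)%:~R * tau + (g 0 1)%:~R) / ((g 1 0)%:~R * tau + (g 1 1)%:~R)).

(* Modular forms are functions on the upper half-plane: the values of f outside
   it are irrelevant.  The last clause is holomorphy at every cusp; every
   f |_k g has period l, since the principal congruence subgroup of level l is
   normal in SL_2(Z) and contained in Gamma_1(l). *)
Definition modular_form (k l : nat) (f : C -> C) : Prop :=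
  [/\ forall tau, upper tau -> differentiable_at f tau,
      forall g tau, Gamma1 l g -> upper tau -> slash k g f tau = f tau &
      forall g : 'M[int]_2, \det g = 1 ->
        exists a : nat -> C, q_expansion l (slash k g f) a].

Definition modular_basis (k l d : nat) (b : 'I_d -> C -> C) : Prop :=
  [/\ forall i, modular_form k l (b i),
      forall c : 'I_d -> C,
        (forall tau, upper tau -> \sum_(i < d) c i * b i tau = 0) ->
        forall i, c i = 0 &
      forall f, modular_form k l f -> exists c : 'I_d -> C,
        forall tau, upper tau -> f tau = \sum_(i < d) c i * b i tau].

(* p i is the pivot exponent of the i-th basis element. *)
Definition row_echelon_basis (k l d : nat) (b : 'I_d -> C -> C)
    (p : 'I_d -> nat) : Prop :=
  [/\ modular_basis k l b,
      exists a : 'I_d -> nat -> C, forall i,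
        [/\ q_expansion 1 (b i) (a i), a i (p i) = 1 &
            forall j, (j < p i)%N -> a i j = 0] &
      forall i j : 'I_d, (i < j)%N -> (p i < p j)%N].

End ModularForms.

(* Main.v *)
Require Import Defs.
From HB Require Import structures.
From mathcomp Require Import all_boot all_order all_algebra.
From mathcomp Require Import all_classical all_reals all_analysis.
From mathcomp Require Import finmap complex ring lra zify.
From mathcomp Require Import all_field measurable_realfun perm.

(** Fix distinct coordinates i and j, and weigh a vector x by the harmonic
    polynomial (x_i + i x_j)^2.  The theta series of an even lattice M of even
    rank 2 k and level l' > 1 with such a weight is a modular form of weight
    k + 2 on Gamma_1(l') ([theta_modular]).  Take M to be the sum of L and A_1,
    of rank n + 1 = 2 k and of a level divisible by 4, with i and j among the
    first n coordinates.  The weight ignores the last coordinate, so that the theta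
    series is a product of the weighted theta series of L and the plain theta
    series of A_1, which is 1 + 2 q + 2 q^4 + ...  ([theta_coef_addA1]).

    The coefficient of q^e in the weighted theta series of L is the sum of the
    weight over the layer of norm 2 e ([theta_coef_layer]).  Its real part
    compares the second moments of the layer along the axes i and j, its
    imaginary part is twice the mixed moment.  If the layers of norm at most 2 N
    are 2-designs, these sums vanish for e <= N ([design_theta_coef]), hence so
    do the coefficients of the product up to the last pivot N; a form in the
    span of the echelon basis with this property is zero ([echelon_vanish]).
    Dividing by the theta series of A_1 ([theta_coef_eq0]), all the sums over
    layers of L vanish, for all i and j.  Since the layers are symmetric about
    the origin, this says that all their moments of degree at most 2 are those
    of the sphere ([theta_coef_design]).

    Modularity is proved from scratch.  In dimension one, the inversion formula
    of Jacobi follows from a finite Fourier transform of the Gaussian and the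
    fact that its Riemann sums hardly depend on the contour
    ([theta_inversion]).  Splitting off one coordinate at a time by Schur
    complements gives the formula for positive definite forms
    ([qf_inversion]), and second derivatives in the characteristic bring in the
    weight ([hweight_inversion]).  Near a rational point, the lattice splits
    into residue classes that are inverted separately ([theta_rational]): this
    gives the expansions at the cusps ([theta_cusp]) and, after a second
    inversion, the transformation under Gamma_0(l'), with a quadratic Gauss sum
    as its multiplier ([theta_Gamma0]).  For Gamma_1(l') the multiplier is 1:
    the matrix (1 z; l' 1 + l' z) is a product of (1 0; l' 1) and a translation,
    for both of which the multiplier is trivial, and the Gauss sums attached to
    the other matrices with the same last entry are Galois conjugates of this
    one ([theta_Gamma1]).

    On the side of designs, one needs a rotation invariant probability on the
    sphere.  It is the radial projection of the Lebesgue measure of a ball, a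
    product measure whose rotation invariance comes from the uniqueness of
    translation invariant measures ([sphere_measure_exists]).  Its moments of
    degree at most 2 follow from invariance under reflections and coordinate
    permutations. *)

Set Implicit Arguments.
Unset Strict Implicit.
Unset Printing Implicit Defensive.

Import Order.TTheory GRing.Theory Num.Theory.
Import numFieldNormedType.Exports.
Import Normc.

Local Open Scope classical_set_scope.
Local Open Scope complex_scope.
Local Open Scope ring_scope.

Local Notation Re := complex.Re.
Local Notation Im := complex.Im.
Local Notation "'ii'" := (Complex 0 1).

(** * The complex exponential *)

(** [cexp] is by definition a product, which unification unfolds whenever a
    lemma on products is rewritten with; this copy is sealed. *)
HB.lock Definition cex {R : realType} (z : R[i]) : R[i] := cexp z.

Lemma cexE {R : realType} (z : R[i]) : cexp z = cex z.
Proof. by rewrite cex.unlock. Qed.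

Section ComplexExp.
Context {R : realType}.
Local Notation C := R[i].

(** The modulus as a map into the real field itself, where order reasoning
    takes place; the norm of the numeric field [R[i]] is complex-valued. *)
Definition cabs (z : C) : R := normc z.
Arguments cabs : simpl never.

Lemma cabs0 : cabs 0 = 0. Proof. exact: normc0. Qed.
Lemma cabs1 : cabs 1 = 1. Proof. exact: normc1. Qed.
Lemma cabsM x y : cabs (x * y) = cabs x * cabs y. Proof. exact: normcM. Qed.
Lemma cabsV x : cabs x^-1 = (cabs x)^-1. Proof. exact: normcV. Qed.
Lemma cabsN x : cabs (- x) = cabs x. Proof. exact: normcN. Qed.
Lemma cabsD x y : cabs (x + y) <= cabs x + cabs y. Proof. exact: le_normcD. Qed.

Lemma cabs_ge0 (z : C) : 0 <= cabs z.
Proof. by case: z => a b; exact: sqrtr_ge0. Qed.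

Lemma cabs_Re (z : C) : `|Re z| <= cabs z.
Proof.
case: z => a b; rewrite /cabs/= -sqrtr_sqr ler_wsqrtr//.
by rewrite lerDl sqr_ge0.
Qed.

Lemma cabs_Im (z : C) : `|Im z| <= cabs z.
Proof.
case: z => a b; rewrite /cabs/= -sqrtr_sqr ler_wsqrtr//.
by rewrite lerDr sqr_ge0.
Qed.

Lemma cabs_le_ReIm (z : C) : cabs z <= `|Re z| + `|Im z|.
Proof.
case: z => a b; rewrite /cabs/= -[leRHS]ger0_norm ?addr_ge0// -sqrtr_sqr.
rewrite ler_wsqrtr// sqrrD !real_normK ?num_real// lerD2r lerDl.
by rewrite mulrn_wge0// mulr_ge0.
Qed.

Lemma cabsR (x : R) : cabs (x%:C) = `|x|.
Proof. by rewrite /cabs/= expr0n/= addr0 sqrtr_sqr. Qed.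

Lemma cabsX (z : C) n : cabs (z ^+ n) = cabs z ^+ n.
Proof.
elim: n => [|n IH]; first by rewrite !expr0 cabs1.
by rewrite !exprS cabsM IH.
Qed.

Lemma cabs_natr n : cabs (n%:R : C) = n%:R.
Proof. by rewrite -(rmorph_nat (real_complex R)) cabsR normr_nat. Qed.

Lemma cabsB (x y : C) : cabs (x - y) <= cabs x + cabs y.
Proof. by rewrite -(cabsN y); exact: cabsD. Qed.

Lemma cabs_eq0 (z : C) : cabs z = 0 -> z = 0.
Proof. exact: eq0_normc. Qed.

Lemma cabs_gt0 (z : C) : z != 0 -> 0 < cabs z.
Proof.
move=> z0; rewrite lt_neqAle cabs_ge0 andbT eq_sym.
by apply: contra z0 => /eqP/cabs_eq0->.
Qed.

Lemma le_cabs_sum (I : Type) (r : seq I) (P : pred I) (F : I -> C) :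
  cabs (\sum_(i <- r | P i) F i) <= \sum_(i <- r | P i) cabs (F i).
Proof.
elim/big_ind2 : _ => //; first by rewrite cabs0.
by move=> x x' y y' xx' yy'; rewrite (le_trans (cabsD _ _))// lerD.
Qed.

Lemma cex0 : cex 0 = 1 :> C.
Proof. by rewrite -cexE /cexp /= expR0 sin0 cos0 mul1r. Qed.

Lemma cexD (a b : C) : cex (a + b) = cex a * cex b.
Proof.
case: a b => [a1 a2] [b1 b2]; rewrite -!cexE /cexp /= expRD cosD sinD.
simpc; congr (Complex _ _); ring.
Qed.

Lemma cexN (a : C) : cex (- a) = (cex a)^-1.
Proof.
have h : cex a * cex (- a) = 1 by rewrite -cexD subrr cex0.
have a0 : cex a != 0.
  by apply/eqP => a0; move/eqP: h; rewrite a0 mul0r eq_sym oner_eq0.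
by apply: (mulfI a0); rewrite h divff.
Qed.

Lemma cabs_cex (a : C) : cabs (cex a) = expR (Re a).
Proof.
rewrite -cexE /cexp cabsM cabsR ger0_norm ?expR_ge0//.
by rewrite /cabs/= cos2Dsin2 sqrtr1 mulr1.
Qed.

Lemma cex_neq0 (a : C) : cex a != 0.
Proof.
apply/eqP => a0; have := cabs_cex a; rewrite a0 cabs0 => /esym/eqP.
by rewrite expR_eq0.
Qed.

Lemma cexMn (a : C) n : cex (n%:R * a) = cex a ^+ n.
Proof.
elim: n => [|n IH]; first by rewrite mul0r cex0.
by rewrite -addn1 natrD mulrDl mul1r cexD IH exprD expr1.
Qed.

Lemma cex_2pi : cex (2 * pi%:C * ii) = 1 :> C.
Proof.
have -> : 2 * pi%:C * ii = Complex 0 (pi *+ 2) :> C.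
  rewrite -(rmorph_nat (real_complex R)) -rmorphM/=; simpc.
  by congr (Complex _ _); rewrite mulr_natl.
by rewrite -cexE /cexp /= expR0 mul1r cos2pi sin2pi.
Qed.

Lemma cex_2pin (n : nat) : cex (2 * pi%:C * ii * n%:R) = 1 :> C.
Proof. by rewrite mulrC cexMn cex_2pi expr1n. Qed.

Lemma cex_2piz (z : int) : cex (2 * pi%:C * ii * z%:~R) = 1 :> C.
Proof.
case: z => n; first exact: cex_2pin.
by rewrite NegzE rmorphN mulrN cexN cex_2pin invr1.
Qed.

Lemma MVT_norm_bound (f df : R -> R) (x K : R) :
  (forall t : R, is_derive t 1 f (df t)) -> f 0 = 0 ->
  (forall t, `|t| <= `|x| -> `|df t| <= K) -> `|f x| <= K * `|x|.
Proof.
move=> fd f0 dfK.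
have cf : continuous f.
  by move=> t; apply/differentiable_continuous/derivable1_diffP; have [] := fd t.
have [x0|x0|->] := ltgtP x 0; last first.
- by rewrite f0 !normr0 mulr0.
- have [c cx] := MVT x0 (fun t _ => fd t) (continuous_subspaceT cf).
  rewrite f0 !subr0 => ->; rewrite normrM ler_wpM2r// dfK//.
  by move: cx; rewrite in_itv/= => /andP[c1 c2]; rewrite !gtr0_norm// ltW.
- have [c cx] := MVT x0 (fun t _ => fd t) (continuous_subspaceT cf).
  rewrite f0 sub0r => /eqP; rewrite eqr_oppLR => /eqP ->.
  rewrite sub0r mulrN opprK normrM ler_wpM2r// dfK//.
  by move: cx; rewrite in_itv/= => /andP[c1 c2]; rewrite !ltr0_norm// lerN2 ltW.
Qed.

Lemma max1_expR (x y : R) : x <= y -> 0 <= y ->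
  Num.max 1 (expR x) <= expR y.
Proof. by move=> xy y0; rewrite ge_max ler_expR xy -{1}expR0 ler_expR y0. Qed.

(** Bounds by the larger of the values of the exponential at the two ends of
    [0, x], rather than by that at `|x|. *)
Lemma expR_sub1_max (x : R) : `|expR x - 1| <= `|x| * Num.max 1 (expR x).
Proof.
have h1 := expR_ge1Dx x; have h2 := expR_ge1Dx (- x).
have e0 := expR_gt0 x.
have h3 : expR x - 1 <= x * expR x.
  have : (1 - x) * expR x <= expR (- x) * expR x by rewrite ler_wpM2r// ltW.
  by rewrite -expRD addNr expR0 => h; lra.
have [x0|x0] := leP 0 x.
  rewrite (ger0_norm x0) ger0_norm; last by lra.
  by rewrite (le_trans h3)// ler_wpM2l// le_max lexx orbT.
rewrite (ltr0_norm x0) ler0_norm; last by rewrite subr_le0 expR_le1 ltW.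
have : - x * 1 <= - x * Num.max 1 (expR x).
  by rewrite ler_wpM2l//; [lra|rewrite le_max lexx].
by lra.
Qed.

Lemma expR_sub2_max (x : R) :
  `|expR x - 1 - x| <= `|x| ^+ 2 * Num.max 1 (expR x).
Proof.
have h1 := expR_ge1Dx x; have h2 := expR_ge1Dx (- x).
have e0 := expR_gt0 x.
have h3 : expR x - 1 - x <= x * (expR x - 1).
  have : (1 - x) * expR x <= expR (- x) * expR x by rewrite ler_wpM2r// ltW.
  by rewrite -expRD addNr expR0 => h; lra.
rewrite ger0_norm; last by lra.
apply: (le_trans h3); rewrite (le_trans (ler_norm _))// normrM expr2 -mulrA.
by rewrite ler_wpM2l// expR_sub1_max.
Qed.

Lemma expR_sub1_bound (x : R) : `|expR x - 1| <= `|x| * expR `|x|.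
Proof.
apply: (le_trans (expR_sub1_max x)); rewrite ler_wpM2l//.
by apply: max1_expR; rewrite ?ler_norm.
Qed.

Lemma expR_sub2_bound (x : R) : `|expR x - 1 - x| <= `|x| ^+ 2 * expR `|x|.
Proof.
apply: (le_trans (expR_sub2_max x)); rewrite ler_wpM2l ?exprn_ge0//.
by apply: max1_expR; rewrite ?ler_norm.
Qed.

Lemma expR_sub3_bound (x : R) :
  `|expR x - 1 - x - x ^+ 2 / 2| <= `|x| ^+ 3 * expR `|x|.
Proof.
pose f t : R := expR t - 1 - t - t ^+ 2 / 2.
rewrite -[X in `|X|]/(f x) exprSr -mulrA (mulrC `|x|) mulrA.
apply: (@MVT_norm_bound f (fun t => expR t - 1 - t)).
- move=> t; rewrite /f.
  by apply: is_derive_eq; rewrite !scaler1 /GRing.scale/=; field.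
- by rewrite /f expR0 expr0n/=; lra.
- move=> t tx; apply: (le_trans (expR_sub2_bound _)).
  by rewrite ler_pM ?exprn_ge0 ?expR_ge0// ?lerXn2r ?nnegrE// ler_expR.
Qed.

Lemma sin_bound (x : R) : `|sin x| <= `|x|.
Proof.
rewrite -[leRHS]mul1r; apply: (@MVT_norm_bound sin cos) => //.
- by rewrite sin0.
- by move=> t _; exact: cos_max.
Qed.

Lemma cos_bound1 (x : R) : `|cos x - 1| <= `|x|.
Proof.
rewrite -[leRHS]mul1r.
apply: (@MVT_norm_bound (fun t => cos t - 1) (fun t => - sin t)) => //.
- by move=> t; apply: is_derive_eq; rewrite subr0.
- by rewrite cos0 subrr.
- by move=> t _; rewrite normrN; exact: sin_max.
Qed.

Lemma cos_bound2 (x : R) : `|cos x - 1| <= `|x| ^+ 2.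
Proof.
rewrite expr2.
apply: (@MVT_norm_bound (fun t => cos t - 1) (fun t => - sin t)) => //.
- by move=> t; apply: is_derive_eq; rewrite subr0.
- by rewrite cos0 subrr.
- by move=> t tx; rewrite normrN (le_trans (sin_bound _)).
Qed.

Lemma sin_bound2 (x : R) : `|sin x - x| <= `|x| ^+ 2.
Proof.
rewrite expr2.
apply: (@MVT_norm_bound (fun t => sin t - t) (fun t => cos t - 1)) => //.
- by rewrite sin0 subrr.
- by move=> t tx; rewrite (le_trans (cos_bound1 _)).
Qed.

Lemma sin_bound3 (x : R) : `|sin x - x| <= `|x| ^+ 3.
Proof.
rewrite exprSr.
apply: (@MVT_norm_bound (fun t => sin t - t) (fun t => cos t - 1)) => //.
- by rewrite sin0 subrr.
- by move=> t tx; rewrite (le_trans (cos_bound2 _))// lerXn2r ?nnegrE.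
Qed.

Lemma cos_bound3 (x : R) : `|cos x - 1 + x ^+ 2 / 2| <= `|x| ^+ 3.
Proof.
rewrite [leRHS]exprSr.
apply: (@MVT_norm_bound (fun t => cos t - 1 + t ^+ 2 / 2) (fun t => t - sin t)).
- by move=> t; apply: is_derive_eq; rewrite /GRing.scale/=; field.
- by rewrite cos0 subrr add0r expr0n/= mul0r.
- move=> t tx; rewrite distrC (le_trans (sin_bound2 _))//.
  by rewrite lerXn2r ?nnegrE.
Qed.

Lemma expR_le_norm (x y : R) : `|x| <= y -> expR x <= expR y.
Proof. by move=> xy; rewrite ler_expR (le_trans (ler_norm _)). Qed.

(** The remainder is controlled by the two end values of the exponential only;
    a bound by the exponential of [cabs a] would not be summable below, where
    [a] grows quadratically along a Gaussian sum. *)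
Lemma cex_bound2_max (a : C) :
  cabs (cex a - 1 - a) <= 4 * cabs a ^+ 2 * Num.max 1 (expR (Re a)).
Proof.
have := cabs_Re a; have := cabs_Im a; have := cabs_ge0 a.
move: (cabs a) => N N0; case: a => x y yN xN; rewrite /= in xN yN *.
set M := Num.max 1 (expR x).
have M1 : 1 <= M by rewrite /M le_max lexx.
have M0 : 0 <= M by lra.
have eM : expR x <= M by rewrite /M le_max lexx orbT.
have x2 : `|x| ^+ 2 <= N ^+ 2 by rewrite lerXn2r// nnegrE.
have y2 : `|y| ^+ 2 <= N ^+ 2 by rewrite lerXn2r// nnegrE.
apply: (le_trans (cabs_le_ReIm _)); rewrite -cexE /cexp; simpc => /=.
have -> : expR x * cos y - 1 - x = (expR x - 1 - x) + expR x * (cos y - 1).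
  by ring.
have -> : expR x * sin y - y = expR x * (sin y - y) + y * (expR x - 1) by ring.
rewrite (_ : 4 * N ^+ 2 * M = (N ^+ 2 * M + M * N ^+ 2)
  + (M * N ^+ 2 + N * (N * M))); last by ring.
apply: lerD; apply: (le_trans (ler_normD _ _)); apply: lerD.
- by apply: (le_trans (expR_sub2_max x)); rewrite ler_pM// exprn_ge0.
- rewrite normrM ger0_norm ?expR_ge0// ler_pM ?expR_ge0//.
  exact: (le_trans (cos_bound2 _)).
- rewrite normrM ger0_norm ?expR_ge0// ler_pM ?expR_ge0//.
  exact: (le_trans (sin_bound2 _)).
- rewrite normrM ler_pM//.
  by apply: (le_trans (expR_sub1_max _)); rewrite ler_pM.
Qed.

Lemma cex_bound2 (a : C) :
  cabs (cex a - 1 - a) <= 4 * cabs a ^+ 2 * expR (cabs a).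
Proof.
apply: (le_trans (cex_bound2_max a)); rewrite ler_wpM2l//.
  by rewrite mulr_ge0// exprn_ge0// cabs_ge0.
apply: max1_expR (cabs_ge0 a).
by rewrite (le_trans (ler_norm _))// cabs_Re.
Qed.

Lemma cex_bound3 (a : C) :
  cabs (cex a - 1 - a - a ^+ 2 / 2) <= 6 * cabs a ^+ 3 * expR (cabs a).
Proof.
have := cabs_Re a; have := cabs_Im a; have := cabs_ge0 a.
move: (cabs a) => N N0; case: a => x y yN xN; rewrite /= in xN yN.
have e0 := expR_ge0 N.
have eN : expR x <= expR N by exact: expR_le_norm.
have eN' : expR `|x| <= expR N by rewrite ler_expR.
have x2 : `|x| ^+ 2 <= N ^+ 2 by rewrite lerXn2r// nnegrE.
have y2 : `|y| ^+ 2 <= N ^+ 2 by rewrite lerXn2r// nnegrE.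
have x3 : `|x| ^+ 3 <= N ^+ 3 by rewrite lerXn2r// nnegrE.
have y3 : `|y| ^+ 3 <= N ^+ 3 by rewrite lerXn2r// nnegrE.
have -> : (Complex x y) ^+ 2 / 2 = Complex ((x ^+ 2 - y ^+ 2) / 2) (x * y) :> C.
  have -> : 2^-1 = (2^-1)%:C :> C by rewrite fmorphV rmorph_nat.
  by rewrite expr2; simpc; congr (Complex _ _); field.
apply: (le_trans (cabs_le_ReIm _)); rewrite -cexE /cexp; simpc => /=.
have -> : expR x * cos y - 1 - x - (x ^+ 2 - y ^+ 2) / 2 =
  (expR x - 1 - x - x ^+ 2 / 2) + expR x * (cos y - 1 + y ^+ 2 / 2)
  - (expR x - 1) * (y ^+ 2 / 2) by field.
have -> : expR x * sin y - y - x * y =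
  expR x * (sin y - y) + y * (expR x - 1 - x) by ring.
have p : 0 <= N ^+ 3 * expR N by rewrite mulr_ge0// exprn_ge0.
apply: (@le_trans _ _ ((N ^+ 3 * expR N + expR N * N ^+ 3 + (N * expR N) * N ^+ 2)
  + (expR N * N ^+ 3 + N * (N ^+ 2 * expR N)))); last by lra.
apply: lerD.
  apply: (le_trans (ler_normB _ _)); apply: lerD.
    apply: (le_trans (ler_normD _ _)); apply: lerD.
      by apply: (le_trans (expR_sub3_bound x)); rewrite ler_pM// ?exprn_ge0 ?expR_ge0.
    rewrite normrM ger0_norm ?expR_ge0// ler_pM ?expR_ge0//.
    exact: (le_trans (cos_bound3 _)).
  rewrite normrM ler_pM//.
    by apply: (le_trans (expR_sub1_bound _)); rewrite ler_pM ?expR_ge0.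
  rewrite normrM normrX (ger0_norm (_ : 0 <= 2^-1 :> R))// ?invr_ge0//.
  by have := exprn_ge0 2 N0; lra.
apply: (le_trans (ler_normD _ _)); apply: lerD.
  rewrite normrM ger0_norm ?expR_ge0// ler_pM ?expR_ge0//.
  exact: (le_trans (sin_bound3 _)).
rewrite normrM ler_pM//.
by apply: (le_trans (expR_sub2_bound x)); rewrite ler_pM// ?exprn_ge0 ?expR_ge0.
Qed.

End ComplexExp.

(** * Unconditional sums of complex families *)

Section RealSums.
Context {R : realType}.
Local Notation es f := (\esum_(x in [set: _]) (f x)%:E)%E.

Definition summ (T : choiceType) (f : T -> R) : Prop :=
  (es (fun x => `|f x|) < +oo)%E.

(** Meant for nonnegative families; [rsum] reduces the general case to it. *)
Definition psum (T : choiceType) (f : T -> R) : R := fine (es f).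

Definition rsum (T : choiceType) (f : T -> R) : R :=
  psum (fun x => Num.max (f x) 0) - psum (fun x => Num.max (- f x) 0).

Lemma psumE (T : choiceType) (f : T -> R) : (forall x, 0 <= f x) -> summ f ->
  es f = (psum f)%:E.
Proof.
move=> f0 sf; rewrite /psum fineK// ge0_fin_numE.
  by apply: le_lt_trans sf; apply: le_esum => x _; rewrite lee_fin ler_norm.
by apply: esum_ge0 => x _; rewrite lee_fin.
Qed.

Lemma eq_psum (T : choiceType) (f g : T -> R) : f =1 g -> psum f = psum g.
Proof. by move=> /funext ->. Qed.

Lemma summ_le (T : choiceType) (f g : T -> R) :
  (forall x, `|f x| <= g x) -> summ g -> summ f.
Proof.
move=> fg; apply: le_lt_trans; apply: le_esum => x _.
by rewrite lee_fin (le_trans (fg x))// ler_norm.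
Qed.

Lemma summ_esum (T : choiceType) (f : T -> R) K : (forall x, 0 <= f x) ->
  (es f <= K%:E)%E -> summ f.
Proof.
move=> f0 h; rewrite /summ; apply: le_lt_trans (ltry K); apply: le_trans h.
by apply: le_esum => x _; rewrite ger0_norm.
Qed.

Lemma psum_ge0 (T : choiceType) (f : T -> R) : (forall x, 0 <= f x) ->
  0 <= psum f.
Proof. by move=> f0; apply: fine_ge0; apply: esum_ge0 => x _; rewrite lee_fin. Qed.

Lemma le_psum (T : choiceType) (f g : T -> R) : (forall x, 0 <= f x) ->
  (forall x, f x <= g x) -> summ g -> psum f <= psum g.
Proof.
move=> f0 fg sg.
have sf : summ f by apply: summ_le sg => x; rewrite ger0_norm.
rewrite -lee_fin -!psumE//; last by move=> x; exact: le_trans (fg x).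
by apply: le_esum => x _; rewrite lee_fin.
Qed.

Lemma summD (T : choiceType) (f g : T -> R) : summ f -> summ g ->
  summ (fun x => f x + g x).
Proof.
move=> sf sg; rewrite /summ.
apply: (@le_lt_trans _ _ (es (fun x => `|f x|) + es (fun x => `|g x|))%E).
  rewrite -esumD; try by move=> x _; rewrite lee_fin.
  by apply: le_esum => x _; rewrite -EFinD lee_fin ler_normD.
exact: lte_add_pinfty.
Qed.

Lemma psumD (T : choiceType) (f g : T -> R) : (forall x, 0 <= f x) ->
  (forall x, 0 <= g x) -> summ f -> summ g ->
  psum (fun x => f x + g x) = psum f + psum g.
Proof.
move=> f0 g0 sf sg; apply: EFin_inj; rewrite EFinD -!psumE//.
- by rewrite -esumD; [| move=> x _; rewrite lee_fin|move=> x _; rewrite lee_fin].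
- by move=> x; rewrite addr_ge0.
- exact: summD.
Qed.

Lemma esumZ_le (T : choiceType) (f : T -> R) c : 0 <= c -> (forall x, 0 <= f x) ->
  (es (fun x => c * f x)%R <= c%:E * es f)%E.
Proof.
move=> c0 f0; apply: ge_ereal_sup => _ [X [finX _] <-].
rewrite (eq_fsbigr (fun x => c%:E * (f x)%:E)%E); last by move=> x _; rewrite EFinM.
rewrite -ge0_mule_fsumr; last by move=> x; rewrite lee_fin.
by apply: lee_wpmul2l => //; apply: esum_ge; exists X.
Qed.

Lemma summZ (T : choiceType) (f : T -> R) c : summ f -> summ (fun x => c * f x).
Proof.
move=> sf; rewrite /summ.
rewrite (_ : (fun x => _) = (fun x => (`|c| * `|f x|)%:E)); last first.
  by apply/funext => x; rewrite normrM.
apply: (le_lt_trans (esumZ_le _ _)) => //.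
have s0 : (0 <= es (fun x => `|f x|))%E by apply: esum_ge0 => x _; rewrite lee_fin.
by rewrite lte_mul_pinfty.
Qed.

Lemma psumZ (T : choiceType) (f : T -> R) c : 0 <= c -> (forall x, 0 <= f x) ->
  summ f -> psum (fun x => c * f x) = c * psum f.
Proof.
move=> c0 f0 sf.
have Z (d : R) (h : T -> R) : 0 <= d -> (forall x, 0 <= h x) -> summ h ->
    psum (fun x => d * h x) <= d * psum h.
  move=> d0 h0 sh; rewrite -lee_fin EFinM -!psumE//.
  - exact: esumZ_le.
  - by move=> x; rewrite mulr_ge0.
  - exact: summZ.
apply/eqP; rewrite eq_le Z//=.
have [->|cn0] := eqVneq c 0.
  by rewrite mul0r; apply: psum_ge0 => x; rewrite mul0r.
have cp : 0 < c by rewrite lt_neqAle eq_sym cn0.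
rewrite -ler_pdivlMl//.
rewrite [leLHS](@eq_psum _ _ (fun x => c^-1 * (c * f x))); last first.
  by move=> x; rewrite mulKf.
apply: Z; rewrite ?invr_ge0//; last exact: summZ.
by move=> x; rewrite mulr_ge0.
Qed.

Lemma summ_abs (T : choiceType) (f : T -> R) : summ f -> summ (fun x => `|f x|).
Proof. by rewrite /summ; under [in X in _ -> X]eq_esum do rewrite normr_id. Qed.

Lemma maxr0_ge0 (x : R) : 0 <= Num.max x 0. Proof. by rewrite le_max lexx orbT. Qed.

Lemma summ_pos (T : choiceType) (f : T -> R) : summ f -> summ (fun x => Num.max (f x) 0).
Proof.
move/summ_abs; apply: summ_le => x; rewrite ger0_norm ?maxr0_ge0//.
by rewrite ge_max ler_norm normr_ge0.
Qed.

Lemma summN (T : choiceType) (f : T -> R) : summ f -> summ (fun x => - f x).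
Proof. by move/summ_abs; apply: summ_le => x; rewrite normrN. Qed.

Lemma maxrB (x : R) : Num.max x 0 - Num.max (- x) 0 = x.
Proof. by have [x0|x0] := leP x 0; [rewrite max_l//|rewrite max_r//]; lra. Qed.

(** Any decomposition of a family as a difference of nonnegative summable
    families computes its sum: this is what makes [rsum] additive although
    positive parts are not. *)
Lemma rsum_diff (T : choiceType) (f g h : T -> R) :
  (forall x, 0 <= g x) -> (forall x, 0 <= h x) -> summ g -> summ h ->
  (forall x, f x = g x - h x) -> rsum f = psum g - psum h.
Proof.
move=> g0 h0 sg sh fE.
have sf : summ f.
  apply: (@summ_le _ _ (fun x => g x + h x)); last exact: summD.
  by move=> x; rewrite fE (le_trans (ler_normB _ _))// !ger0_norm.
have : psum (fun x => Num.max (f x) 0 + h x) = psum (fun x => Num.max (- f x) 0 + g x).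
  apply: eq_psum => x; have := maxrB (f x); have := fE x; lra.
rewrite !psumD//; try exact: summ_pos; try (by move=> x; exact: maxr0_ge0).
  by rewrite /rsum; lra.
by apply: summ_pos; exact: summN.
Qed.

Lemma eq_rsum (T : choiceType) (f g : T -> R) : f =1 g -> rsum f = rsum g.
Proof. by move=> /funext ->. Qed.

Lemma rsum_ge0E (T : choiceType) (f : T -> R) : (forall x, 0 <= f x) -> summ f ->
  rsum f = psum f.
Proof.
move=> f0 sf; rewrite (@rsum_diff _ f f (fun=> 0))//.
- by rewrite (_ : psum (fun=> 0) = 0) ?subr0// /psum esum1.
- by rewrite /summ esum1// => x _; rewrite normr0.
- by move=> x; rewrite subr0.
Qed.

Lemma rsumD (T : choiceType) (f g : T -> R) : summ f -> summ g ->
  rsum (fun x => f x + g x) = rsum f + rsum g.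
Proof.
move=> sf sg.
rewrite (@rsum_diff _ _ (fun x => Num.max (f x) 0 + Num.max (g x) 0)
  (fun x => Num.max (- f x) 0 + Num.max (- g x) 0)).
- rewrite !psumD /rsum; try (by move=> x; exact: maxr0_ge0);
    do ?[exact: summ_pos|by apply: summ_pos; exact: summN].
  by ring.
- by move=> x; rewrite addr_ge0// maxr0_ge0.
- by move=> x; rewrite addr_ge0// maxr0_ge0.
- by apply: summD; exact: summ_pos.
- by apply: summD; apply: summ_pos; exact: summN.
- by move=> x; have := maxrB (f x); have := maxrB (g x); lra.
Qed.

Lemma rsumN (T : choiceType) (f : T -> R) : summ f ->
  rsum (fun x => - f x) = - rsum f.
Proof.
move=> sf; rewrite (@rsum_diff _ _ (fun x => Num.max (- f x) 0) (fun x => Num.max (f x) 0)).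
- by rewrite /rsum opprB.
- by move=> x; exact: maxr0_ge0.
- by move=> x; exact: maxr0_ge0.
- by apply: summ_pos; exact: summN.
- exact: summ_pos.
- by move=> x; have := maxrB (f x); lra.
Qed.

Lemma rsumZ (T : choiceType) (f : T -> R) c : summ f ->
  rsum (fun x => c * f x) = c * rsum f.
Proof.
move=> sf; wlog c0 : c / 0 <= c.
  move=> h; have [/h//|/ltW c0] := leP 0 c.
  rewrite (@eq_rsum _ _ (fun x => - (- c * f x))); last by move=> x; rewrite mulNr opprK.
  by rewrite rsumN ?h ?oppr_ge0// ?mulNr ?opprK//; exact: summZ.
rewrite (@rsum_diff _ _ (fun x => c * Num.max (f x) 0) (fun x => c * Num.max (- f x) 0)).
- rewrite !psumZ//; try (by move=> x; exact: maxr0_ge0); first by rewrite /rsum mulrBr.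
  + by apply: summ_pos; exact: summN.
  + exact: summ_pos.
- by move=> x; rewrite mulr_ge0// maxr0_ge0.
- by move=> x; rewrite mulr_ge0// maxr0_ge0.
- by apply: summZ; exact: summ_pos.
- by apply: summZ; apply: summ_pos; exact: summN.
- by move=> x; rewrite -mulrBr maxrB.
Qed.

Lemma ler_norm_rsum (T : choiceType) (f : T -> R) : summ f ->
  `|rsum f| <= psum (fun x => `|f x|).
Proof.
move=> sf.
have h x : Num.max (f x) 0 + Num.max (- f x) 0 = `|f x|.
  by have [x0|x0] := leP (f x) 0; rewrite ?(ler0_norm x0) ?(gtr0_norm x0);
    [rewrite max_l|rewrite max_r]; lra.
rewrite -(@eq_psum _ _ _ h) psumD; try (by move=> x; exact: maxr0_ge0);
  do ?[exact: summ_pos|by apply: summ_pos; exact: summN].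
apply: (le_trans (ler_normB _ _)).
by rewrite !ger0_norm// psum_ge0// => x; exact: maxr0_ge0.
Qed.

Lemma esum_bij (T T' : choiceType) (e : T -> T') (f : T' -> R) : bijective e ->
  es f = es (f \o e).
Proof.
move=> be; apply: reindex_esum; split=> //.
- by move=> x y _ _; exact: bij_inj.
- by move=> y _; case: be => g _ gK; exists (g y).
Qed.

Lemma summ_bij (T T' : choiceType) (e : T -> T') (f : T' -> R) : bijective e ->
  summ (f \o e) <-> summ f.
Proof. by move=> be; rewrite /summ (esum_bij _ be). Qed.

Lemma rsum_bij (T T' : choiceType) (e : T -> T') (f : T' -> R) : bijective e ->
  rsum (f \o e) = rsum f.
Proof. by move=> be; rewrite /rsum /psum !(esum_bij _ be). Qed.

Lemma esum_pair (T1 T2 : choiceType) (f : T1 * T2 -> R) : (forall x, 0 <= f x) ->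
  es f = (\esum_(x in [set: T1]) \esum_(y in [set: T2]) (f (x, y))%:E)%E.
Proof.
move=> f0; rewrite (@esum_esum _ _ _ setT (fun=> setT) (fun x y => (f (x, y))%:E)).
  rewrite (_ : [set: T1] `*`` _ = setT); last by apply/seteqP; split => -[].
  by apply: eq_esum => -[].
by move=> i j _ _; rewrite lee_fin.
Qed.

Lemma summ_pairP (T1 T2 : choiceType) (f : T1 * T2 -> R) (g : T1 -> R) :
  (forall x, summ (fun y => f (x, y))) ->
  (forall x, psum (fun y => `|f (x, y)|) <= g x) -> summ g -> summ f.
Proof.
move=> sf fg sg; rewrite /summ esum_pair; last by move=> x.
apply: le_lt_trans sg; apply: le_esum => x _.
rewrite psumE//; last exact/summ_abs.
by rewrite lee_fin (le_trans (fg x))// ler_norm.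
Qed.

Lemma summ_pair1 (T1 T2 : choiceType) (f : T1 * T2 -> R) x :
  summ f -> summ (fun y => f (x, y)).
Proof.
rewrite /summ esum_pair; last by move=> ?.
apply: le_lt_trans; rewrite -[leLHS](@esum_set1 _ _ x (fun x =>
  \esum_(y in [set: T2]) (`|f (x, y)|)%:E)%E); last first.
  by apply: esum_ge0 => y _; rewrite lee_fin.
rewrite [leRHS](esumID [set x])/=; last first.
  by move=> i _; apply: esum_ge0 => y _; rewrite lee_fin.
rewrite setTI leeDl//; apply: esum_ge0 => i _.
by apply: esum_ge0 => y _; rewrite lee_fin.
Qed.

Lemma summ_pair2 (T1 T2 : choiceType) (f : T1 * T2 -> R) :
  summ f -> summ (fun x => psum (fun y => `|f (x, y)|)).
Proof.
move=> sf; have := sf; rewrite {1}/summ esum_pair; last by move=> ?.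
apply: le_lt_trans; apply: le_esum => x _; rewrite ger0_norm; last exact: psum_ge0.
by rewrite psumE//; apply/summ_abs; exact: summ_pair1.
Qed.

Lemma psum_pair (T1 T2 : choiceType) (f : T1 * T2 -> R) : (forall x, 0 <= f x) ->
  summ f -> psum f = psum (fun x => psum (fun y => f (x, y))).
Proof.
move=> f0 sf; rewrite {1}/psum esum_pair//; congr fine.
apply: eq_esum => x _; rewrite psumE//; exact: summ_pair1.
Qed.

Lemma rsum_pair (T1 T2 : choiceType) (f : T1 * T2 -> R) :
  summ f -> rsum f = rsum (fun x => rsum (fun y => f (x, y))).
Proof.
move=> sf.
have sp : summ (fun x => Num.max (f x) 0) by exact: summ_pos.
have sn : summ (fun x => Num.max (- f x) 0) by apply: summ_pos; exact: summN.
rewrite [RHS](@rsum_diff _ _ (fun x => psum (fun y => Num.max (f (x, y)) 0))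
  (fun x => psum (fun y => Num.max (- f (x, y)) 0))).
- by rewrite /rsum !psum_pair//; move=> x; exact: maxr0_ge0.
- by move=> x; apply: psum_ge0 => y; exact: maxr0_ge0.
- by move=> x; apply: psum_ge0 => y; exact: maxr0_ge0.
- move/summ_pair2: sp; apply: summ_le => x; rewrite ger0_norm.
    by under eq_psum do rewrite -(ger0_norm (maxr0_ge0 _)).
  by apply: psum_ge0 => y; exact: maxr0_ge0.
- move/summ_pair2: sn; apply: summ_le => x; rewrite ger0_norm.
    by under eq_psum do rewrite -(ger0_norm (maxr0_ge0 _)).
  by apply: psum_ge0 => y; exact: maxr0_ge0.
- by [].
Qed.

Lemma rsum_single (T : choiceType) (f : T -> R) x0 :
  (forall x, x != x0 -> f x = 0) -> summ f /\ rsum f = f x0.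
Proof.
have H (g : T -> R) : (forall x, 0 <= g x) -> (forall x, x != x0 -> g x = 0) ->
    es g = (g x0)%:E.
  move=> g0 gz; rewrite (esumID [set x0])/=; last by move=> x _; rewrite lee_fin.
  rewrite setTI esum_set1 ?lee_fin// esum1 ?adde0// => x [_ /= /eqP xx0].
  by rewrite gz//; apply/eqP => h; apply: xx0; rewrite h.
move=> fz; split.
  by rewrite /summ H// ?ltry// => x /fz ->; rewrite normr0.
rewrite /rsum /psum !H; try (by move=> x; exact: maxr0_ge0);
  try (by move=> x /fz ->; rewrite ?oppr0 maxxx).
by rewrite /= maxrB.
Qed.

(** Finite partial sums approach the sum, which is their supremum. *)
Lemma psum_tail (T : choiceType) (g : T -> R) e : (forall x, 0 <= g x) -> summ g ->
  0 < e -> exists A : {fset T}, psum (fun x => if x \in A then 0 else g x) <= e.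
Proof.
move=> g0 sg e0.
have hs : es g = (psum g)%:E by exact: psumE.
have : ((psum g - e)%:E < es g)%E by rewrite hs lte_fin; lra.
move=> /ereal_sup_gt[_ [X [finX _] <-]] h.
exists (fset_set X).
have sI : summ (fun x => if x \in fset_set X then g x else 0).
  by apply: summ_le sg => x; case: ifP; rewrite ?normr0// ger0_norm.
have sO : summ (fun x => if x \in fset_set X then 0 else g x).
  by apply: summ_le sg => x; case: ifP; rewrite ?normr0// ger0_norm.
have : psum g = psum (fun x => (if x \in fset_set X then g x else 0)
    + (if x \in fset_set X then 0 else g x)).
  by apply: eq_psum => x; case: ifP; rewrite ?addr0 ?add0r.
rewrite psumD//; try by move=> x; case: ifP.
suff : psum g - e <= psum (fun x => if x \in fset_set X then g x else 0).
  by move=> h1 h2; rewrite -(lerD2l (psum (fun x => if x \in fset_set X then g x else 0))) -h2 -lerBlDr.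
rewrite -lee_fin -psumE//; last by move=> x; case: ifP.
apply: (le_trans (ltW h)); apply: esum_ge; exists X; first by split.
rewrite [leRHS](eq_fsbigr (fun x => (g x)%:E))// => x Xx.
by rewrite in_fset_set// Xx.
Qed.

Lemma psum_fset (T : choiceType) (g : T -> R) (A : {fset T}) :
  (forall x, 0 <= g x) ->
  summ (fun x => if x \in A then g x else 0) /\
  psum (fun x => if x \in A then g x else 0) = \sum_(x <- A) g x.
Proof.
move=> g0.
have H : es (fun x => if x \in A then g x else 0) = (\sum_(x <- A) g x)%:E.
  rewrite (esumID [set` A])/=; last by move=> x _; case: ifP; rewrite lee_fin.
  rewrite setTI esum_fset//; last by move=> x _; case: ifP; rewrite lee_fin.
  rewrite esum1 ?adde0; last by move=> x [_ /= /negP/negbTE ->].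
  rewrite fsbig_finite//= set_fsetK -sumEFin big_seq [RHS]big_seq.
  by apply: eq_bigr => x ->.
split; last by rewrite /psum H.
apply: (@summ_esum _ _ (\sum_(x <- A) g x)); last by rewrite H.
by move=> x; case: ifP.
Qed.

(** Dominated convergence for sums (Tannery's theorem). *)
Lemma psum_tannery (T : choiceType) (f : nat -> T -> R) (g : T -> R) :
  (forall n x, 0 <= f n x) -> (forall n x, f n x <= g x) -> summ g ->
  (forall x, f n x @[n --> \oo] --> 0) -> psum (f n) @[n --> \oo] --> 0.
Proof.
move=> f0 fg sg fx.
have g0 x : 0 <= g x by exact: le_trans (f0 0%N x) (fg 0%N x).
have sf n : summ (f n) by apply: summ_le sg => x; rewrite ger0_norm.
apply/cvgrPdist_le => e e0.
have [A hA] := psum_tail g0 sg (divr_gt0 e0 (ltr0n _ 2)).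
have : \sum_(x <- A) f n x @[n --> \oo] --> \sum_(x <- A) (0 : R).
  elim: (enum_fset A) => [|x s IH].
    by under eq_fun do rewrite big_nil; rewrite big_nil; exact: cvg_cst.
  by under eq_fun do rewrite big_cons; rewrite big_cons; exact: cvgD.
rewrite big1// => /cvgrPdist_le/(_ _ (divr_gt0 e0 (ltr0n _ 2))).
apply: filterS => n; rewrite !sub0r !normrN.
have Sp : 0 <= \sum_(x <- A) f n x by apply: sumr_ge0.
rewrite (ger0_norm Sp) (ger0_norm (psum_ge0 _))// => hn.
have [sI EI] := @psum_fset _ (f n) A (f0 n).
have sO : summ (fun x => if x \in A then 0 else f n x).
  by apply: summ_le (sf n) => x; case: ifP; rewrite ?normr0// ger0_norm.
rewrite (@eq_psum _ _ (fun x => (if x \in A then f n x else 0)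
    + (if x \in A then 0 else f n x))); last first.
  by move=> x; case: ifP; rewrite ?addr0 ?add0r.
rewrite psumD//; try by move=> x; case: ifP.
rewrite EI.
have : psum (fun x => if x \in A then 0 else f n x) <=
       psum (fun x => if x \in A then 0 else g x).
  apply: le_psum; [by move=> x; case: ifP|by move=> x; case: ifP|].
  by apply: summ_le sg => x; case: ifP; rewrite ?normr0// ger0_norm.
by lra.
Qed.

End RealSums.

Section ComplexSums.
Context {R : realType}.
Local Notation C := R[i].

Definition csummable (T : choiceType) (f : T -> C) := summ (fun x => cabs (f x)).

Definition csum (T : choiceType) (f : T -> C) : C :=
  Complex (rsum (fun x => Re (f x))) (rsum (fun x => Im (f x))).

Lemma eq_csum (T : choiceType) (f g : T -> C) : f =1 g -> csum f = csum g.
Proof. by move=> /funext ->. Qed.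

Lemma eq_csummable (T : choiceType) (f g : T -> C) : f =1 g ->
  csummable f -> csummable g.
Proof. by move=> /funext ->. Qed.

Lemma csummable_le (T : choiceType) (f : T -> C) (g : T -> R) :
  (forall x, cabs (f x) <= g x) -> summ g -> csummable f.
Proof.
by move=> fg; apply: summ_le => x; rewrite ger0_norm ?cabs_ge0.
Qed.

Lemma csummable_Re (T : choiceType) (f : T -> C) : csummable f ->
  summ (fun x => Re (f x)).
Proof. by apply: summ_le => x; exact: cabs_Re. Qed.

Lemma csummable_Im (T : choiceType) (f : T -> C) : csummable f ->
  summ (fun x => Im (f x)).
Proof. by apply: summ_le => x; exact: cabs_Im. Qed.

Lemma csummableD (T : choiceType) (f g : T -> C) : csummable f -> csummable g ->
  csummable (fun x => f x + g x).
Proof.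
move=> sf sg; apply: csummable_le (summD sf sg) => x; exact: cabsD.
Qed.

Lemma csummableZ (T : choiceType) (f : T -> C) c : csummable f ->
  csummable (fun x => c * f x).
Proof.
by move=> /(summZ (cabs c)) sf; apply: csummable_le sf => x; rewrite cabsM.
Qed.

Lemma csumD (T : choiceType) (f g : T -> C) : csummable f -> csummable g ->
  csum (fun x => f x + g x) = csum f + csum g.
Proof.
move=> sf sg; rewrite /csum; simpc; congr (Complex _ _).
  rewrite -rsumD; [|exact: csummable_Re|exact: csummable_Re].
  by apply: eq_rsum => x; case: (f x) (g x) => ? ? [].
rewrite -rsumD; [|exact: csummable_Im|exact: csummable_Im].
by apply: eq_rsum => x; case: (f x) (g x) => ? ? [].
Qed.

Lemma csumZ (T : choiceType) (f : T -> C) c : csummable f ->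
  csum (fun x => c * f x) = c * csum f.
Proof.
move=> sf; have sR := csummable_Re sf; have sI := csummable_Im sf.
case: c => a b; rewrite /csum; simpc; congr (Complex _ _).
  rewrite -!rsumZ// -rsumN; last exact: summZ.
  rewrite -rsumD; [|exact: summZ|by apply: summN; exact: summZ].
  by apply: eq_rsum => x; case: (f x).
rewrite -!rsumZ// -rsumD; [|exact: summZ|exact: summZ].
by apply: eq_rsum => x; case: (f x).
Qed.

Lemma csumN (T : choiceType) (f : T -> C) : csummable f ->
  csum (fun x => - f x) = - csum f.
Proof.
move=> sf; rewrite -mulN1r -csumZ//; apply: eq_csum => x; by rewrite mulN1r.
Qed.

Lemma csummableN (T : choiceType) (f : T -> C) : csummable f ->
  csummable (fun x => - f x).
Proof. by apply: csummable_le => x; rewrite cabsN. Qed.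

Lemma csumB (T : choiceType) (f g : T -> C) : csummable f -> csummable g ->
  csum (fun x => f x - g x) = csum f - csum g.
Proof. by move=> sf sg; rewrite csumD ?csumN//; exact: csummableN. Qed.

Lemma csum_single (T : choiceType) (f : T -> C) x0 :
  (forall x, x != x0 -> f x = 0) -> csummable f /\ csum f = f x0.
Proof.
move=> fz; split.
  by apply: (rsum_single (x0 := x0) _).1 => x /fz ->; rewrite cabs0.
rewrite /csum !(rsum_single (x0 := x0) _).2; [by case: (f x0)| |];
  by move=> x /fz ->.
Qed.

Lemma csummable0 (T : choiceType) : csummable (fun=> 0 : C) (T := T).
Proof. by rewrite /csummable /summ esum1// => x _; rewrite cabs0 normr0. Qed.

Lemma csum0 (T : choiceType) : csum (fun=> 0 : C) (T := T) = 0.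
Proof.
have h := csumZ 0 (@csummable0 T); rewrite mul0r in h.
by rewrite h mul0r.
Qed.

Lemma csum_sum (T : choiceType) (I : Type) (r : seq I) (F : I -> T -> C) :
  (forall i, csummable (F i)) ->
  csummable (fun x => \sum_(i <- r) F i x) /\
  csum (fun x => \sum_(i <- r) F i x) = \sum_(i <- r) csum (F i).
Proof.
move=> sF; elim: r => [|i r [IH1 IH2]].
  rewrite big_nil; under eq_fun do rewrite big_nil; split; last exact: csum0.
  exact: csummable0.
rewrite big_cons -IH2 -csumD//.
by split; [under eq_fun do rewrite big_cons; exact: csummableD|
  apply: eq_csum => x; rewrite big_cons].
Qed.

Lemma csum_seq (T : choiceType) (s : seq T) (f : T -> C) : uniq s ->
  (forall x, x \notin s -> f x = 0) ->
  csummable f /\ csum f = \sum_(x <- s) f x.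
Proof.
move=> us fs; pose F y x := if x == y then f y else 0.
have hF y : csummable (F y) /\ csum (F y) = f y.
  have z x : x != y -> F y x = 0 by move=> /negPf; rewrite /F => ->.
  by have [h1 h2] := csum_single z; rewrite h2; split=> //; rewrite /F eqxx.
have [sf h] := csum_sum s (fun y => (hF y).1).
rewrite (eq_bigr (fun y => csum (F y))); last by move=> y _; rewrite (hF y).2.
suff E x : \sum_(y <- s) F y x = f x.
  by rewrite -h; split; [exact: eq_csummable sf|exact/esym/eq_csum].
have [xs|xs] := boolP (x \in s); last first.
  rewrite big_seq big1 ?fs// => y ys; rewrite /F; case: eqP => // xy.
  by rewrite xy ys in xs.
rewrite (bigD1_seq x)//= /F eqxx big1 ?addr0// => y.
by rewrite eq_sym => /negPf ->.
Qed.

Lemma csum_fin (T : finType) (f : T -> C) :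
  csummable f /\ csum f = \sum_x f x.
Proof.
have [|sf ->] := @csum_seq T (enum T) f (enum_uniq T).
  by move=> x; rewrite mem_enum.
by rewrite big_enum.
Qed.

Lemma cabs_csum_le (T : choiceType) (f : T -> C) : csummable f ->
  cabs (csum f) <= 2 * psum (fun x => cabs (f x)).
Proof.
move=> sf; apply: (le_trans (cabs_le_ReIm _)); rewrite /csum/=.
rewrite mulr_natl mulr2n; apply: lerD.
  apply: (le_trans (ler_norm_rsum (csummable_Re sf))).
  by apply: le_psum => // x; exact: cabs_Re.
apply: (le_trans (ler_norm_rsum (csummable_Im sf))).
by apply: le_psum => // x; exact: cabs_Im.
Qed.

Lemma csummable_bij (T T' : choiceType) (e : T -> T') (f : T' -> C) :
  bijective e -> csummable (f \o e) <-> csummable f.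
Proof. by move=> be; exact: (@summ_bij R T T' e (fun x => cabs (f x)) be). Qed.

Lemma csum_bij (T T' : choiceType) (e : T -> T') (f : T' -> C) : bijective e ->
  csum (f \o e) = csum f.
Proof.
move=> be; rewrite /csum; congr (Complex _ _).
  exact: (@rsum_bij R T T' e (fun x => Re (f x))).
exact: (@rsum_bij R T T' e (fun x => Im (f x))).
Qed.

Lemma csummable_pair1 (T1 T2 : choiceType) (f : T1 * T2 -> C) x :
  csummable f -> csummable (fun y => f (x, y)).
Proof. exact: (@summ_pair1 R T1 T2 (fun z => cabs (f z))). Qed.

Lemma csummable_pair2 (T1 T2 : choiceType) (f : T1 * T2 -> C) :
  csummable f -> csummable (fun x => csum (fun y => f (x, y))).
Proof.
move=> sf; have := summZ 2 (@summ_pair2 R T1 T2 (fun z => cabs (f z)) sf).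
apply: csummable_le => x; apply: (le_trans (cabs_csum_le _)).
  exact: csummable_pair1.
by rewrite ler_wpM2l// le_psum//; [move=> y; exact: cabs_ge0|
  move=> y; exact: ler_norm|apply: summ_abs; exact: csummable_pair1].
Qed.

Lemma csum_pair (T1 T2 : choiceType) (f : T1 * T2 -> C) :
  csummable f -> csum f = csum (fun x => csum (fun y => f (x, y))).
Proof.
move=> sf; rewrite /csum; congr (Complex _ _).
  by rewrite rsum_pair//; exact: csummable_Re.
by rewrite rsum_pair//; exact: csummable_Im.
Qed.

Lemma swap_bij (T1 T2 : Type) : bijective (fun z : T1 * T2 => (z.2, z.1)).
Proof. by exists (fun z => (z.2, z.1)) => -[]. Qed.

Lemma csummable_swap (T1 T2 : choiceType) (f : T1 * T2 -> C) :
  csummable f -> csummable (fun z : T2 * T1 => f (z.2, z.1)).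
Proof. by move/(csummable_bij f (swap_bij T2 T1)). Qed.

Lemma csum_swap (T1 T2 : choiceType) (f : T1 * T2 -> C) : csummable f ->
  csum (fun x => csum (fun y => f (x, y))) =
  csum (fun y => csum (fun x => f (x, y))).
Proof.
move=> sf; rewrite -csum_pair// -(csum_bij f (swap_bij T2 T1)) csum_pair//.
exact: (csummable_swap sf).
Qed.

Lemma csummable_pairP (T1 T2 : choiceType) (f : T1 * T2 -> C) (g : T1 -> R) :
  (forall x, csummable (fun y => f (x, y))) ->
  (forall x, psum (fun y => cabs (f (x, y))) <= g x) -> summ g -> csummable f.
Proof.
move=> sf fg sg; apply: (@summ_pairP _ _ _ _ g) => // x.
by under eq_psum do rewrite ger0_norm ?cabs_ge0//.
Qed.

Lemma csum_tannery (T : choiceType) (f : nat -> T -> C) (g : T -> R) :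
  (forall n x, cabs (f n x) <= g x) -> summ g ->
  (forall x, cabs (f n x) @[n --> \oo] --> (0 : R)) ->
  cabs (csum (f n)) @[n --> \oo] --> (0 : R).
Proof.
move=> fg sg fx.
have h : 2 * psum (fun x => cabs (f n x)) @[n --> \oo] --> (2 * 0 : R).
  apply: cvgM; first exact: cvg_cst.
  apply: (@psum_tannery _ _ (fun n x => cabs (f n x)) g) => //.
  by move=> n x; exact: cabs_ge0.
rewrite mulr0 in h; apply: (squeeze_cvgr _ (cvg_cst 0) h).
near=> n; rewrite cabs_ge0/= cabs_csum_le//; exact: csummable_le (fg n) sg.
Unshelve. all: by end_near. Qed.

Lemma has_sumP (v : nat -> C) (l : C) :
  cabs (series v n - l) @[n --> \oo] --> (0 : R) <-> has_sum v l.
Proof.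
rewrite /has_sum; move: (series v) => u.
have nE (z : C) : `|z| = (cabs z)%:C by [].
split.
  move=> /cvgrPdist_lt h; apply/cvgrPdist_lt => e e0.
  have eE : e = (Re e)%:C by rewrite RRe_real// gtr0_real.
  have e1 : 0 < Re e by rewrite -ltcR -eE.
  have := h _ e1; apply: filterS => n.
  by rewrite sub0r normrN ger0_norm ?cabs_ge0// -cabsN opprB nE eE ltcR.
move=> /cvgrPdist_lt h; apply/cvgrPdist_lt => e e0.
have e1 : 0 < (e%:C : C) by rewrite ltcR.
have := h _ e1; apply: filterS => n.
by rewrite nE ltcR => h1; rewrite sub0r normrN ger0_norm ?cabs_ge0// -cabsN opprB.
Qed.

(** The partial sums of a series differ from its sum by tails, which Tannery's
    theorem sends to 0. *)
Lemma csum_has_sum (u : nat -> C) : csummable u -> has_sum u (csum u).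
Proof.
move=> su; apply/has_sumP.
pose f n k : C := if (k < n)%N then 0 else - u k.
have fE n : series u n - csum u = csum (f n).
  have [h1 h2] := @csum_sum nat _ (iota 0 n) (fun i k => if k == i then u i else 0)
    (fun i => (@csum_single nat (fun k => if k == i then u i else 0) i
       (fun k => ltac:(by move=> /negbTE ->))).1).
  have uE k : u k = \sum_(i <- iota 0 n) (if k == i then u i else 0) - f n k.
    rewrite /f; case: ltnP => kn; last first.
      rewrite opprK big_seq big1 ?add0r// => i; rewrite mem_iota add0n => /= ilt.
      by case: eqP => // ki; move: ilt; rewrite -ki ltnNge kn.
    rewrite subr0 (bigD1_seq k)/= ?iota_uniq ?mem_iota//= eqxx big1 ?addr0//.
    by move=> i; rewrite eq_sym => /negbTE ->.
  have sf : csummable (f n).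
    by apply: csummable_le su => k; rewrite /f; case: ifP; rewrite ?cabs0 ?cabs_ge0 ?cabsN.
  rewrite (eq_csum uE) csumB// h2 seriesEnat/= /index_iota subn0.
  have -> : \sum_(i <- iota 0 n) csum (fun k => if k == i then u i else 0) =
      \sum_(i <- iota 0 n) u i.
    apply: eq_bigr => i _; rewrite (@csum_single nat _ i _).2 ?eqxx//.
    by move=> k /negbTE ->.
  by rewrite opprB addrC subrK.
under eq_fun do rewrite fE.
apply: (csum_tannery (g := fun k => cabs (u k))) => //.
  by move=> n k; rewrite /f; case: ifP; rewrite ?cabs0 ?cabs_ge0 ?cabsN.
move=> k; apply: cvg_near_cst; exists k.+1 => // n /= kn.
by rewrite /f kn cabs0.
Qed.

(** Grouping the terms of a family along a numbering of its indices. *)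
Lemma csum_fiber (T : choiceType) (F : T -> C) (v : T -> nat) : csummable F ->
  let u j := csum (fun x => if v x == j then F x else 0) in
  csummable u /\ csum F = csum u.
Proof.
move=> sF u.
pose G (z : T * nat) : C := if v z.1 == z.2 then F z.1 else 0.
have G1 x := @csum_single nat (fun j => G (x, j)) (v x)
  (fun j => ltac:(by rewrite /G/= eq_sym => /negbTE ->)).
have sG : csummable G.
  apply: (csummable_pairP (g := fun x => cabs (F x))) => // x; first exact: (G1 x).1.
  have [h1 h2] := @rsum_single R nat (fun j => cabs (G (x, j))) (v x)
    (fun j => ltac:(by rewrite /G/= eq_sym => /negbTE ->; rewrite cabs0)).
  rewrite -rsum_ge0E//; last by move=> j; exact: cabs_ge0.
  by rewrite h2 /G/= eqxx.
split; first exact: (csummable_pair2 (csummable_swap sG)).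
rewrite -(csum_swap sG); apply: eq_csum => x.
by rewrite (G1 x).2 /G/= eqxx.
Qed.

End ComplexSums.

(** * Gaussian Riemann sums and contour independence *)

Section GaussianSums.
Context {R : realType}.
Local Notation C := R[i].
Implicit Types (x : R) (z s w : C).

Definition eta z : C := cex (- (pi%:C * z ^+ 2)).

Definition qdecay x : R := (1 + x ^+ 2)^-1.

Lemma qdecay_gt0 x : 0 < qdecay x.
Proof. by rewrite invr_gt0; have := sqr_ge0 x; lra. Qed.

Lemma eqr_lex (a b : R) : a = b -> a <= b. Proof. by move->. Qed.

Lemma ReZ x z : Re (x%:C * z) = x * Re z.
Proof. by case: z => a b; simpc. Qed.

Lemma ImZ x z : Im (x%:C * z) = x * Im z.
Proof. by case: z => a b; simpc. Qed.

Lemma ReN z : Re (- z) = - Re z. Proof. by case: z. Qed.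

Lemma cabs_eta z : cabs (eta z) = expR (- (pi * Re (z ^+ 2))).
Proof. by rewrite /eta cabs_cex ReN ReZ. Qed.

(** Complete the square, then use that exp t >= 1 + t. *)
Lemma gauss_le_qdecay (b c : R) : 0 < b ->
  exists2 K, 0 <= K & forall x, expR (- (b * x ^+ 2) + c * `|x|) <= K * qdecay x.
Proof.
move=> b0; exists (expR (c ^+ 2 / (2 * b)) * (1 + 2 / b)).
  by rewrite mulr_ge0 ?expR_ge0// addr_ge0// divr_ge0// ltW.
move=> x.
have bn0 : b != 0 by rewrite gt_eqF.
have h1 : - (b * x ^+ 2) + c * `|x| <= c ^+ 2 / (2 * b) - b / 2 * x ^+ 2.
  rewrite -subr_ge0.
  have -> : c ^+ 2 / (2 * b) - b / 2 * x ^+ 2 - (- (b * x ^+ 2) + c * `|x|) =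
      b / 2 * (`|x| - c / b) ^+ 2.
    rewrite -(real_normK (num_real x)); field; exact: bn0.
  by rewrite mulr_ge0 ?sqr_ge0// divr_ge0// ltW.
apply: (@le_trans _ _ (expR (c ^+ 2 / (2 * b) - b / 2 * x ^+ 2))).
  by rewrite ler_expR.
rewrite expRB -[leRHS]mulrA ler_wpM2l ?expR_ge0//.
rewrite /qdecay ler_pdivlMr; last by have := sqr_ge0 x; lra.
rewrite mulrC ler_pdivrMr ?expR_gt0//.
have x2 := sqr_ge0 x.
apply: (@le_trans _ _ ((1 + 2 / b) * (1 + b / 2 * x ^+ 2))).
  have -> : (1 + 2 / b) * (1 + b / 2 * x ^+ 2) = 1 + x ^+ 2 + 2 / b + b / 2 * x ^+ 2.
    by field; exact: bn0.
  have : 0 <= 2 / b by rewrite divr_ge0// ltW.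
  have : 0 <= b / 2 * x ^+ 2 by rewrite mulr_ge0// divr_ge0// ltW.
  by lra.
rewrite ler_wpM2l ?expR_ge1Dx//.
by rewrite addr_ge0// divr_ge0// ltW.
Qed.

Lemma Re_sqr_line s w x : Re ((s * x%:C + w) ^+ 2) =
  x ^+ 2 * Re (s ^+ 2) + 2 * x * Re (s * w) + Re (w ^+ 2).
Proof. by case: s w => a b [c d]; rewrite !expr2; simpc => /=; ring. Qed.

(** Uniform Gaussian decay of [eta] along all lines whose direction stays in a
    compact part of the cone [0 < Re (s ^+ 2)], with room for a polynomial. *)
Lemma eta_le (m S V : R) : 0 < m -> 0 <= S -> 0 <= V ->
  exists2 K, 0 <= K & forall s w x u, m <= Re (s ^+ 2) -> cabs s <= S ->
    cabs w <= V -> `|u| <= 1 ->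
    cabs (eta (s * (x + u)%:C + w)) * expR (6 * `|x|) <= K * qdecay x.
Proof.
move=> m0 S0 V0; have p0 : (0 : R) < pi by exact: pi_gt0.
have [K K0 HK] := @gauss_le_qdecay (pi * m)
  (2 * pi * m + 2 * pi * (S * V) + 6) (mulr_gt0 p0 m0).
exists (expR (pi * (2 * (S * V) + V ^+ 2)) * K).
  by rewrite mulr_ge0 ?expR_ge0.
move=> s w x u ms sS wV u1.
rewrite cabs_eta -expRD -mulrA; apply: (le_trans _ (ler_wpM2l (expR_ge0 _) (HK x))).
rewrite -expRD ler_expR Re_sqr_line.
have SV : 0 <= S * V by rewrite mulr_ge0.
have b1 : `|Re (s * w)| <= S * V.
  by rewrite (le_trans (cabs_Re _))// cabsM ler_pM ?cabs_ge0.
have b2 : `|Re (w ^+ 2)| <= V ^+ 2.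
  by rewrite (le_trans (cabs_Re _))// cabsX lerXn2r ?nnegrE ?cabs_ge0.
have xu : `|x + u| <= `|x| + 1 by rewrite (le_trans (ler_normD _ _))// lerD2l.
have b3 : - (2 * (x + u) * Re (s * w)) <= 2 * ((`|x| + 1) * (S * V)).
  have : `|(x + u) * Re (s * w)| <= (`|x| + 1) * (S * V) by rewrite normrM ler_pM.
  by rewrite ler_norml => /andP[]; lra.
have b4 : x ^+ 2 - 2 * `|x| <= (x + u) ^+ 2.
  have : `|x * u| <= `|x| by rewrite normrM -{2}(mulr1 `|x|) ler_wpM2l.
  by rewrite ler_norml => /andP[]; have := sqr_ge0 u; rewrite sqrrD; lra.
have b5 : m * (x ^+ 2 - 2 * `|x|) <= (x + u) ^+ 2 * Re (s ^+ 2).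
  apply: (@le_trans _ _ (m * (x + u) ^+ 2)); first by rewrite ler_pM2l.
  by rewrite mulrC ler_wpM2l// sqr_ge0.
move: b2; rewrite ler_norml => /andP[b2 _].
have : - ((x + u) ^+ 2 * Re (s ^+ 2) + 2 * (x + u) * Re (s * w) + Re (w ^+ 2)) <=
  - (m * (x ^+ 2 - 2 * `|x|)) + 2 * ((`|x| + 1) * (S * V)) + V ^+ 2 by lra.
move=> /(ler_wpM2l (ltW p0)); rewrite mulrN => h.
rewrite -lerBrDr; apply: (le_trans h); apply: eqr_lex.
by ring.
Qed.

(** Second order expansion of the Gaussian; as in [cex_bound2_max] the error is
    controlled by the values at the two end points, both of which decay. *)
Lemma eta_taylor z e (d : R) : pi * cabs e * (2 * cabs z + cabs e) <= d ->
  cabs (eta (z + e) - eta z + 2 * pi%:C * z * e * eta z) <=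
  (cabs (eta z) + cabs (eta (z + e))) * (4 * d ^+ 2 + pi * cabs e ^+ 2).
Proof.
have p0 : (0 : R) < pi by exact: pi_gt0.
have p0' : (0 : R) <= pi by exact: pi_ge0.
pose a := - (pi%:C * (2 * z * e + e ^+ 2)).
have etaD : eta (z + e) = eta z * cex a.
  by rewrite /eta -cexD; congr cex; rewrite /a; ring.
move=> ad.
have ha : cabs a <= d.
  apply: le_trans ad.
  rewrite /a (_ : 2 * z * e + e ^+ 2 = e * (2 * z + e)); last by ring.
  rewrite cabsN !cabsM cabsR (ger0_norm (ltW p0)) -[leRHS]mulrA.
  rewrite ler_wpM2l// ler_wpM2l ?cabs_ge0//.
  by rewrite (le_trans (cabsD _ _))// cabsM cabs_natr.
have d0 : 0 <= d by rewrite (le_trans (cabs_ge0 a)).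
have -> : eta (z + e) - eta z + 2 * pi%:C * z * e * eta z =
    eta z * (cex a - 1 - a) - eta z * (pi%:C * e ^+ 2).
  by rewrite etaD /a; ring.
apply: (le_trans (cabsB _ _)); rewrite !cabsM (cabsR pi) (ger0_norm p0') -expr2.
have h1 : cabs (eta z) * cabs (cex a - 1 - a) <=
    (cabs (eta z) + cabs (eta (z + e))) * (4 * d ^+ 2).
  apply: (@le_trans _ _ (cabs (eta z) * (4 * d ^+ 2 * Num.max 1 (expR (Re a))))).
    rewrite ler_wpM2l ?cabs_ge0//; apply: (le_trans (cex_bound2_max a)).
    rewrite ler_wpM2r// ?le_max ?ler01// ler_wpM2l// lerXn2r// nnegrE ?cabs_ge0//.
  rewrite mulrCA [leRHS]mulrC ler_wpM2l//; first by rewrite mulr_ge0// exprn_ge0.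
  rewrite etaD cabsM cabs_cex maxEle; case: ifP => _; rewrite ?mulr1.
    by rewrite lerDr cabs_ge0.
  by rewrite lerDl mulr_ge0// ?cabs_ge0// expR_ge0.
have h2 : cabs (eta z) * (pi * cabs e ^+ 2) <=
    (cabs (eta z) + cabs (eta (z + e))) * (pi * cabs e ^+ 2).
  rewrite ler_wpM2r ?lerDl ?cabs_ge0//.
  by rewrite mulr_ge0 ?exprn_ge0 ?cabs_ge0//.
by rewrite mulrDr lerD.
Qed.

Lemma expr_le_exp6 x : (1 + `|x|) ^+ 6 <= expR (6 * `|x|).
Proof. by rewrite expRM_natl lerXn2r ?nnegrE ?addr_ge0 ?expR_ge0// expR_ge1Dx. Qed.

Lemma le_cabs3 (a b c d : C) : cabs (a - b + c + d) <=
  cabs a + cabs b + cabs c + cabs d.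
Proof.
apply: (le_trans (cabsD _ _)); rewrite lerD2r.
by apply: (le_trans (cabsD _ _)); rewrite lerD2r cabsB.
Qed.

(** One step of a contour deformation: to first order, moving the line
    [t |-> s * t + w] changes the integrand by a difference quotient, which
    disappears once summed over the lattice. *)
Lemma contour_step_pointwise (m S V : R) : 0 < m -> 0 <= S -> 0 <= V ->
  exists2 K, 0 <= K & forall (h : R) s0 w0 s1 w1 ds dw x, 0 < h -> h <= 1 ->
    s1 = s0 + h%:C * ds -> w1 = w0 + h%:C * dw ->
    m <= Re (s0 ^+ 2) -> m <= Re (s1 ^+ 2) -> cabs s0 <= S -> cabs s1 <= S ->
    cabs w0 <= V -> cabs w1 <= V -> cabs ds <= 2 * S -> cabs dw <= 2 * V ->
    cabs (s1 * eta (s1 * x%:C + w1) - s0 * eta (s0 * x%:C + w0)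
      - ((ds * (x + h)%:C + dw) * eta (s0 * (x + h)%:C + w0)
         - (ds * x%:C + dw) * eta (s0 * x%:C + w0))) <= K * h ^+ 2 * qdecay x.
Proof.
move=> m0 S0 V0; have p0 : (0 : R) < pi by exact: pi_gt0.
have p0' : (0 : R) <= pi by exact: pi_ge0.
have [K K0 HK] := eta_le m0 S0 V0.
(* C1 bounds the two Taylor remainders, C2 the whole error; all powers of X
   that occur are at most X ^+ 6, which the Gaussian absorbs. *)
pose B := 1 + S + V.
pose C1 := 256 * pi ^+ 2 * B ^+ 4 + 4 * pi * B ^+ 2.
pose C2 := 7 * B * C1 + 12 * pi * B ^+ 3.
have B1 : 1 <= B by rewrite /B; lra.
have B0 : 0 <= B by lra.
have C10 : 0 <= C1.
  by rewrite /C1 addr_ge0// !mulr_ge0// ?exprn_ge0//.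
have C20 : 0 <= C2.
  by rewrite /C2 addr_ge0// !mulr_ge0// ?exprn_ge0//.
exists (C2 * (3 * K)); first by rewrite !mulr_ge0.
move=> h s0 w0 s1 w1 ds dw x h0 h1; have h0' := ltW h0; move=> s1E w1E ms0 ms1 sS0 sS1 wV0 wV1 dsS dwV.
pose X := 1 + `|x|.
have X1 : 1 <= X by rewrite /X lerDl.
have X0 : 0 <= X by lra.
pose y := s0 * x%:C + w0; pose k := ds * x%:C + dw.
have y1E : s1 * x%:C + w1 = y + h%:C * k by rewrite s1E w1E /y /k; ring.
have y2E : s0 * (x + h)%:C + w0 = y + h%:C * s0.
  by rewrite rmorphD/= /y; ring.
have kE : ds * (x + h)%:C + dw = k + h%:C * ds.
  by rewrite rmorphD/= /k; ring.
rewrite y1E y2E kE -/y -/k.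
pose E := cabs (eta y) + cabs (eta (y + h%:C * k)) + cabs (eta (y + h%:C * s0)).
have E0 : 0 <= E by rewrite !addr_ge0 ?cabs_ge0.
have hE : E * X ^+ 6 <= 3 * K * qdecay x.
  apply: (@le_trans _ _ (E * expR (6 * `|x|))).
    by rewrite ler_wpM2l// expr_le_exp6.
  have a1 := HK s0 w0 x 0 ms0 sS0 wV0; rewrite normr0 ler01 addr0 -/y in a1.
  have a2 := HK s1 w1 x 0 ms1 sS1 wV1; rewrite normr0 ler01 addr0 y1E in a2.
  have a3 := HK s0 w0 x h ms0 sS0 wV0; rewrite y2E (ger0_norm h0') in a3.
  have := a1 isT; have := a2 isT; have := a3 h1; rewrite /E !mulrDl; lra.
have yB : cabs y <= B * X.
  apply: (le_trans (cabsD _ _)); rewrite cabsM cabsR.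
  have : cabs s0 * `|x| <= B * `|x| by rewrite ler_wpM2r// /B; lra.
  by rewrite /X (mulrDr B) mulr1; have : cabs w0 <= B by [rewrite /B; lra]; lra.
have kB : cabs k <= 2 * B * X.
  apply: (le_trans (cabsD _ _)); rewrite cabsM cabsR.
  have : cabs ds * `|x| <= 2 * B * `|x| by rewrite ler_wpM2r// /B; lra.
  by rewrite /X (mulrDr (2 * B)) mulr1; have : cabs dw <= 2 * B by [rewrite /B; lra]; lra.
have s0B : cabs s0 <= B by rewrite /B; lra.
have dsB : cabs ds <= 2 * B by rewrite /B; lra.
have s0B' : cabs s0 <= 2 * B * X.
  have : B * 1 <= B * X by rewrite ler_wpM2l.
  by lra.
have T (e : C) : cabs e <= 2 * B * X -> cabs (eta (y + h%:C * e)) <= E - cabs (eta y) ->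
    cabs (eta (y + h%:C * e) - eta y + 2 * pi%:C * y * (h%:C * e) * eta y) <=
    E * h ^+ 2 * (C1 * X ^+ 4).
  move=> eB eE.
  have he : cabs (h%:C * e) <= h * (2 * B * X).
    by rewrite cabsM cabsR gtr0_norm// ler_wpM2l//.
  have he' : cabs (h%:C * e) <= 2 * B * X.
    apply: (le_trans he); rewrite -[leRHS]mul1r ler_wpM2r//.
    by rewrite !mulr_ge0.
  apply: (le_trans (@eta_taylor y (h%:C * e) (8 * pi * B ^+ 2 * X ^+ 2 * h) _)).
    apply: (@le_trans _ _ (pi * (h * (2 * B * X)) * (2 * (B * X) + 2 * B * X))).
      rewrite ler_pM//.
      - by rewrite mulr_ge0 ?cabs_ge0//.
      - by rewrite addr_ge0// ?mulr_ge0 ?cabs_ge0.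
      - by rewrite ler_wpM2l//.
      - by rewrite lerD// ler_wpM2l.
    by apply: eqr_lex; ring.
  rewrite -[leRHS]mulrA; apply: ler_pM.
  - by rewrite addr_ge0 ?cabs_ge0.
  - by apply: addr_ge0; apply: mulr_ge0; rewrite ?sqr_ge0.
  - by lra.
  have h2 : cabs (h%:C * e) ^+ 2 <= (h * (2 * B * X)) ^+ 2.
    by rewrite lerXn2r ?nnegrE ?cabs_ge0// !mulr_ge0//.
  apply: (@le_trans _ _ (4 * (8 * pi * B ^+ 2 * X ^+ 2 * h) ^+ 2 +
     pi * (h * (2 * B * X)) ^+ 2)).
    by rewrite lerD2l ler_wpM2l//.
  have X24 : X ^+ 2 <= X ^+ 4 by rewrite ler_weXn2l.
  have : 0 <= 4 * pi * B ^+ 2 * h ^+ 2.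
    by rewrite !mulr_ge0 ?exprn_ge0//.
  move=> /ler_wpM2l/(_ _ _ X24) h3; rewrite /C1.
  rewrite [leRHS](_ : _ = 4 * (8 * pi * B ^+ 2 * X ^+ 2 * h) ^+ 2 +
    4 * pi * B ^+ 2 * h ^+ 2 * X ^+ 4); last by ring.
  by rewrite lerD2l; apply: le_trans h3; apply: eqr_lex; ring.
have T1 := T k kB; have T2 := T s0 s0B'.
pose r1 := eta (y + h%:C * k) - eta y + 2 * pi%:C * y * (h%:C * k) * eta y.
pose r2 := eta (y + h%:C * s0) - eta y + 2 * pi%:C * y * (h%:C * s0) * eta y.
rewrite -/r1 in T1; rewrite -/r2 in T2.
have {}T1 : cabs r1 <= E * h ^+ 2 * (C1 * X ^+ 4).
  by apply: T1; rewrite /E; have := cabs_ge0 (eta (y + h%:C * s0)); lra.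
have {}T2 : cabs r2 <= E * h ^+ 2 * (C1 * X ^+ 4).
  by apply: T2; rewrite /E; have := cabs_ge0 (eta (y + h%:C * k)); lra.
have -> : s1 * eta (y + h%:C * k) - s0 * eta y -
    ((k + h%:C * ds) * eta (y + h%:C * s0) - k * eta y) =
    s0 * r1 - k * r2 + ds * h%:C ^+ 2 * (k - s0) * (- (2 * pi%:C * y * eta y))
    + ds * h%:C * (r1 - r2).
  by rewrite s1E /r1 /r2; ring.
apply: (le_trans (le_cabs3 _ _ _ _)); rewrite !cabsM !cabsN !cabsM.
rewrite !cabsR (gtr0_norm h0) (gtr0_norm p0) cabs_natr -expr2.
set r := E * h ^+ 2 * (C1 * X ^+ 4) in T1 T2.
have r0 : 0 <= r by rewrite (le_trans (cabs_ge0 r1)).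
have X46 : X ^+ 4 <= X ^+ 6 by rewrite ler_weXn2l.
have X56 : X ^+ 5 <= X ^+ 6 by rewrite ler_weXn2l.
have X26 : X ^+ 2 <= X ^+ 6 by rewrite ler_weXn2l.
have Eh : 0 <= E * h ^+ 2 by rewrite mulr_ge0// exprn_ge0//.
have HC (c t : R) : 0 <= c -> t <= X ^+ 6 ->
    c * (E * h ^+ 2 * t) <= c * (E * h ^+ 2 * X ^+ 6).
  by move=> c0 t6; apply: ler_wpM2l => //; apply: ler_wpM2l.
have U1 : cabs s0 * cabs r1 <= B * C1 * (E * h ^+ 2 * X ^+ 6).
  apply: (@le_trans _ _ (B * r)); first by rewrite ler_pM ?cabs_ge0.
  rewrite /r (_ : B * (E * h ^+ 2 * (C1 * X ^+ 4)) = B * C1 * (E * h ^+ 2 * X ^+ 4)).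
    by apply: HC; rewrite ?mulr_ge0.
  by ring.
have U2 : cabs k * cabs r2 <= 2 * B * C1 * (E * h ^+ 2 * X ^+ 6).
  apply: (@le_trans _ _ (2 * B * X * r)); first by rewrite ler_pM ?cabs_ge0.
  rewrite /r (_ : 2 * B * X * (E * h ^+ 2 * (C1 * X ^+ 4)) =
    2 * B * C1 * (E * h ^+ 2 * X ^+ 5)); last by ring.
  by apply: HC; rewrite ?mulr_ge0.
have U3 : cabs ds * h ^+ 2 * cabs (k - s0) * (2 * pi * cabs y * cabs (eta y)) <=
    12 * pi * B ^+ 3 * (E * h ^+ 2 * X ^+ 6).
  have ks : cabs (k - s0) <= 3 * B * X.
    apply: (le_trans (cabsB _ _)).
    by have : B * 1 <= B * X; [rewrite ler_wpM2l|lra].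
  apply: (@le_trans _ _ (2 * B * h ^+ 2 * (3 * B * X) * (2 * pi * (B * X) * E))).
    have h20 : 0 <= h ^+ 2 by rewrite exprn_ge0//.
    apply: ler_pM; rewrite ?mulr_ge0 ?cabs_ge0//.
      by apply: ler_pM; rewrite ?mulr_ge0 ?cabs_ge0// ler_wpM2r.
    apply: ler_pM; rewrite ?mulr_ge0 ?cabs_ge0//.
      by rewrite ler_wpM2l// mulr_ge0//.
    by rewrite /E -addrA lerDl addr_ge0 ?cabs_ge0.
  rewrite (_ : 2 * B * h ^+ 2 * (3 * B * X) * (2 * pi * (B * X) * E) =
    12 * pi * B ^+ 3 * (E * h ^+ 2 * X ^+ 2)); last by ring.
  by apply: HC; rewrite // !mulr_ge0// exprn_ge0.
have U4 : cabs ds * h * cabs (r1 - r2) <= 4 * B * C1 * (E * h ^+ 2 * X ^+ 6).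
  apply: (@le_trans _ _ (2 * B * 1 * (r + r))).
    apply: ler_pM; rewrite ?mulr_ge0 ?cabs_ge0//.
      by rewrite ler_pM ?cabs_ge0//.
    by apply: (le_trans (cabsB _ _)); rewrite lerD.
  rewrite /r (_ : 2 * B * 1 * _ = 4 * B * C1 * (E * h ^+ 2 * X ^+ 4)); last by ring.
  by apply: HC; rewrite ?mulr_ge0.
apply: (@le_trans _ _ (C2 * (E * h ^+ 2 * X ^+ 6))).
  apply: (le_trans (lerD (lerD (lerD U1 U2) U3) U4)).
  by apply: eqr_lex; rewrite /C2; ring.
rewrite (_ : C2 * (3 * K) * h ^+ 2 * qdecay x = C2 * h ^+ 2 * (3 * K * qdecay x)); last by ring.
rewrite (_ : C2 * (E * h ^+ 2 * X ^+ 6) = C2 * h ^+ 2 * (E * X ^+ 6)); last by ring.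
by rewrite ler_wpM2l// mulr_ge0// exprn_ge0//.
Qed.

End GaussianSums.

(** * The one-dimensional theta inversion formula *)

Section LatticeSums.
Context {R : realType}.
Local Notation C := R[i].

Lemma nat_psum_le (f : nat -> R) K : (forall n, 0 <= f n) ->
  (forall n, \sum_(i < n) f i <= K) ->
  (\esum_(x in [set: nat]) (f x)%:E <= K%:E)%E.
Proof.
move=> f0 fK; rewrite -nneseries_esumT; last by move=> n; rewrite lee_fin.
apply: lime_le; first by apply: is_cvg_nneseries => n _ _; rewrite lee_fin.
by apply: nearW => n; rewrite sumEFin lee_fin big_mkord.
Qed.

Lemma esum_int (f : int -> R) : (forall j, 0 <= f j) ->
  (\esum_(x in [set: int]) (f x)%:E =
   \esum_(n in [set: nat]) (f (Posz n))%:E +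
   \esum_(n in [set: nat]) (f (Negz n))%:E)%E.
Proof.
move=> f0; rewrite (esumID (range Posz)); last by move=> j _; rewrite lee_fin.
rewrite !setTI; congr (_ + _)%E; apply: reindex_esum; split => //.
- by move=> i j _ _ [].
- move=> n _; rewrite /= => -[k _]; by [].
- by move=> i j _ _ [].
- case=> n /=; first by move=> h; exfalso; apply: h; exists n.
  by move=> _; exists n.
Qed.

(** The sum is compared with a telescoping one, through
    h / (1 + (n + 1)^2 h^2) <= 2 (1 / (1 + n h) - 1 / (1 + (n + 1) h)). *)
Lemma qdecay_lattice (h : R) : 0 < h -> h <= 1 ->
  summ (fun j : int => h * qdecay (j%:~R * h)) /\
  psum (fun j : int => h * qdecay (j%:~R * h)) <= 12.
Proof.
move=> h0 h1; set f := fun j : int => h * qdecay (j%:~R * h).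
have f0 j : 0 <= f j by rewrite mulr_ge0 ?(ltW h0) ?ltW ?qdecay_gt0.
have fN n : f (Negz n) = f (Posz n.+1).
  by rewrite /f NegzE rmorphN mulNr /qdecay sqrrN.
have fP (n : nat) : \sum_(i < n.+1) f (Posz i) <= 1 + 2 * (1 - (1 + n%:R * h)^-1).
  elim: n => [|n IH].
    rewrite big_ord_recr big_ord0 /= add0r mul0r addr0 invr1 subrr mulr0 addr0.
    by rewrite /f /qdecay mul0r expr0n/= addr0 invr1 mulr1.
  rewrite big_ord_recr/=; apply: (le_trans (lerD IH (lexx _))).
  have n0 : 0 <= n%:R * h by rewrite mulr_ge0 ?ler0n// ltW.
  have q0 : 0 < 1 + (n.+1%:R * h) ^+ 2 by have := sqr_ge0 (n.+1%:R * h); lra.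
  have a0 : 0 < 1 + n%:R * h by lra.
  have b0 : 0 < 1 + n.+1%:R * h by rewrite -natr1 mulrDl; lra.
  rewrite (_ : f (Posz n.+1) = h / (1 + (n.+1%:R * h) ^+ 2)); last by [].
  have : h / (1 + (n.+1%:R * h) ^+ 2) <= 2 * ((1 + n%:R * h)^-1 - (1 + n.+1%:R * h)^-1).
    have -> : 2 * ((1 + n%:R * h)^-1 - (1 + n.+1%:R * h)^-1) =
        h * 2 / ((1 + n%:R * h) * (1 + n.+1%:R * h)).
      have := lt0r_neq0 a0; have := lt0r_neq0 b0; rewrite -natr1 => ? ?.
      by field; apply/andP; split.
    rewrite -mulrA ler_pM2l// ler_pdivlMr ?mulr_gt0// mulrC ler_pdivrMr//.
    rewrite (@le_trans _ _ ((1 + n.+1%:R * h) * (1 + n.+1%:R * h)))//.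
      by rewrite ler_wpM2r ?(ltW b0)// lerD2l ler_wpM2r ?(ltW h0)// ler_nat.
    by have := sqr_ge0 (1 - n.+1%:R * h); rewrite expr2; move: (n.+1%:R * h) => t; nra.
  by lra.
have fP3 (n : nat) : \sum_(i < n) f (Posz i) <= 6.
  case: n => [|n]; first by rewrite big_ord0.
  apply: (le_trans (fP n)).
  have : 0 <= (1 + n%:R * h)^-1.
    by rewrite invr_ge0 addr_ge0// mulr_ge0// ltW.
  by lra.
have hP := nat_psum_le (fun n => f0 (Posz n)) fP3.
have hN : (\esum_(n in [set: nat]) (f (Negz n))%:E <= 6%:E)%E.
  apply: nat_psum_le => // n.
  apply: le_trans (fP3 n.+1); rewrite big_ord_recl/=.
  have -> : \sum_(i < n) f (Negz i) = \sum_(i < n) f (Posz (lift ord0 i)).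
    by apply: eq_bigr => i _; rewrite fN.
  by rewrite lerDr.
have H : (\esum_(j in [set: int]) (f j)%:E <= 12%:E)%E.
  rewrite esum_int//; apply: le_trans (leeD hP hN) _.
  by rewrite -EFinD lee_fin; lra.
have sf : summ f by apply: summ_esum H.
by split => //; rewrite -lee_fin -psumE.
Qed.

(** Riemann sums of a function of quadratic decay, bounded uniformly in the
    mesh. *)
Lemma lattice_csummable (F : R -> C) K h : 0 < h -> h <= 1 ->
  (forall x, cabs (F x) <= K * qdecay x) ->
  csummable (fun j : int => h%:C * F (j%:~R * h)) /\
  cabs (csum (fun j : int => h%:C * F (j%:~R * h))) <= 24 * K.
Proof.
move=> h0 h1 FK; have [sq q12] := qdecay_lattice h0 h1.
have K0 : 0 <= K.
  have := le_trans (cabs_ge0 _) (FK 0).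
  by rewrite pmulr_lge0// qdecay_gt0.
have le j : cabs (h%:C * F (j%:~R * h)) <= K * (h * qdecay (j%:~R * h)).
  by rewrite cabsM cabsR gtr0_norm// mulrCA ler_wpM2l// ltW.
have sK := summZ K sq.
have sF : csummable (fun j : int => h%:C * F (j%:~R * h)) by exact: csummable_le sK.
split => //; apply: (le_trans (cabs_csum_le sF)).
have : psum (fun j : int => cabs (h%:C * F (j%:~R * h))) <= K * 12.
  apply: le_trans (ler_wpM2l K0 q12); rewrite -psumZ//.
    by apply: le_psum => // j; exact: cabs_ge0.
  by move=> j; rewrite mulr_ge0 ?(ltW h0) ?ltW ?qdecay_gt0.
by lra.
Qed.

Lemma addz1_bij : bijective (fun j : int => j + 1).
Proof. by exists (fun j => j - 1) => j; ring. Qed.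

Lemma csum_telescope (F : R -> C) K h : 0 < h -> h <= 1 ->
  (forall x, cabs (F x) <= K * qdecay x) ->
  csummable (fun j : int => h%:C * (F (j%:~R * h + h) - F (j%:~R * h))) /\
  csum (fun j : int => h%:C * (F (j%:~R * h + h) - F (j%:~R * h))) = 0.
Proof.
move=> h0 h1 FK; have [s1 _] := lattice_csummable h0 h1 FK.
set G := fun j : int => h%:C * F (j%:~R * h) in s1.
have E j : h%:C * (F (j%:~R * h + h) - F (j%:~R * h)) = (G \o (fun j : int => j + 1)) j - G j.
  by rewrite /G /= rmorphD/= mulrDl mul1r mulrBr.
have s2 : csummable (G \o (fun j : int => j + 1)).
  by apply/csummable_bij => //; exact: addz1_bij.
split; first by apply: (eq_csummable (fun j => esym (E j))); exact: csummableD (csummableN _).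
by rewrite (eq_csum E) csumB// (csum_bij _ addz1_bij) subrr.
Qed.

End LatticeSums.

Section Contour.
Context {R : realType}.
Local Notation C := R[i].
Implicit Types (s w : C).

Lemma eta_decay s w : 0 < Re (s ^+ 2) -> exists2 K, 0 <= K &
  forall (x : R) (a b : C), cabs ((a * x%:C + b) * eta (s * x%:C + w)) <=
    (cabs a + cabs b) * K * qdecay x.
Proof.
move=> s0; have [K K0 HK] := eta_le s0 (cabs_ge0 s) (cabs_ge0 w).
exists K => // x a b.
have := HK s w x 0 (lexx _) (lexx _) (lexx _); rewrite normr0 ler01 addr0.
move=> /(_ isT) h; rewrite cabsM -[leRHS]mulrA.
have h2 : cabs (a * x%:C + b) <= (cabs a + cabs b) * expR (6 * `|x|).
  apply: (le_trans (cabsD _ _)); rewrite cabsM cabsR mulrDl.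
  have e1 : `|x| <= expR (6 * `|x|).
    by have := expR_ge1Dx (6 * `|x|); have := normr_ge0 x; lra.
  have e2 : 1 <= expR (6 * `|x|).
    by have := expR_ge1Dx (6 * `|x|); have := normr_ge0 x; lra.
  apply: lerD; first by rewrite ler_wpM2l ?cabs_ge0.
  by rewrite -{1}(mulr1 (cabs b)) ler_wpM2l ?cabs_ge0.
apply: (le_trans (ler_wpM2r (cabs_ge0 _) h2)).
rewrite -[leLHS]mulrA ler_wpM2l ?addr_ge0 ?cabs_ge0//.
by rewrite mulrC.
Qed.

Lemma eta_decay0 s w : 0 < Re (s ^+ 2) -> exists2 K, 0 <= K &
  forall x : R, cabs (eta (s * x%:C + w)) <= K * qdecay x.
Proof.
move=> s0; have [K K0 HK] := eta_decay w s0; exists K => // x.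
by have := HK x 0 1; rewrite mul0r add0r !mul1r cabs0 cabs1 add0r mul1r.
Qed.

Definition riemann_sum (h : R) s w : C :=
  csum (fun j : int => h%:C * (s * eta (s * (j%:~R * h)%:C + w))).

Lemma riemann_sum_summable (h : R) s w : 0 < h -> h <= 1 -> 0 < Re (s ^+ 2) ->
  csummable (fun j : int => h%:C * (s * eta (s * (j%:~R * h)%:C + w))).
Proof.
move=> h0 h1 s0; have [K K0 HK] := eta_decay w s0.
apply: (@lattice_csummable R (fun x => s * eta (s * x%:C + w)) _ h h0 h1 _).1 => x.
by have := HK x 0 s; rewrite mul0r add0r; exact.
Qed.

Lemma contour_step (m S V : R) : 0 < m -> 0 <= S -> 0 <= V ->
  exists2 K, 0 <= K & forall (h : R) s0 w0 s1 w1 ds dw, 0 < h -> h <= 1 ->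
    s1 = s0 + h%:C * ds -> w1 = w0 + h%:C * dw ->
    m <= Re (s0 ^+ 2) -> m <= Re (s1 ^+ 2) -> cabs s0 <= S -> cabs s1 <= S ->
    cabs w0 <= V -> cabs w1 <= V -> cabs ds <= 2 * S -> cabs dw <= 2 * V ->
    cabs (riemann_sum h s1 w1 - riemann_sum h s0 w0) <= K * h ^+ 2.
Proof.
move=> m0 S0 V0; have [K K0 HK] := contour_step_pointwise m0 S0 V0.
exists (24 * K); first by rewrite mulr_ge0.
move=> h s0 w0 s1 w1 ds dw h0 h1 s1E w1E ms0 ms1 sS0 sS1 wV0 wV1 dsS dwV.
pose Z (x : R) : C := (ds * x%:C + dw) * eta (s0 * x%:C + w0).
pose D (x : R) : C := s1 * eta (s1 * x%:C + w1) - s0 * eta (s0 * x%:C + w0)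
      - (Z (x + h) - Z x).
have [K' K'0 HK'] := @eta_decay s0 w0 (lt_le_trans m0 ms0).
have [tS t0] := @csum_telescope R Z _ h h0 h1 (fun x => HK' x ds dw).
have [dS dK] := @lattice_csummable R D (K * h ^+ 2) h h0 h1
  (fun x => HK h s0 w0 s1 w1 ds dw x h0 h1 s1E w1E ms0 ms1 sS0 sS1 wV0 wV1 dsS dwV).
rewrite /riemann_sum -csumB; [|exact: riemann_sum_summable (lt_le_trans m0 _)|exact: riemann_sum_summable (lt_le_trans m0 _)].
rewrite (@eq_csum _ _ _ (fun j : int => h%:C * D (j%:~R * h) +
  h%:C * (Z (j%:~R * h + h) - Z (j%:~R * h)))); last first.
  by move=> j; rewrite /D; ring.
by rewrite csumD// t0 addr0 -mulrA.
Qed.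

(** The cone is convex, so that its points are joined to 1 by segments, and
    squaring maps it onto the right half-plane. *)
Definition cone s := `|Im s| < Re s.

(** Re (z ^+ 2) = (Re z - `|Im z|) (Re z + `|Im z|), and along the segment from
    1 to s the first factor is affine. *)
Lemma cone_path s (t : R) : cone s -> 0 <= t -> t <= 1 ->
  Num.min 1 (Re s - `|Im s|) ^+ 2 <= Re ((1 + t%:C * (s - 1)) ^+ 2).
Proof.
have -> : Re ((1 + t%:C * (s - 1)) ^+ 2) =
    (1 + t * (Re s - 1)) ^+ 2 - (t * Im s) ^+ 2.
  by case: s => a b; rewrite !expr2; simpc => /=; ring.
rewrite /cone; move: (Re s) (Im s) => a b ab t0 t1.
set mu := Num.min _ _.
have mu0 : 0 < mu by rewrite /mu lt_min ltr01 subr_gt0.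
have mu1 : mu <= 1 by rewrite /mu ge_min lexx.
have mu2 : mu <= a - `|b| by rewrite /mu ge_min lexx orbT.
have b0 := normr_ge0 b.
have -> : (1 + t * (a - 1)) ^+ 2 - (t * b) ^+ 2 =
   (1 + t * (a - 1) - t * `|b|) * (1 + t * (a - 1) + t * `|b|).
  by rewrite -(real_normK (num_real (t * b))) normrM (ger0_norm t0); ring.
have h1 : mu <= 1 + t * (a - 1) - t * `|b|.
  have : t * mu <= t * (a - `|b|) by rewrite ler_wpM2l.
  have : (1 - t) * mu <= (1 - t) * 1 by rewrite ler_wpM2l// subr_ge0.
  by lra.
have h2 : 0 <= t * `|b| by rewrite mulr_ge0.
by rewrite expr2 ler_pM ?(ltW mu0)//; lra.
Qed.

Lemma cone_Re s : cone s -> 0 < Re (s ^+ 2).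
Proof.
move=> cs; have := @cone_path s 1 cs ler01 (lexx _).
have -> : 1 + 1%:C * (s - 1) = s by rewrite rmorph1; ring.
apply: lt_le_trans.
by rewrite exprn_gt0// lt_min ltr01 subr_gt0.
Qed.

Lemma cone_neq0 s : cone s -> s != 0.
Proof.
by rewrite /cone; apply: contraTneq => ->; rewrite /= normr0 ltxx.
Qed.

Lemma ReV_gt0 (z : C) : 0 < Re z -> 0 < Re z^-1.
Proof.
case: z => a b /= a0; rewrite /= divr_gt0//.
by have := sqr_ge0 b; have : 0 < a ^+ 2 by [rewrite exprn_gt0]; lra.
Qed.

(** The Riemann sums of a Gaussian depend on the contour only up to the mesh:
    walk from the real line to the given line in as many steps as there are
    sample points per unit length. *)
Lemma contour_independence s w : cone s -> exists2 K, 0 <= K &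
  forall n : nat, cabs (riemann_sum n.+1%:R^-1 s w - riemann_sum n.+1%:R^-1 1 0) <= K * n.+1%:R^-1.
Proof.
move=> cs; pose m := Num.min 1 (Re s - `|Im s|) ^+ 2.
have m0 : 0 < m by rewrite exprn_gt0// lt_min ltr01 subr_gt0.
have S0 : 0 <= 1 + cabs (s - 1) by rewrite addr_ge0// cabs_ge0.
have [K K0 HK] := contour_step m0 S0 (cabs_ge0 w).
exists K => // n; set h := n.+1%:R^-1.
have h0 : 0 < h by rewrite invr_gt0.
have h1 : h <= 1 by rewrite invf_le1// ler1n.
pose sp (p : nat) : C := 1 + (p%:R * h)%:C * (s - 1).
pose wp (p : nat) : C := (p%:R * h)%:C * w.
have hp (p : nat) : (p <= n.+1)%N -> 0 <= p%:R * h <= 1.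
  move=> pn; rewrite mulr_ge0 ?(ltW h0)//=.
  by rewrite ler_pdivrMr// mul1r ler_nat.
have spS p : (p <= n.+1)%N -> cabs (sp p) <= 1 + cabs (s - 1).
  move=> /hp/andP[p0 p1]; apply: (le_trans (cabsD _ _)); rewrite cabs1 lerD2l.
  by rewrite cabsM cabsR ger0_norm// ler_piMl ?cabs_ge0.
have wpV p : (p <= n.+1)%N -> cabs (wp p) <= cabs w.
  move=> /hp/andP[p0 p1].
  by rewrite cabsM cabsR ger0_norm// ler_piMl ?cabs_ge0.
have mp p : (p <= n.+1)%N -> m <= Re ((sp p) ^+ 2).
  by move=> /hp/andP[p0 p1]; exact: cone_path.
have step p : (p < n.+1)%N ->
    cabs (riemann_sum h (sp p.+1) (wp p.+1) - riemann_sum h (sp p) (wp p)) <= K * h ^+ 2.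
  move=> pn; have pn' := ltnW pn.
  apply: (HK h (sp p) (wp p) (sp p.+1) (wp p.+1) (s - 1) w) => //;
    rewrite ?mp ?spS ?wpV//.
  - by rewrite /sp -natr1 mulrDl mul1r rmorphD/=; ring.
  - by rewrite /wp -natr1 mulrDl mul1r rmorphD/=; ring.
  - by have := cabs_ge0 (s - 1); lra.
  - by have := cabs_ge0 w; lra.
have hn : n.+1%:R * h = 1 by rewrite divff.
have -> : riemann_sum h s w - riemann_sum h 1 0 =
    \sum_(0 <= p < n.+1) (riemann_sum h (sp p.+1) (wp p.+1) - riemann_sum h (sp p) (wp p)).
  rewrite (@telescope_sumr _ 0 n.+1 (fun p => riemann_sum h (sp p) (wp p)))//.
  have -> : sp n.+1 = s by rewrite /sp hn rmorph1; ring.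
  have -> : wp n.+1 = w by rewrite /wp hn rmorph1 mul1r.
  by rewrite /sp /wp mul0r rmorph0 !mul0r addr0.
apply: (le_trans (le_cabs_sum _ _ _)).
apply: (@le_trans _ _ (\sum_(0 <= p < n.+1) K * h ^+ 2)).
  by rewrite big_nat [leRHS]big_nat; apply: ler_sum => p /andP[_ pn]; exact: step.
rewrite big_const_nat subn0 iter_addr_0 -mulr_natl mulrCA expr2 (mulrA n.+1%:R) hn.
by rewrite mul1r.
Qed.

End Contour.

Section FiniteFourier.
Context {R : realType}.
Local Notation C := R[i].
Implicit Types (s w : C).

Definition ce (x : R) : C := cex (2 * pi%:C * ii * x%:C).

Lemma ceD (x y : R) : ce (x + y) = ce x * ce y.
Proof. by rewrite /ce -cexD; congr cex; rewrite rmorphD/=; ring. Qed.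

Lemma ce0 : ce 0 = 1. Proof. by rewrite /ce mulr0 cex0. Qed.

Lemma ce_int (z : int) : ce z%:~R = 1.
Proof. by rewrite /ce rmorph_int cex_2piz. Qed.

Lemma ceMn (x : R) n : ce (n%:R * x) = ce x ^+ n.
Proof. by rewrite /ce rmorphM rmorph_nat mulrCA cexMn. Qed.

Lemma cabs_ce (x : R) : cabs (ce x) = 1.
Proof.
rewrite /ce cabs_cex (_ : Re _ = 0) ?expR0//.
by rewrite -(rmorph_nat (real_complex R)); simpc => /=; rewrite ?(mulr0,mul0r,subr0,addr0).
Qed.

Lemma ce_neq1 (x : R) : 0 < x -> x < 1 -> ce x != 1.
Proof.
move=> x0 x1; apply/eqP => ce1; have := congr1 (fun z : C => Re z) ce1.
rewrite /ce (_ : 2 * pi%:C * ii * x%:C = Complex 0 (2 * pi * x)); last first.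
  by rewrite -(rmorph_nat (real_complex R)); simpc; congr (Complex _ _); ring.
rewrite -cexE /cexp /= expR0; simpc => /=.
have p0 : (0 : R) < pi by exact: pi_gt0.
rewrite (_ : 2 * pi * x = (pi * x) *+ 2); last by ring.
rewrite cos_mulr2n cos2sin2 => h.
have : sin (pi * x) = 0.
  apply/eqP; rewrite -sqrf_eq0; apply/eqP.
  by move: h; rewrite mulr2n; lra.
apply/eqP; rewrite gt_eqF// sin_gt0_pi// mulr_gt0//=.
by rewrite gtr_pMr.
Qed.

(** Orthogonality of the characters of the integers modulo [n]. *)
Lemma sum_ce (n : nat) (r : nat) (c : int) : (0 < n)%N -> (r < n)%N ->
  \sum_(k < n) ce ((k%:R + c%:~R) * (r%:R / n%:R)) =
  if r == 0%N then n%:R else 0.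
Proof.
move=> n0 rn; case: eqP => [->|/eqP r0].
  under eq_bigr do rewrite mul0r mulr0 ce0.
  by rewrite sumr_const card_ord.
have nR : n%:R != 0 :> R by rewrite pnatr_eq0 -lt0n.
set z := ce (r%:R / n%:R).
have z1 : z - 1 != 0.
  rewrite subr_eq0 ce_neq1 ?divr_gt0 ?ltr0n ?lt0n//; first by rewrite -lt0n.
  by rewrite ltr_pdivrMr ?ltr0n// mul1r ltr_nat.
have zn : z ^+ n = 1.
  by rewrite -ceMn mulrCA divff// mulr1 -(ce_int r).
rewrite (eq_bigr (fun k : 'I_n => ce (c%:~R * (r%:R / n%:R)) * z ^+ k)); last first.
  by move=> k _; rewrite mulrDl ceD mulrC ceMn.
rewrite -big_distrr/=; apply/eqP; rewrite mulf_eq0; apply/orP; right.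
by rewrite -(mulrI_eq0 _ (mulfI z1)) -subrX1 zn subrr.
Qed.

Lemma edivz_bij (n : nat) :
  bijective (fun z : int * 'I_n.+1 => z.1 * n.+1%:Z + (nat_of_ord z.2)%:Z).
Proof.
exists (fun j => ((j %/ n.+1%:Z)%Z, inord `|(j %% n.+1%:Z)%Z|%N)).
  case=> m r /=; have rn : (r < n.+1)%N by [].
  rewrite divzMDl// divz_small ?addr0; last by rewrite /= ltz_nat.
  congr (_, _); apply: val_inj; rewrite /= inordK modzMDl modz_small//=.
move=> j /=; rewrite inordK; last first.
  by rewrite -ltz_nat gez0_abs ?modz_ge0// ltz_pmod.
by rewrite gez0_abs ?modz_ge0// -divz_eq.
Qed.

(** Turns the sum over frequencies of [gauss_dft_sum] into a family over the
    integers, to which dominated convergence applies. *)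
Lemma csum_window (G : int -> C) (p : nat) :
  \sum_(i < p.*2.+1) G (i%:Z - p%:Z) =
  csum (fun k : int => if (`|k| <= p%:Z) then G k else 0).
Proof.
pose F (i : 'I_p.*2.+1) (k : int) := if k == i%:Z - p%:Z then G k else 0.
have hF i : csummable (F i) /\ csum (F i) = G (i%:Z - p%:Z).
  have [|h1 h2] := @csum_single R int (F i) (i%:Z - p%:Z).
    by move=> k /negbTE; rewrite /F => ->.
  by split => //; rewrite h2 /F eqxx.
have [_ h] := @csum_sum R int _ (index_enum 'I_p.*2.+1) F (fun i => (hF i).1).
rewrite [RHS](@eq_csum _ _ _ (fun k => \sum_i F i k)).
  by rewrite h; apply: eq_bigr => i _; rewrite (hF i).2.
move=> k; case: ifPn => kp.
  have kb : (0 <= k + p%:Z) && (k + p%:Z < p.*2.+1%:Z).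
    by move: kp; rewrite ler_norml => /andP[k1 k2]; apply/andP; split; lia.
  have [k0 k1] := andP kb.
  have i0 : (`|(k + p%:Z)%R| < p.*2.+1)%N by rewrite -ltz_nat gez0_abs.
  rewrite (bigD1 (Ordinal i0))//= /F gez0_abs// addrK eqxx big1 ?addr0// => i /eqP ni.
  case: eqP => // kE; exfalso; apply: ni; apply: val_inj => /=.
  by rewrite kE subrK.
rewrite big1// => i _; rewrite /F; case: eqP => // kE; move: kp.
by rewrite kE ler_norml => /negP; case; have := ltn_ord i; lia.
Qed.

(** The discrete Fourier coefficient, at the frequency k, of the sum of the
    integer translates of the Gaussian, sampled at 2 p + 1 points. *)
Definition gauss_dft (p : nat) s w (k : int) : C :=
  csum (fun j : int => (p.*2.+1%:R^-1)%:C *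
    (eta (s * (j%:~R * p.*2.+1%:R^-1)%:C + s * w)
     * ce (- (k%:~R * (j%:~R * p.*2.+1%:R^-1))))).

(** Fourier inversion at the sample point 0. *)
Lemma gauss_dft_sum p s w : 0 < Re (s ^+ 2) ->
  csummable (fun m : int => eta (s * (m%:~R)%:C + s * w)) /\
  \sum_(i < p.*2.+1) gauss_dft p s w (i%:Z - p%:Z) =
  csum (fun m : int => eta (s * (m%:~R)%:C + s * w)).
Proof.
move=> s0; set n := p.*2.+1; set h : R := n%:R^-1.
have h0 : 0 < h by rewrite invr_gt0.
have h1 : h <= 1 by rewrite invf_le1// ler1n.
have nh : n%:R * h = 1 by rewrite /h divff// pnatr_eq0.
have [K K0 HK] := eta_decay0 (s * w) s0.
split.
  have := (@lattice_csummable R (fun x => eta (s * x%:C + s * w)) K 1 ltr01 (lexx _) HK).1.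
  by apply: eq_csummable => m; rewrite mulr1 rmorph1 mul1r.
pose G (k : int) (x : R) := eta (s * x%:C + s * w) * ce (- (k%:~R * x)).
have GK k x : cabs (G k x) <= K * qdecay x.
  by rewrite cabsM cabs_ce mulr1 HK.
have sG k := (@lattice_csummable R (G k) K h h0 h1 (GK k)).1.
have [s1 s2] := @csum_sum R int _ (index_enum 'I_n)
  (fun (i : 'I_n) (j : int) => h%:C * G (i%:Z - p%:Z) (j%:~R * h)) (fun i => sG _).
rewrite -s2 -(csum_bij _ (edivz_bij p.*2)).
rewrite csum_pair; last by apply/csummable_bij => //; exact: edivz_bij.
apply: eq_csum => m; rewrite (csum_fin _).2 /=.
rewrite (bigD1 ord0)//= [X in _ + X]big1 ?addr0 => [|r r0].
  rewrite (eq_bigr (fun i => h%:C * eta (s * m%:~R%:C + s * w))); last first.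
    move=> i _; have -> : (m * p.*2.+1%:Z)%:~R * h = m%:~R :> R.
      by rewrite intrM -mulrA [X in _ * X](_ : _ = 1) ?mulr1.
    by rewrite /G -intrM -mulrNz ce_int mulr1.
  rewrite sumr_const card_ord -mulr_natl mulrA -(rmorph_nat (real_complex R)).
  by rewrite -rmorphM/= nh rmorph1 mul1r.
have xE : (m * n%:Z + r%:Z)%:~R * h = m%:~R + r%:R / n%:R :> R.
  by rewrite rmorphD rmorphM/= mulrDl -mulrA nh mulr1.
rewrite (eq_bigr (fun i : 'I_n => h%:C * eta (s * (m%:~R + r%:R / n%:R)%:C + s * w) *
    ce ((i%:R + (- p%:Z)%:~R) * ((n - r)%:R / n%:R)))); last first.
  move=> i _; rewrite -/n xE /G mulrA; congr (_ * _).
  have -> : (n - r)%:R / n%:R = 1 - r%:R / n%:R :> R.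
    by rewrite natrB ?(ltnW (ltn_ord r))// mulrBl divff// pnatr_eq0.
  have -> : - ((i%:Z - p%:Z)%:~R * (m%:~R + r%:R / n%:R)) =
    (- (i%:Z - p%:Z) * (m + 1))%:~R + (i%:R + (- p%:Z)%:~R) * (1 - r%:R / n%:R) :> R.
    by rewrite !(rmorphM, rmorphD, rmorphN)/=; ring.
  by rewrite ceD ce_int mul1r.
rewrite -big_distrr/= sum_ce//; last by rewrite ltn_subrL lt0n r0.
by rewrite subn_eq0 leqNgt ltn_ord /= mulr0.
Qed.

(** Completing the square moves the oscillating factor into the contour: a
    Fourier coefficient is a Riemann sum of the Gaussian along a shifted line. *)
Lemma gauss_dft_riemann p s w (k : int) : s != 0 -> 0 < Re (s ^+ 2) ->
  s * gauss_dft p s w k =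
  cex (2 * pi%:C * ii * k%:~R * w - pi%:C * k%:~R ^+ 2 / s ^+ 2) *
  riemann_sum p.*2.+1%:R^-1 s (s * w + ii * k%:~R / s).
Proof.
move=> s0; set n := p.*2.+1; set h : R := n%:R^-1.
have h0 : 0 < h by rewrite invr_gt0.
have h1 : h <= 1 by rewrite invf_le1// ler1n.
move=> s20; have [K K0 HK] := eta_decay0 (s * w) s20.
rewrite /gauss_dft /riemann_sum -/n -/h.
pose G (x : R) := eta (s * x%:C + s * w) * ce (- (k%:~R * x)).
have GK x : cabs (G x) <= K * qdecay x by rewrite cabsM cabs_ce mulr1 HK.
have sG := (@lattice_csummable R G K h h0 h1 GK).1.
rewrite -csumZ// -csumZ; last exact: riemann_sum_summable.
apply: eq_csum => j; rewrite /G /ce; move: (j%:~R * h) => x.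
rewrite mulrCA [RHS]mulrCA; congr (_ * _); rewrite [RHS]mulrCA; congr (_ * _).
rewrite /eta -!cexD; congr cex.
have kC : (k%:~R : R)%:C = k%:~R by rewrite rmorph_int.
have -> : (- (k%:~R * x))%:C = - (k%:~R * x%:C) :> C.
  by rewrite -kC -rmorphM -rmorphN.
have ii2 : ii ^+ 2 = -1 :> C by rewrite sqr_i.
pose kc : C := k%:~R; rewrite -/kc.
have -> : (s * x%:C + (s * w + ii * kc / s)) ^+ 2 =
  (s * x%:C + s * w) ^+ 2 + 2 * ii * kc * (x%:C + w) + ii ^+ 2 * kc ^+ 2 / s ^+ 2.
  by field.
by rewrite ii2; ring.
Qed.

End FiniteFourier.

Section Jacobi.
Context {R : realType}.
Local Notation C := R[i].
Implicit Types (s w : C).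

(** By duplication: on half the angle the cosine is at least 1 / 2. *)
Lemma sin_ge_quarter (u : R) : 0 <= u -> u <= pi / 2 -> u / 4 <= sin u.
Proof.
move=> u0 u1; have p0 : (0 : R) < pi by exact: pi_gt0.
pose v := u / 2; have v0 : 0 <= v by rewrite /v; lra.
have vp : v <= pi by rewrite /v; lra.
have cv0 : 0 <= cos v by apply: cos_ge0_pihalf; apply/andP; split; rewrite /v; lra.
have cu0 : 0 <= cos u by apply: cos_ge0_pihalf; apply/andP; split; lra.
have uE : u = v *+ 2 by rewrite /v mulr2n; lra.
have cv : 1 / 2 <= cos v.
  rewrite leNgt; apply/negP => h.
  have : cos v ^+ 2 < (1 / 2) ^+ 2 by rewrite ltrXn2r//; lra.
  by move: cu0; rewrite uE cos_mulr2n mulr2n; lra.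
have sv : v * cos v <= sin v.
  have cont : {within `[0, v], continuous (@sin R)}.
    by apply: continuous_subspaceT; exact: continuous_sin.
  have [c] := @MVT_segment R sin cos 0 v v0 (fun x _ => is_derive_sin x) cont.
  rewrite in_itv/= => /andP[c0 c1]; rewrite sin0 !subr0 => ->.
  rewrite mulrC ler_wpM2r// leNgt ltr_cos ?in_itv/= ?c0 ?v0 ?vp ?(le_trans c1)//.
  by rewrite ltNge c1.
have uE2 : u = 2 * v by rewrite uE mulr_natl.
have -> : sin u = 2 * (cos v * sin v) by rewrite uE sin_mulr2n mulr_natl.
have h1 : v / 2 <= sin v by apply: le_trans sv; rewrite ler_wpM2l//; lra.
have : (1 / 2) * (v / 2) <= cos v * sin v.
  by apply: ler_pM => //; rewrite /v; lra.
by rewrite uE2; lra.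
Qed.

Lemma ceE (x : R) : ce x = Complex (cos (2 * pi * x)) (sin (2 * pi * x)).
Proof.
rewrite /ce (_ : 2 * pi%:C * ii * x%:C = Complex 0 (2 * pi * x)); last first.
  by rewrite -(rmorph_nat (real_complex R)); simpc; congr (Complex _ _); ring.
by rewrite -cexE /cexp /= expR0 mul1r.
Qed.

(** The symbol of the second difference is - 4 sin^2 (pi x), and
    [sin_ge_quarter] bounds the sine from below. *)
Lemma chord_ge (x : R) : `|x| <= 1 / 2 -> x ^+ 2 <= cabs (ce x + ce (- x) - 2).
Proof.
move=> x1; have p0 : (0 : R) < pi by exact: pi_gt0.
apply: le_trans (cabs_Re _); rewrite !ceE mulrN cosN sinN.
rewrite -(rmorph_nat (real_complex R)); simpc => /=.
rewrite (_ : 2 * pi * x = (pi * x) *+ 2); last by ring.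
rewrite cos_mulr2n cos2sin2.
rewrite (_ : _ + (-1 - 1) = - (4 * sin (pi * x) ^+ 2)); last by rewrite !mulr2n; ring.
rewrite normrN ger0_norm; last by rewrite mulr_ge0// sqr_ge0.
have -> : sin (pi * x) ^+ 2 = sin (pi * `|x|) ^+ 2.
  by case: (ger0P x) => //; rewrite mulrN sinN sqrrN.
have h1 : pi * `|x| / 4 <= sin (pi * `|x|).
  apply: sin_ge_quarter; first by rewrite mulr_ge0// ltW.
  by have := ler_wpM2l (ltW p0) x1; lra.
have h2 : 2 * `|x| / 4 <= sin (pi * `|x|).
  apply: le_trans h1; rewrite ler_wpM2r// ler_wpM2r//.
  exact: pi_ge2.
rewrite -(real_normK (num_real x)).
have : (2 * `|x| / 4) ^+ 2 <= sin (pi * `|x|) ^+ 2.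
  have x0 : 0 <= 2 * `|x| / 4 by rewrite divr_ge0// mulr_ge0.
  by rewrite lerXn2r// nnegrE// (le_trans x0).
by rewrite exprMn exprMn; lra.
Qed.

Lemma eta_second_diff s w : 0 < Re (s ^+ 2) -> exists2 A, 0 <= A &
  forall (h x : R), 0 < h -> h <= 1 ->
  cabs (eta (s * (x + h)%:C + w) + eta (s * (x - h)%:C + w)
        - 2 * eta (s * x%:C + w)) <= A * h ^+ 2 * qdecay x.
Proof.
move=> s0; have [K K0 HK] := eta_le s0 (cabs_ge0 s) (cabs_ge0 w).
have p0 : (0 : R) <= pi by exact: pi_ge0.
pose B := cabs s + cabs w.
have B0 : 0 <= B by rewrite addr_ge0 ?cabs_ge0.
pose c := 36 * pi ^+ 2 * B ^+ 4 + pi * B ^+ 2.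
have c0 : 0 <= c by rewrite /c addr_ge0// !mulr_ge0// exprn_ge0.
exists (4 * K * c); first by rewrite !mulr_ge0.
move=> h x h0 h1; have h0' := ltW h0.
pose X := 1 + `|x|; have X1 : 1 <= X by rewrite lerDl.
pose z := s * x%:C + w.
have zB : cabs z <= B * X.
  apply: (le_trans (cabsD _ _)); rewrite cabsM cabsR /B /X.
  have := mulr_ge0 (cabs_ge0 w) (normr_ge0 x); have := cabs_ge0 s; lra.
have sB : cabs s <= B by rewrite /B lerDl cabs_ge0.
have T (t : R) : `|t| = h -> cabs (eta (z + s * t%:C) - eta z
    + 2 * pi%:C * z * (s * t%:C) * eta z) <= 2 * K * c * h ^+ 2 * qdecay x.
  move=> th.
  have e1 : cabs (s * t%:C) <= B * h by rewrite cabsM cabsR th ler_wpM2r.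
  have e2 : cabs (s * t%:C) <= B * X.
    apply: (le_trans e1); rewrite ler_wpM2l//; lra.
  apply: (le_trans (@eta_taylor _ z (s * t%:C) (3 * pi * B ^+ 2 * X * h) _)).
    rewrite (_ : 3 * pi * B ^+ 2 * X * h = pi * (B * h) * (2 * (B * X) + B * X)); last by ring.
    apply: ler_pM.
    - by rewrite mulr_ge0 ?cabs_ge0.
    - by rewrite addr_ge0 ?mulr_ge0 ?cabs_ge0.
    - by rewrite ler_wpM2l.
    - by rewrite lerD// ler_wpM2l.
  have E1 : cabs (eta z) * expR (6 * `|x|) <= K * qdecay x.
    by have := HK s w x 0 (lexx _) (lexx _) (lexx _); rewrite normr0 ler01 addr0; exact.
  have E2 : cabs (eta (z + s * t%:C)) * expR (6 * `|x|) <= K * qdecay x.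
    have := HK s w x t (lexx _) (lexx _) (lexx _); rewrite th h1.
    by rewrite (_ : s * (x + t)%:C + w = z + s * t%:C); [exact|rewrite rmorphD/= /z; ring].
  set E := _ + _; have E0 : 0 <= E by rewrite addr_ge0 ?cabs_ge0.
  have EX : E * X ^+ 2 <= 2 * K * qdecay x.
    have : E * X ^+ 2 <= E * expR (6 * `|x|).
      rewrite ler_wpM2l//; apply: le_trans (expr_le_exp6 x).
      by rewrite ler_weXn2l.
    by rewrite /E mulrDl; lra.
  have h2 : 4 * (3 * pi * B ^+ 2 * X * h) ^+ 2 + pi * cabs (s * t%:C) ^+ 2 <=
      c * h ^+ 2 * X ^+ 2.
    have : cabs (s * t%:C) ^+ 2 <= (B * h) ^+ 2.
      by rewrite lerXn2r ?nnegrE ?cabs_ge0// mulr_ge0.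
    have X2 : 1 <= X ^+ 2 by rewrite exprn_ege1.
    have : (B * h) ^+ 2 * 1 <= (B * h) ^+ 2 * X ^+ 2 by rewrite ler_wpM2l// sqr_ge0.
    move=> a1 a2; have := ler_wpM2l p0 (le_trans a2 (le_trans (eqr_lex (esym (mulr1 _))) a1)).
    rewrite /c => a3.
    rewrite (_ : (36 * pi ^+ 2 * B ^+ 4 + pi * B ^+ 2) * h ^+ 2 * X ^+ 2 =
      4 * (3 * pi * B ^+ 2 * X * h) ^+ 2 + pi * ((B * h) ^+ 2 * X ^+ 2)); last by ring.
    by rewrite lerD2l.
  apply: (le_trans (ler_wpM2l E0 h2)).
  rewrite (_ : E * (c * h ^+ 2 * X ^+ 2) = c * h ^+ 2 * (E * X ^+ 2)); last by ring.
  rewrite (_ : 2 * K * c * h ^+ 2 * qdecay x = c * h ^+ 2 * (2 * K * qdecay x)); last by ring.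
  by rewrite ler_wpM2l// mulr_ge0// exprn_ge0.
have T1 := T h (ger0_norm h0').
have T2 := T (- h) (etrans (normrN _) (ger0_norm h0')).
rewrite (_ : s * (x + h)%:C + w = z + s * h%:C); last by rewrite rmorphD/= /z; ring.
rewrite (_ : s * (x - h)%:C + w = z + s * (- h)%:C); last first.
  by rewrite rmorphB rmorphN/= /z; ring.
rewrite -/z.
rewrite (_ : eta (z + s * h%:C) + eta (z + s * (- h)%:C) - 2 * eta z =
  (eta (z + s * h%:C) - eta z + 2 * pi%:C * z * (s * h%:C) * eta z) +
  (eta (z + s * (- h)%:C) - eta z + 2 * pi%:C * z * (s * (- h)%:C) * eta z)).
  apply: (le_trans (cabsD _ _)); apply: (le_trans (lerD T1 T2)).
  by apply: eqr_lex; ring.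
by rewrite rmorphN/=; ring.
Qed.

Lemma subz1_bij : bijective (fun j : int => j - 1).
Proof. by exists (fun j => j + 1) => j; ring. Qed.

(** Uniformly in the modulus, the discrete Fourier coefficients decay
    quadratically: multiplying one by the symbol of the second difference is
    taking the coefficient of a second difference. *)
Lemma gauss_dft_decay s w : 0 < Re (s ^+ 2) -> exists2 A, 0 <= A &
  forall (p : nat) (k : int), `|k| <= p%:Z -> cabs (gauss_dft p s w k) <= A * qdecay k%:~R.
Proof.
move=> s0; have [K K0 HK] := eta_decay0 (s * w) s0.
have [A A0 HA] := eta_second_diff (s * w) s0.
exists (24 * (A + K)); first by rewrite mulr_ge0// addr_ge0.
move=> p k kp; set n := p.*2.+1; set h : R := n%:R^-1.
have h0 : 0 < h by rewrite invr_gt0.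
have h1 : h <= 1 by rewrite invf_le1// ler1n.
have nh : n%:R * h = 1 by rewrite /h divff// pnatr_eq0.
pose f (x : R) := eta (s * x%:C + s * w).
pose G (x : R) := f x * ce (- (k%:~R * x)).
have GK x : cabs (G x) <= K * qdecay x by rewrite cabsM cabs_ce mulr1 HK.
have [sG bG] := @lattice_csummable R G K h h0 h1 GK.
pose D (x : R) := (f (x + h) + f (x - h) - 2 * f x) * ce (- (k%:~R * x)).
have DA x : cabs (D x) <= A * h ^+ 2 * qdecay x.
  by rewrite cabsM cabs_ce mulr1 HA.
have [sD bD] := @lattice_csummable R D (A * h ^+ 2) h h0 h1 DA.
have psiE : gauss_dft p s w k = csum (fun j : int => h%:C * G (j%:~R * h)) by [].
pose G0 (j : int) := h%:C * G (j%:~R * h).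
have E : (ce (k%:~R * h) + ce (- (k%:~R * h)) - 2) * gauss_dft p s w k =
    csum (fun j : int => h%:C * D (j%:~R * h)).
  have sp : csummable (G0 \o (fun j : int => j + 1)).
    by apply/csummable_bij => //; exact: addz1_bij.
  have sm : csummable (G0 \o (fun j : int => j - 1)).
    by apply/csummable_bij => //; exact: subz1_bij.
  rewrite mulrBl mulrDl.
  rewrite {1}psiE -/G0 -(csum_bij G0 addz1_bij) -(csumZ _ sp).
  rewrite {1}psiE -/G0 -(csum_bij G0 subz1_bij) -(csumZ _ sm).
  rewrite psiE -/G0 -(csumZ _ sG).
  rewrite -csumD; [|exact: csummableZ|exact: csummableZ].
  rewrite -csumB; [|by apply: csummableD; exact: csummableZ|exact: csummableZ].
  apply: eq_csum => j; rewrite /G0 /= /D /G.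
  rewrite !rmorphD rmorphN rmorph1 /= !mulrDl !mulNr mul1r.
  move: (j%:~R * h) => x.
  have e1 : ce (- (k%:~R * (x + h))) * ce (k%:~R * h) = ce (- (k%:~R * x)).
    by rewrite -ceD; congr ce; ring.
  have e2 : ce (- (k%:~R * (x - h))) * ce (- (k%:~R * h)) = ce (- (k%:~R * x)).
    by rewrite -ceD; congr ce; ring.
  transitivity (h%:C * (f (x + h) * (ce (- (k%:~R * (x + h))) * ce (k%:~R * h))) +
    h%:C * (f (x - h) * (ce (- (k%:~R * (x - h))) * ce (- (k%:~R * h)))) -
    2 * (h%:C * (f x * ce (- (k%:~R * x))))); first by ring.
  by rewrite e1 e2; ring.
have kh : `|k%:~R * h| <= 1 / 2.
  rewrite normrM (gtr0_norm h0) ler_pdivrMr ?ltr0n// -intr_norm.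
  have : (`|k|%:~R : R) <= p%:R by rewrite -(ler_int R) in kp.
  have nE : n%:R = 2 * p%:R + 1 :> R by rewrite /n -natr1 -mul2n natrM.
  by rewrite nE; lra.
have ck := chord_ge kh.
have P0 := cabs_ge0 (gauss_dft p s w k).
have h20 : 0 < h ^+ 2 by rewrite exprn_gt0.
have B1 : k%:~R ^+ 2 * cabs (gauss_dft p s w k) <= 24 * A.
  rewrite -(ler_pM2r h20).
  apply: (@le_trans _ _ (cabs (ce (k%:~R * h) + ce (- (k%:~R * h)) - 2) * cabs (gauss_dft p s w k))).
    rewrite mulrAC -exprMn ler_wpM2r//.
  by rewrite -cabsM E (le_trans bD)// mulrA.
have B2 : cabs (gauss_dft p s w k) <= 24 * K by rewrite psiE.
rewrite /qdecay ler_pdivlMr; last by have := sqr_ge0 (k%:~R : R); lra.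
by rewrite mulrDr mulr1 (mulrC _ (_ ^+ 2)) (mulrDr 24) addrC lerD.
Qed.

Lemma cex_eta s w (k : R) : s != 0 ->
  cex (2 * pi%:C * ii * k%:C * w - pi%:C * k%:C ^+ 2 / s ^+ 2) =
  cex (- (pi%:C * s ^+ 2 * w ^+ 2)) * eta (s^-1 * k%:C - ii * s * w).
Proof.
move=> s0; rewrite /eta -cexD; congr cex.
have ii2 : ii ^+ 2 = -1 :> C by rewrite sqr_i.
rewrite (_ : (s^-1 * k%:C - ii * s * w) ^+ 2 =
  k%:C ^+ 2 / s ^+ 2 - 2 * ii * k%:C * w + ii ^+ 2 * s ^+ 2 * w ^+ 2).
  by rewrite ii2; ring.
by field.
Qed.

Lemma ReVsqr_gt0 s : 0 < Re (s ^+ 2) -> 0 < Re (s^-1 ^+ 2).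
Proof. by move=> s0; rewrite exprVn; exact: ReV_gt0. Qed.

Lemma theta_term_decay s w : s != 0 -> 0 < Re (s ^+ 2) -> exists2 K, 0 <= K &
  forall k : R, cabs (cex (2 * pi%:C * ii * k%:C * w - pi%:C * k%:C ^+ 2 / s ^+ 2))
    <= K * qdecay k.
Proof.
move=> sn0 s0; have [K K0 HK] := eta_decay0 (- (ii * s * w)) (ReVsqr_gt0 s0).
exists (cabs (cex (- (pi%:C * s ^+ 2 * w ^+ 2))) * K).
  by rewrite mulr_ge0 ?cabs_ge0.
by move=> k; rewrite cex_eta// cabsM -[leRHS]mulrA ler_wpM2l ?cabs_ge0.
Qed.

Lemma qdecay_int_summ (K : R) : summ (fun k : int => K * qdecay k%:~R).
Proof.
apply: summZ; have := (@qdecay_lattice R 1 ltr01 (lexx _)).1.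
by under [X in summ X -> _]eq_fun do rewrite mulr1 mul1r.
Qed.

Definition theta_dual s w := csum (fun k : int =>
  cex (2 * pi%:C * ii * k%:~R * w - pi%:C * k%:~R ^+ 2 / s ^+ 2)).

Definition theta_prim s w := csum (fun m : int => eta (s * (m%:~R)%:C + s * w)).

Lemma cvg_harmonic_odd : (2 * n%:R + 1)^-1 @[n --> \oo] --> (0 : R).
Proof.
apply: (@squeeze_cvgr _ _ _ _ (cst 0) (fun n => n.+1%:R^-1)).
- near=> n; rewrite /cst invr_ge0 addr_ge0 ?mulr_ge0//=.
  by rewrite lef_pV2 ?posrE// ?ltr_wpDl ?mulr_ge0// -natr1; have := ler0n R n; lra.
- exact: cvg_cst.
- exact: (@cvg_harmonic R).
Unshelve. all: by end_near. Qed.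

(** Fourier inversion expresses theta_prim by the coefficients gauss_dft, each of
    which is, by contour independence, a term of theta_dual up to a common factor
    and O(1/p); the decay of the coefficients justifies the limit. *)
Lemma theta_cvg s w : cone s ->
  cabs (s * theta_prim s w - riemann_sum p.*2.+1%:R^-1 1 0 * theta_dual s w)
    @[p --> \oo] --> (0 : R).
Proof.
move=> cs; have s0 := cone_Re cs; have sn0 := cone_neq0 cs.
have [A A0 HA] := gauss_dft_decay w s0.
have [K K0 HK] := theta_term_decay w sn0 s0.
pose e (k : int) := cex (2 * pi%:C * ii * k%:~R * w - pi%:C * k%:~R ^+ 2 / s ^+ 2).
have eK k : cabs (e k) <= K * qdecay k%:~R by have := HK k%:~R; rewrite rmorph_int.
have [B B0 HB] : exists2 B, 0 <= B & forall p : nat, cabs (riemann_sum p.*2.+1%:R^-1 1 0 : C) <= B.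
  have re1 : 0 < Re ((1 : C) ^+ 2) by rewrite expr1n /= ltr01.
  have [K1 K10 HK1] := eta_decay0 (0 : C) re1.
  exists (24 * K1); first by rewrite mulr_ge0.
  move=> p; have h0 : 0 < (p.*2.+1%:R^-1 : R) by rewrite invr_gt0.
  have h1 : (p.*2.+1%:R^-1 : R) <= 1 by rewrite invf_le1// ler1n.
  have := (@lattice_csummable R (fun x => 1 * eta (1 * x%:C + 0)) K1 _ h0 h1 _).2.
  by apply => x; rewrite mul1r.
pose f p (k : int) := (if `|k| <= p%:Z then s * gauss_dft p s w k else 0)
  - riemann_sum p.*2.+1%:R^-1 1 0 * e k.
have se : csummable e by apply: csummable_le (qdecay_int_summ K).
have fE p : s * theta_prim s w - riemann_sum p.*2.+1%:R^-1 1 0 * theta_dual s w = csum (f p).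
  rewrite /f csumB; last exact: csummableZ.
    rewrite csumZ// /theta_dual /theta_prim -(gauss_dft_sum p w s0).2.
    by rewrite (big_distrr s)/= (csum_window (fun k => s * gauss_dft p s w k)).
  apply: csummable_le (qdecay_int_summ (cabs s * A)) => k.
  case: ifP => [/HA h|_]; first by rewrite cabsM -[leRHS]mulrA ler_wpM2l ?cabs_ge0.
  by rewrite cabs0 !mulr_ge0 ?cabs_ge0// ltW// qdecay_gt0.
under eq_fun do rewrite fE.
apply: (csum_tannery (g := fun k : int => (cabs s * A + B * K) * qdecay k%:~R)).
- move=> p k; apply: (le_trans (cabsB _ _)); rewrite mulrDl; apply: lerD.
    case: ifP => [/HA h|_]; first by rewrite cabsM -[leRHS]mulrA ler_wpM2l ?cabs_ge0.
    by rewrite cabs0 !mulr_ge0 ?cabs_ge0// ltW// qdecay_gt0.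
  by rewrite cabsM -[leRHS]mulrA ler_pM ?cabs_ge0.
- exact: qdecay_int_summ.
move=> k; have [M M0 HM] := contour_independence (s * w + ii * k%:~R / s) cs.
apply: (@squeeze_cvgr _ _ _ _ (cst 0) (fun p => (cabs (e k) * M) * (2 * p%:R + 1)^-1)).
- near=> p; rewrite /cst cabs_ge0 /f /=.
  have -> : `|k| <= p%:Z.
    have : (`|k| <= p)%N by near: p; exists `|k|%N.
    by rewrite -lez_nat abszE.
  rewrite gauss_dft_riemann// -/(e k) (mulrC (e k)) -mulrBl cabsM mulrC -[leRHS]mulrA.
  rewrite ler_wpM2l ?cabs_ge0//; apply: (le_trans (HM p.*2)).
  by rewrite -(natr1 p.*2) -mul2n natrM.
- exact: cvg_cst.
- rewrite -[X in _ --> X](mulr0 (cabs (e k) * M)); apply: cvgM; first exact: cvg_cst.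
  exact: cvg_harmonic_odd.
Unshelve. all: by end_near. Qed.


Lemma theta_gauss_neq0 : theta_dual 1 0 != 0 :> C.
Proof.
pose g (k : int) : R := expR (- (pi * k%:~R ^+ 2)).
have tE (k : int) : cex (2 * pi%:C * ii * k%:~R * 0 - pi%:C * k%:~R ^+ 2 / 1 ^+ 2) =
    (g k)%:C :> C.
  rewrite mulr0 sub0r expr1n divr1 -(rmorph_int (real_complex R)) -rmorphXn -rmorphM -rmorphN.
  by rewrite -cexE /cexp /= cos0 sin0 mulr1.
have re1 : 0 < Re ((1 : C) ^+ 2) by rewrite expr1n /= ltr01.
have [K K0 HK] := theta_term_decay (0 : C) (oner_neq0 _) re1.
have g0 k : 0 <= g k by exact: expR_ge0.
have sg : summ g.
  apply: summ_le (qdecay_int_summ K) => k; rewrite -cabsR -tE.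
  by have := HK k%:~R; rewrite rmorph_int.
apply/eqP => /(congr1 (fun z : C => Re z)); rewrite /theta_dual /csum /=.
rewrite (@eq_rsum _ _ _ g) ?rsum_ge0E//; last by move=> k; rewrite tE.
have [s1 e1] := @rsum_single R int (fun k => if k == 0 then 1 else 0) 0
  (fun k => ltac:(by move=> /negbTE ->)).
have : 1 <= psum g.
  rewrite -[leLHS](_ : rsum (fun k : int => if k == 0 then 1 else 0) = 1); last first.
    by rewrite e1 eqxx.
  rewrite rsum_ge0E//; last by move=> k; case: ifP.
  apply: le_psum => // k; case: ifP => // /eqP ->.
  by rewrite /g expr0n/= mulr0 oppr0 expR0.
by move=> h1 h2; move: h1; rewrite h2; rewrite ler10.
Qed.

(** Jacobi's inversion formula.  The finite Fourier transform gives it up to the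
    limit of the normalised sums of [exp (- pi t ^ 2)], and the self-dual case
    [s = 1], [w = 0] says that this limit is 1. *)
Theorem theta_inversion s w : cone s -> s * theta_prim s w = theta_dual s w.
Proof.
move=> cs; have c1 : cone (1 : C) by rewrite /cone /= normr0 ltr01.
set A := fun p : nat => riemann_sum p.*2.+1%:R^-1 1 0 : C.
pose t : C := theta_dual 1 0.
have tp : theta_prim 1 0 = t.
  apply: eq_csum => k; rewrite !mul1r addr0 /eta mulr0 sub0r expr1n divr1.
  by rewrite rmorph_int.
have h1 := theta_cvg 0 c1; rewrite mul1r tp -/t -/A in h1.
have h2 := theta_cvg w cs; rewrite -/A in h2.
have t0 : 0 < cabs t by rewrite cabs_gt0// theta_gauss_neq0.
pose d := s * theta_prim s w - theta_dual s w.
have bd p : cabs d <= cabs (s * theta_prim s w - A p * theta_dual s w) +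
    cabs (t - A p * t) * (cabs (theta_dual s w) / cabs t).
  rewrite (_ : t - A p * t = (1 - A p) * t); last by ring.
  have -> : cabs ((1 - A p) * t) * (cabs (theta_dual s w) / cabs t) =
      cabs (theta_dual s w * (1 - A p)).
    by rewrite !cabsM; field; rewrite gt_eqF.
  rewrite /d (_ : s * theta_prim s w - theta_dual s w = (s * theta_prim s w -
    A p * theta_dual s w) - theta_dual s w * (1 - A p)); last by ring.
  exact: cabsB.
have lim0 : cabs (s * theta_prim s w - A p * theta_dual s w) +
    cabs (t - A p * t) * (cabs (theta_dual s w) / cabs t) @[p --> \oo] --> (0 : R).
  rewrite -[X in _ --> X](addr0 0); apply: cvgD => //.
  by rewrite -[X in _ --> X](mul0r (cabs (theta_dual s w) / cabs t)); apply: cvgM => //; exact: cvg_cst.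
have d0 : cabs d <= 0.
  rewrite -(cvg_lim _ lim0)//; apply: limr_ge; first by apply/cvg_ex; exists 0.
  by apply: nearW => p; exact: bd.
apply/eqP; rewrite -subr_eq0 -/d; apply/eqP; apply: cabs_eq0.
by apply/eqP; rewrite eq_le d0 cabs_ge0.
Qed.

End Jacobi.

(** * Theta inversion for positive definite quadratic forms *)

Section QuadraticForms.
Context {R : realType}.

Definition qf n (A : 'M[R]_n) (x : 'rV[R]_n) : R := (x *m A *m x^T) 0 0.

Definition posdef n (A : 'M[R]_n) := A^T = A /\ forall x, x != 0 -> 0 < qf A x.

Lemma dotC n (x y : 'rV[R]_n) : dot x y = dot y x.
Proof. by rewrite /dot -[x *m y^T]trmxK mxE trmx_mul trmxK. Qed.

Lemma dotDl n (x y z : 'rV[R]_n) : dot (x + y) z = dot x z + dot y z.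
Proof. by rewrite /dot mulmxDl mxE. Qed.

Lemma dotZl n (a : R) (x z : 'rV[R]_n) : dot (a *: x) z = a * dot x z.
Proof. by rewrite /dot -scalemxAl mxE. Qed.

Lemma dotNl n (x z : 'rV[R]_n) : dot (- x) z = - dot x z.
Proof. by rewrite -scaleN1r dotZl mulN1r. Qed.

Lemma dotDr n (x y z : 'rV[R]_n) : dot z (x + y) = dot z x + dot z y.
Proof. by rewrite !(dotC z) dotDl. Qed.

Lemma dotZr n (a : R) (x z : 'rV[R]_n) : dot z (a *: x) = a * dot z x.
Proof. by rewrite !(dotC z) dotZl. Qed.

Lemma dotNr n (x z : 'rV[R]_n) : dot z (- x) = - dot z x.
Proof. by rewrite !(dotC z) dotNl. Qed.

Lemma dotE n (x y : 'rV[R]_n) : dot x y = \sum_i x 0 i * y 0 i.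
Proof. by rewrite /dot mxE; apply: eq_bigr => i _; rewrite mxE. Qed.

Lemma dot_row n1 n2 (x1 y1 : 'rV[R]_n1) (x2 y2 : 'rV[R]_n2) :
  dot (row_mx x1 x2) (row_mx y1 y2) = dot x1 y1 + dot x2 y2.
Proof. by rewrite /dot tr_row_mx mul_row_col mxE. Qed.

Lemma dot_scalar (a b : R) : dot (a%:M : 'rV_1) b%:M = a * b.
Proof. by rewrite /dot tr_scalar_mx mul_scalar_mx !mxE eqxx mulr1n. Qed.

Lemma dot_ge0 n (x : 'rV[R]_n) : 0 <= dot x x.
Proof. by rewrite dotE; apply: sumr_ge0 => i _; rewrite -expr2 sqr_ge0. Qed.

Lemma dot_eq0 n (x : 'rV[R]_n) : (dot x x == 0) = (x == 0).
Proof.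
apply/eqP/eqP => [|->]; last by rewrite /dot mul0mx mxE.
rewrite dotE => /eqP; rewrite psumr_eq0; last by move=> i _; rewrite -expr2 sqr_ge0.
move=> /allP h; apply/rowP => i; rewrite mxE.
by have := h i (mem_index_enum _); rewrite /= -expr2 sqrf_eq0 => /eqP.
Qed.

Lemma dot0l n (x : 'rV[R]_n) : dot 0 x = 0.
Proof. by rewrite /dot mul0mx mxE. Qed.

Lemma mul_row_tr n (x w : 'rV[R]_n) : x *m w^T = (dot x w)%:M.
Proof. exact: mx11_scalar. Qed.

Lemma qfE n (A : 'M[R]_n) x : qf A x = dot (x *m A) x. Proof. by []. Qed.

Section Schur.
Variables (n : nat) (A Ai : 'M[R]_(1 + n)).
Hypotheses (pA : posdef A) (AAi : A *m Ai = 1%:M).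

Let a := A 0 0.
Let v : 'rV_n := ursubmx A.
Let c : 'rV_n := a^-1 *: v.

Definition schur : 'M[R]_n := drsubmx A - a^-1 *: (v^T *m v).

Lemma schurAE : A = block_mx a%:M v v^T (drsubmx A).
Proof.
have [At _] := pA.
rewrite -[LHS](submxK A); congr block_mx.
  by rewrite [LHS]mx11_scalar mxE mxE; congr (A _ _)%:M; apply: val_inj.
by rewrite /v trmx_ursub At.
Qed.

Lemma qf_schur_expand (B : 'M[R]_(1 + n)) (b : R) w S x0 (x : 'rV_n) :
  B = block_mx b%:M w w^T S ->
  qf B (row_mx x0%:M x) = b * x0 ^+ 2 + 2 * x0 * dot x w + qf S x.
Proof.
move=> ->; rewrite !qfE mul_row_block dot_row mul_row_tr -scalar_mxM -raddfD/=.
rewrite dot_scalar mul_scalar_mx dotDl dotZl (dotC w) ; ring.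
Qed.

Lemma schur_a_gt0 : 0 < a.
Proof.
have := pA.2 (row_mx 1%:M 0); rewrite (qf_schur_expand _ _ schurAE).
rewrite dot0l qfE mul0mx dot0l expr1n mulr0 !addr0 mulr1; apply.
apply/eqP => /(congr1 (fun M : 'rV[R]_(1 + n) => M 0 (lshift n 0))).
by rewrite row_mxEl !mxE eqxx mulr1n => /eqP; rewrite oner_eq0.
Qed.

(** Completing the square in the first coordinate. *)
Lemma qf_schur x0 (x : 'rV_n) :
  qf A (row_mx x0%:M x) = a * (x0 + dot x c) ^+ 2 + qf schur x.
Proof.
rewrite (qf_schur_expand _ _ schurAE) /c dotZr.
have -> : qf schur x = qf (drsubmx A) x - a^-1 * dot x v ^+ 2.
  rewrite !qfE /schur mulmxBr -scalemxAr mulmxA mul_row_tr mul_scalar_mx.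
  by rewrite dotDl dotNl !dotZl (dotC v); ring.
by have := lt0r_neq0 schur_a_gt0 => a0; field.
Qed.

Lemma schur_posdef : posdef schur.
Proof.
split.
  rewrite /schur linearB/= linearZ/= trmx_mul trmxK; congr (_ - _).
  by rewrite trmx_drsub pA.1.
move=> x x0; have := pA.2 (row_mx (- dot x c)%:M x); rewrite qf_schur addNr expr0n/= mulr0 add0r.
apply; apply: contra x0 => /eqP/(congr1 rsubmx).
by rewrite row_mxKr linear0 => ->.
Qed.

Lemma det_schur : \det A = a * \det schur.
Proof.
have a0 := lt0r_neq0 schur_a_gt0.
pose T : 'M[R]_(1 + n) := block_mx 1%:M 0 c^T 1%:M.
pose D : 'M[R]_(1 + n) := block_mx a%:M v 0 schur.
have -> : A = T *m D.
  rewrite /T /D mulmx_block !mul1mx !mul0mx !addr0 {1}schurAE.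
  congr block_mx.
    by rewrite mul_mx_scalar /c linearZ/= scalerA divff// scale1r.
  by rewrite /schur /c linearZ/= -scalemxAl addrC subrK.
rewrite det_mulmx det_lblock det_ublock !det1 !mul1r det_scalar1 //.
Qed.

(** The lower right block of the inverse inverts the Schur complement. *)
Lemma schur_inv : schur *m drsubmx Ai = 1%:M.
Proof.
have := AAi; rewrite {1}schurAE -{1}(submxK Ai) mulmx_block
  (_ : 1%:M = block_mx 1%:M 0 0 1%:M :> 'M[R]_(1 + n)); last by rewrite -scalar_mx_block.
move=> /eq_block_mx[_ e1 _ e2].
have a0 := lt0r_neq0 schur_a_gt0.
have r : ursubmx Ai = - (c *m drsubmx Ai).
  apply: (scalerI a0); rewrite scalerN scalemxAl /c scalerA divff// scale1r.
  by apply/eqP; rewrite -addr_eq0 -mul_scalar_mx e1.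
rewrite /schur mulmxBl -e2 r addrC mulmxN mulmxA; congr (- _ + _).
by rewrite /c -scalemxAr -!scalemxAl.
Qed.

Lemma qf_schur_inv x0 (x : 'rV_n) : Ai^T = Ai ->
  qf Ai (row_mx x0%:M x) = x0 ^+ 2 / a + qf (drsubmx Ai) (x - x0 *: c).
Proof.
move=> Ait; have a0 := lt0r_neq0 schur_a_gt0.
set S := drsubmx Ai; have St : S^T = S by rewrite /S trmx_drsub Ait.
have := AAi; rewrite {1}schurAE -{1}(submxK Ai) mulmx_block
  (_ : 1%:M = block_mx 1%:M 0 0 1%:M :> 'M[R]_(1 + n)); last by rewrite -scalar_mx_block.
move=> /eq_block_mx[e0 e1 _ _].
have r : ursubmx Ai = - (c *m S).
  apply: (scalerI a0); rewrite scalerN scalemxAl /c scalerA divff// scale1r.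
  by apply/eqP; rewrite -addr_eq0 -mul_scalar_mx e1.
have rt : dlsubmx Ai = (ursubmx Ai)^T by rewrite trmx_ursub Ait.
have p : ulsubmx Ai = (a^-1 + dot (c *m S) c)%:M.
  rewrite [LHS]mx11_scalar; congr (_%:M); set q := ulsubmx Ai 0 0.
  move/(congr1 (fun M : 'M[R]_1 => M 0 0)): e0.
  rewrite rt r linearN/= mulmxN mul_row_tr (mx11_scalar (ulsubmx Ai)) -/q.
  rewrite -scalar_mxM !mxE !eqxx !mulr1n => e0; apply: (mulfI a0).
  move: e0; have -> : dot v (c *m S) = a * dot (c *m S) c.
    by rewrite dotC {1}(_ : v = a *: c) ?dotZr// /c scalerA divff// scale1r.
  by move=> e0; rewrite mulrDr divff// -e0; ring.
rewrite (@qf_schur_expand Ai (a^-1 + dot (c *m S) c) (ursubmx Ai) S); last first.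
  by rewrite -p -rt submxK.
have sym (y : 'rV_n) : dot (c *m S) y = dot (y *m S) c.
  by rewrite /dot -[c *m S *m _]trmxK mxE !trmx_mul trmxK St mulmxA.
move: (c) r p sym => d r p sym.
rewrite r dotNr (dotC x) sym !qfE mulmxBl -(scalemxAl x0 d S).
rewrite !(dotDl, dotDr, dotNl, dotNr, dotZl, dotZr) (sym x).
by field.
Qed.

End Schur.

Lemma posdef_inv n (A Ai : 'M[R]_n) : posdef A -> A *m Ai = 1%:M ->
  Ai^T = Ai -> posdef Ai.
Proof.
move=> [At Ap] AAi Ait; split => // x x0.
have AiA : Ai *m A = 1%:M by exact: mulmx1C.
have -> : qf Ai x = qf A (x *m Ai).
  by rewrite !qfE -mulmxA AiA mulmx1 dotC.
apply: Ap; apply: contra x0 => /eqP h.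
by rewrite -(mulmx1 x) -AiA mulmxA h mul0mx.
Qed.

Definition zrow n (x : 'rV[int]_n) : 'rV[R]_n := map_mx intr x.

Definition consz n (p : int * 'rV[int]_n) : 'rV[int]_(1 + n) := row_mx p.1%:M p.2.

Lemma consz_bij n : bijective (@consz n).
Proof.
exists (fun x => (lsubmx x 0 0, rsubmx x)) => [[m x]|x]; rewrite /consz/=.
  by rewrite row_mxKl row_mxKr mxE eqxx mulr1n.
by rewrite -mx11_scalar hsubmxK.
Qed.

Lemma zrow_consz n p : zrow (@consz n p) = row_mx (p.1%:~R)%:M (zrow p.2).
Proof. by rewrite /zrow /consz map_row_mx map_scalar_mx. Qed.

Lemma row_scalar n (u : 'rV[R]_(1 + n)) : u = row_mx (u 0 0)%:M (rsubmx u).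
Proof.
rewrite -[LHS]hsubmxK; congr row_mx.
by rewrite [LHS]mx11_scalar mxE; congr (u _ _)%:M; apply: val_inj.
Qed.

Lemma zrowD_consz n p (u : 'rV[R]_(1 + n)) :
  zrow (consz p) + u = row_mx (p.1%:~R + u 0 0)%:M (zrow p.2 + rsubmx u).
Proof.
by rewrite zrow_consz {1}(row_scalar u) add_row_mx -raddfD.
Qed.

(** Uniformly in the shift r, which may be reduced modulo 1. *)
Lemma gauss_int_summ (b : R) : 0 < b -> exists2 K, 0 <= K & forall r : R,
  summ (fun m : int => expR (- (b * (m%:~R + r) ^+ 2))) /\
  psum (fun m : int => expR (- (b * (m%:~R + r) ^+ 2))) <= K.
Proof.
move=> b0; have [K K0 HK] := @gauss_le_qdecay R b (2 * b) b0.
have [sq q12] := @qdecay_lattice R 1 ltr01 (lexx _).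
exists (K * 12); first by rewrite mulr_ge0.
move=> r; pose k : int := - Num.floor r.
pose g (m : int) := expR (- (b * (m%:~R + (r - (Num.floor r)%:~R)) ^+ 2)).
have fr0 : 0 <= r - (Num.floor r)%:~R by rewrite subr_ge0 Num.Theory.floor_le.
have fr1 : r - (Num.floor r)%:~R <= 1.
  by have := Num.Theory.floorD1_gt r; rewrite rmorphD rmorph1 /=; lra.
have gE : (fun m : int => expR (- (b * (m%:~R + r) ^+ 2))) =
    g \o (fun m : int => m + Num.floor r).
  apply/funext => m; rewrite /g /= rmorphD/=; congr expR; congr (- (_ * _ ^+ 2)).
  by ring.
have bj : bijective (fun m : int => m + Num.floor r).
  by exists (fun m => m - Num.floor r) => m; ring.
have gK m : g m <= K * (1 * qdecay (m%:~R * 1)).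
  rewrite mul1r mulr1; apply: le_trans (HK m%:~R); rewrite ler_expR /=.
  move: (r - _) fr0 fr1 => f f0 f1.
  have : b * ((m%:~R : R) ^+ 2 - 2 * `|m%:~R|) <= b * (m%:~R + f) ^+ 2.
    rewrite ler_pM2l//; move: (m%:~R : R) => y.
    have : `|y * f| <= `|y| by rewrite normrM (ger0_norm f0) ler_piMr.
    by rewrite ler_norml => /andP[]; have := sqr_ge0 f; rewrite sqrrD; lra.
  by lra.
have sK := summZ K sq.
have sg : summ g by apply: summ_le sK => m; rewrite ger0_norm ?expR_ge0.
rewrite gE; split; first by apply/summ_bij.
rewrite /psum -(esum_bij g bj) -/(psum g).
apply: le_trans (ler_wpM2l K0 q12); rewrite -psumZ//.
  by apply: le_psum => // m; exact: expR_ge0.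
by move=> m; rewrite mul1r ltW// qdecay_gt0.
Qed.

Lemma rV0_eq (T : nmodType) (x y : 'rV[T]_0) : x = y.
Proof. by apply/rowP => -[]. Qed.

(** Gaussian families over the integer points are summable for any positive
    definite form: sum first over the coordinate split off by the Schur
    complement, uniformly in the shift it undergoes. *)
Lemma qf_summ n (A : 'M[R]_n) (b : R) (u : 'rV[R]_n) : posdef A -> 0 < b ->
  summ (fun x : 'rV[int]_n => expR (- (b * qf A (zrow x + u)))).
Proof.
elim: n A u => [|n IH] A u pA b0.
  apply: (@rsum_single R _ _ 0 _).1 => x.
  by rewrite (rV0_eq x 0) eqxx.
have a0 := @schur_a_gt0 n A pA.
have [K K0 HK] := gauss_int_summ (mulr_gt0 b0 a0).
have s2 := IH _ (rsubmx (u : 'rV_(1 + n))) (@schur_posdef n A pA) b0.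
apply/(@summ_bij R _ _ _ _ (consz_bij n)).
apply/(@summ_bij R _ _ _ _ (swap_bij _ _)).
pose c := (A 0 0)^-1 *: ursubmx (A : 'M[R]_(1 + n)).
have E (z : 'rV[int]_n * int) : expR (- (b * qf A (zrow (consz (z.2, z.1)) + u))) =
   expR (- (b * A 0 0 * (z.2%:~R + (u 0 0 + dot (zrow z.1 + rsubmx (u : 'rV_(1 + n))) c)) ^+ 2)) *
   expR (- (b * qf (schur (A : 'M[R]_(1 + n))) (zrow z.1 + rsubmx (u : 'rV_(1 + n))))).
  rewrite zrowD_consz/= (@qf_schur n A pA) -expRD; congr expR; rewrite -/c; ring.
have {}E : ((fun x : 'rV[int]_(1 + n) => expR (- (b * qf A (zrow x + u)))) \o consz (n:=n)) \o
  (fun z => (z.2, z.1)) =1 (fun z : 'rV[int]_n * int =>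
   expR (- (b * qf (schur (A : 'M[R]_(1 + n))) (zrow z.1 + rsubmx (u : 'rV_(1 + n))))) *
   expR (- (b * A 0 0 * (z.2%:~R + (u 0 0 + dot (zrow z.1 + rsubmx (u : 'rV_(1 + n))) c)) ^+ 2))).
  by move=> z /=; rewrite E mulrC.
rewrite (funext E).
apply: (@summ_pairP _ _ _ _ (fun x => K * expR (- (b * qf (schur (A : 'M[R]_(1 + n)))
  (zrow x + rsubmx (u : 'rV_(1 + n))))))).
- by move=> x /=; exact: (summZ _ (HK _).1).
- move=> x /=; set r := u 0 0 + _.
  rewrite (@eq_psum _ _ _ (fun m : int => expR (- (b * qf (schur (A : 'M[R]_(1 + n)))
    (zrow x + rsubmx (u : 'rV_(1 + n))))) * expR (- (b * A 0 0 * (m%:~R + r) ^+ 2)))); last first.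
    by move=> m; rewrite ger0_norm// mulr_ge0 ?expR_ge0.
  rewrite psumZ ?expR_ge0//; last exact: (HK r).1.
  by rewrite mulrC ler_wpM2r ?expR_ge0// (HK r).2.
- exact: summZ.
Qed.

End QuadraticForms.

Section PoissonForms.
Context {R : realType}.
Local Notation C := R[i].

Definition gterm n (t : C) (A : 'M[R]_n) (x z : 'rV[R]_n) : C :=
  cex (- (pi%:C * t * (qf A x)%:C) + 2 * pi%:C * ii * (dot x z)%:C).

Lemma Re_ii (x : R) : Re (2 * pi%:C * ii * x%:C : C) = 0.
Proof.
by rewrite -(rmorph_nat (real_complex R)); simpc => /=; rewrite ?(mulr0,mul0r,subr0,addr0).
Qed.

Lemma ReD (x y : C) : Re (x + y) = Re x + Re y. Proof. by case: x y => ? ? []. Qed.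

Lemma ReZr (t : C) (x : R) : Re (t * x%:C) = Re t * x.
Proof. by rewrite mulrC ReZ mulrC. Qed.

Lemma cabs_gterm n t (A : 'M[R]_n) x z :
  cabs (gterm t A x z) = expR (- (pi * Re t * qf A x)).
Proof. by rewrite /gterm cabs_cex ReD Re_ii addr0 ReN ReZr ReZ. Qed.

Lemma gterm_summable n t (A : 'M[R]_n) (u z : 'rV[R]_n) : posdef A -> 0 < Re t ->
  csummable (fun x : 'rV[int]_n => gterm t A (zrow x + u) z).
Proof.
move=> pA t0.
have := qf_summ u pA (mulr_gt0 (pi_gt0 R) t0).
by apply: csummable_le => x; rewrite cabs_gterm.
Qed.

Lemma cone_scale (s : C) (a : R) : cone s -> 0 < a -> cone (s * a%:C).
Proof.
move=> cs a0; rewrite /cone mulrC ReZ ImZ normrM (gtr0_norm a0).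
by rewrite ltr_pM2l.
Qed.

(** The one-dimensional formula at s sqrt a, where the characteristic z is
    absorbed into a complex shift w. *)
Lemma gauss_inversion (s : C) (a r z : R) : cone s -> 0 < a ->
  s * (Num.sqrt a)%:C * csum (fun m : int =>
    cex (- (pi%:C * s ^+ 2 * (a * (m%:~R + r) ^+ 2)%:C)
      + 2 * pi%:C * ii * ((m%:~R + r) * z)%:C)) =
  csum (fun k : int => cex (- (pi%:C * s ^- 2 * ((k%:~R - z) ^+ 2 / a)%:C)
      + 2 * pi%:C * ii * (k%:~R * r)%:C)).
Proof.
move=> cs a0; have sa0 : 0 < Num.sqrt a by rewrite sqrtr_gt0.
have cs' := cone_scale cs sa0; have s0 := cone_neq0 cs.
have an0 := lt0r_neq0 a0.
have aC : (a%:C : C) != 0 by rewrite fmorph_eq0.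
have sa2 : (Num.sqrt a)%:C ^+ 2 = a%:C :> C by rewrite -rmorphXn/= sqr_sqrtr// ltW.
pose w : C := r%:C - ii * z%:C / (s ^+ 2 * a%:C).
have ii2 : ii ^+ 2 = -1 :> C by rewrite sqr_i.
pose e := cex (- (pi%:C * z%:C ^+ 2 / (s ^+ 2 * a%:C))).
have mC (m : int) : (m%:~R : R)%:C = m%:~R :> C by rewrite rmorph_int.
have [K K0 HK] := eta_decay0 (s * (Num.sqrt a)%:C * w) (cone_Re cs').
have s1 : csummable (fun m : int => eta (s * (Num.sqrt a)%:C * (m%:~R)%:C + s * (Num.sqrt a)%:C * w)).
  by apply: csummable_le (qdecay_int_summ K) => m.
have [K' K'0 HK'] := theta_term_decay w (cone_neq0 cs') (cone_Re cs').
have s2 : csummable (fun k : int => cex (2 * pi%:C * ii * k%:~R * w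
    - pi%:C * k%:~R ^+ 2 / (s * (Num.sqrt a)%:C) ^+ 2)).
  by apply: csummable_le (qdecay_int_summ K') => k; have := HK' k%:~R; rewrite mC.
have := congr1 (fun t => e * t) (theta_inversion w cs').
rewrite /= mulrCA /theta_prim /theta_dual -(csumZ _ s1) -(csumZ _ s2) => h.
transitivity (s * (Num.sqrt a)%:C *
  csum (fun m : int => e * eta (s * (Num.sqrt a)%:C * (m%:~R)%:C + s * (Num.sqrt a)%:C * w))).
  congr (_ * _); apply: eq_csum => m; rewrite /e /eta -cexD; congr cex.
  have -> : (a * (m%:~R + r) ^+ 2)%:C = a%:C * (m%:~R + r%:C) ^+ 2 :> C.
    by rewrite rmorphM rmorphXn rmorphD /= mC.
  have -> : ((m%:~R + r) * z)%:C = (m%:~R + r%:C) * z%:C :> C.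
    by rewrite rmorphM rmorphD /= mC.
  rewrite -[in RHS]mulrDr exprMn exprMn sa2 mC.
  rewrite (_ : (m%:~R + w) ^+ 2 = (m%:~R + r%:C) ^+ 2
    - 2 * ii * z%:C * (m%:~R + r%:C) / (s ^+ 2 * a%:C)
    + ii ^+ 2 * z%:C ^+ 2 / (s ^+ 2 * a%:C) ^+ 2); last first.
    by rewrite /w; field; apply/andP; split.
  by rewrite ii2; field; apply/andP; split.
rewrite h; apply: eq_csum => k; rewrite /e -cexD; congr cex.
have -> : ((k%:~R - z) ^+ 2 / a)%:C = (k%:~R - z%:C) ^+ 2 / a%:C :> C.
  by rewrite rmorphM rmorphXn rmorphB fmorphV /= mC.
have -> : (k%:~R * r)%:C = k%:~R * r%:C :> C by rewrite rmorphM /= mC.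
rewrite exprMn sa2 /w.
rewrite (_ : 2 * pi%:C * ii * k%:~R * (r%:C - ii * z%:C / (s ^+ 2 * a%:C)) =
  2 * pi%:C * ii * k%:~R * r%:C - 2 * pi%:C * ii ^+ 2 * k%:~R * z%:C / (s ^+ 2 * a%:C)); last by ring.
by rewrite ii2; field; apply/andP; split.
Qed.

Lemma csum_consz n (f : 'rV[int]_(1 + n) -> C) : csummable f ->
  csummable (fun z : 'rV[int]_n * int => f (consz (z.2, z.1))) /\
  csum f = csum (fun x : 'rV[int]_n => csum (fun m : int => f (consz (m, x)))).
Proof.
move=> sf.
have s1 : csummable (f \o @consz n) by apply/csummable_bij => //; exact: consz_bij.
split; first exact: (csummable_swap s1).
by rewrite -(csum_bij f (consz_bij n)) csum_pair// csum_swap.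
Qed.

Lemma gterm_schur n (t : C) (A : 'M[R]_(1 + n)) (u z : 'rV[R]_(1 + n)) m
    (x : 'rV[int]_n) : posdef A ->
  let c := (A 0 0)^-1 *: ursubmx A in
  let u' := rsubmx u in let z' := rsubmx z in
  let r := u 0 0 + dot (zrow x + u') c in
  gterm t A (zrow (consz (m, x)) + u) z =
  cex (- (pi%:C * t * (A 0 0 * (m%:~R + r) ^+ 2)%:C)
       + 2 * pi%:C * ii * ((m%:~R + r) * z 0 0)%:C) *
  gterm t (schur A) (zrow x + u') (z' - z 0 0 *: c).
Proof.
move=> pA c u' z' r; rewrite /gterm -cexD zrowD_consz/= (qf_schur pA) -/c -/u'.
rewrite {1}(row_scalar z) dot_row dot_scalar -/z' dotDr dotNr (dotZr (z 0 0)).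
congr cex; rewrite (_ : A 0 0 * (m%:~R + u 0 0 + dot (zrow x + u') c) ^+ 2 =
  A 0 0 * (m%:~R + r) ^+ 2); last by rewrite /r; ring.
rewrite (_ : (m%:~R + u 0 0) * z 0 0 = (m%:~R + r) * z 0 0
   - z 0 0 * dot (zrow x + u') c); last by rewrite /r; ring.
rewrite !(rmorphD, rmorphN)/=; ring.
Qed.

Lemma csummable_prod (T1 T2 : choiceType) (F : T1 * T2 -> C) (f : T1 -> R) (g : T2 -> R) :
  (forall z, cabs (F z) <= f z.1 * g z.2) -> (forall x, 0 <= f x) ->
  (forall y, 0 <= g y) -> summ f -> summ g -> csummable F.
Proof.
move=> Ffg f0 g0 sf sg; apply: (@csummable_pairP _ _ _ _ (fun x => psum g * f x)).
- by move=> x; apply: csummable_le (summZ (f x) sg) => y; exact: (Ffg (x, y)).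
- move=> x; rewrite mulrC -psumZ//; apply: le_psum => //.
  + by move=> y; exact: cabs_ge0.
  + exact: summZ.
- exact: summZ.
Qed.

(** Theta inversion: apply the one-dimensional formula in the coordinate split
    off by the Schur complement, exchange the sums, and use the formula in
    dimension one less for the complement. *)
Theorem qf_inversion n (A Ai : 'M[R]_n) (s : C) (u z : 'rV[R]_n) :
  posdef A -> A *m Ai = 1%:M -> Ai^T = Ai -> cone s ->
  s ^+ n * (Num.sqrt (\det A))%:C *
    csum (fun x : 'rV[int]_n => gterm (s ^+ 2) A (zrow x + u) z) =
  csum (fun y : 'rV[int]_n => gterm (s ^- 2) Ai (zrow y - z) u *
    cex (2 * pi%:C * ii * (dot z u)%:C)).
Proof.
elim: n A Ai u z => [|n IH] A Ai u z pA AAi Ait cs.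
  have z0 (x : 'rV[int]_0) : x != 0 -> false by rewrite (rV0_eq x 0) eqxx.
  rewrite (@csum_single _ _ _ 0 _).2; last by move=> x /z0.
  rewrite (@csum_single _ _ _ 0 _).2; last by move=> x /z0.
  rewrite expr0 det_mx00 sqrtr1 /gterm (rV0_eq z 0) (rV0_eq u 0) (rV0_eq (zrow 0 + 0) 0).
  rewrite (rV0_eq (zrow 0 - 0) 0) !qfE !mul0mx !dot0l rmorph0 !mulr0 oppr0 addr0 cex0.
  by rewrite rmorph1 !mul1r.
pose a := A 0 0; pose c := a^-1 *: ursubmx (A : 'M[R]_(1 + n)).
pose S := drsubmx (Ai : 'M[R]_(1 + n)).
pose u' := rsubmx (u : 'rV[R]_(1 + n)); pose z' := rsubmx (z : 'rV[R]_(1 + n)).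
pose u0 := u 0 0; pose z0 := z 0 0.
have a0 : 0 < a := @schur_a_gt0 R n A pA.
have pS : posdef (schur (A : 'M[R]_(1 + n))) := @schur_posdef R n A pA.
have SS : schur (A : 'M[R]_(1 + n)) *m S = 1%:M := @schur_inv R n A Ai pA AAi.
have St : S^T = S by rewrite /S trmx_drsub Ait.
have s20 := cone_Re cs.
have t20 : 0 < Re (s ^- 2) by exact: ReV_gt0.
have pAi := posdef_inv pA AAi Ait.
have [_ ->] := @csum_consz n _ (@gterm_summable _ (s ^+ 2) A u z pA s20).
have sR : csummable (fun y : 'rV[int]_n.+1 => gterm (s ^- 2) Ai (zrow y - z) u *
    cex (2 * pi%:C * ii * (dot z u)%:C)).
  apply: (eq_csummable (fun y => mulrC (cex (2 * pi%:C * ii * (dot z u)%:C))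
     (gterm (s ^- 2) Ai (zrow y - z) u))).
  apply: csummableZ; exact: (@gterm_summable _ (s ^- 2) Ai (- z) u pAi t20).
have [s2 ->] := @csum_consz n _ sR.
rewrite (csum_swap s2) /=.
pose r (x : 'rV[int]_n) := u0 + dot (zrow x + u') c.
pose G (k : int) : C := cex (- (pi%:C * s ^- 2 * ((k%:~R - z0) ^+ 2 / a)%:C)
  + 2 * pi%:C * ii * (k%:~R * u0)%:C).
pose zk (k : int) := z' + (k%:~R - z0) *: c.
pose D : C := s ^+ n * (Num.sqrt (\det (schur (A : 'M[R]_(1 + n)))))%:C.
have DE : s ^+ n.+1 * (Num.sqrt (\det A))%:C = D * (s * (Num.sqrt a)%:C).
  rewrite (@det_schur R n A pA) -/a sqrtrM ?ltW// rmorphM /D exprSr; ring.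
have F1 (x : 'rV[int]_n) : s * (Num.sqrt a)%:C *
    csum (fun m : int => gterm (s ^+ 2) A (zrow (consz (m, x)) + u) z) =
    csum (fun k : int => G k * gterm (s ^+ 2) (schur (A : 'M[R]_(1 + n))) (zrow x + u') (zk k)).
  pose h := gterm (s ^+ 2) (schur (A : 'M[R]_(1 + n))) (zrow x + u') (z' - z0 *: c).
  have sg : csummable (fun m : int => cex (- (pi%:C * s ^+ 2 * (a * (m%:~R + r x) ^+ 2)%:C)
       + 2 * pi%:C * ii * ((m%:~R + r x) * z0)%:C)).
    have [K K0 HK] := @gauss_int_summ R (pi * Re (s ^+ 2) * a)
      (mulr_gt0 (mulr_gt0 (pi_gt0 R) s20) a0).
    apply: csummable_le (HK (r x)).1 => m.
    by rewrite cabs_cex ReD Re_ii addr0 ReN ReZr ReZ mulrA.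
  rewrite (@eq_csum _ _ _ (fun m : int => h * cex (- (pi%:C * s ^+ 2 * (a * (m%:~R + r x) ^+ 2)%:C)
       + 2 * pi%:C * ii * ((m%:~R + r x) * z0)%:C))); last first.
    by move=> m; rewrite (@gterm_schur n _ _ _ _ _ _ pA) mulrC.
  rewrite csumZ// mulrCA gauss_inversion//.
  have se : csummable (fun k : int => cex (- (pi%:C * s ^- 2 * ((k%:~R - z0) ^+ 2 / a)%:C)
      + 2 * pi%:C * ii * (k%:~R * r x)%:C)).
    have [K K0 HK] := @gauss_int_summ R (pi * Re (s ^- 2) / a)
      (divr_gt0 (mulr_gt0 (pi_gt0 R) t20) a0).
    apply: csummable_le (HK (- z0)).1 => k.
    rewrite cabs_cex ReD Re_ii addr0 ReN ReZr ReZ ler_expR lerN2.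
    by apply: eqr_lex; ring.
  rewrite -csumZ//; apply: eq_csum => k.
  rewrite /h /G /gterm -!cexD; congr cex.
  rewrite /zk /r !(dotDr, dotNr, dotZr _ c).
  rewrite !(rmorphD, rmorphN, rmorphM) /=; ring.
have sF : csummable (fun p : 'rV[int]_n * int => G p.2 *
    gterm (s ^+ 2) (schur (A : 'M[R]_(1 + n))) (zrow p.1 + u') (zk p.2)).
  have [K K0 HK] := @gauss_int_summ R (pi * Re (s ^- 2) / a)
      (divr_gt0 (mulr_gt0 (pi_gt0 R) t20) a0).
  have q := qf_summ u' pS (mulr_gt0 (pi_gt0 R) s20).
  apply: (csummable_prod _ _ _ q (HK (- z0)).1) => [p|x|k]; try exact: expR_ge0.
  rewrite cabsM cabs_gterm mulrC ler_wpM2l ?expR_ge0// /G.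
  rewrite cabs_cex ReD Re_ii addr0 ReN ReZr ReZ ler_expR lerN2.
  by apply: eqr_lex; ring.
have sL := csummable_pair2 (csummable_swap s2).
have s1 : csummable (fun x : 'rV[int]_n => csum (fun m : int =>
    gterm (s ^+ 2) A (zrow (consz (m, x)) + u) z)).
  have [h1 _] := @csum_consz n _ (@gterm_summable _ (s ^+ 2) A u z pA s20).
  exact: (csummable_pair2 h1).
rewrite DE -mulrA -(csumZ _ s1) (eq_csum F1) (csum_swap sF) /=.
rewrite -csumZ; last exact: (csummable_pair2 (csummable_swap sF)).
apply: eq_csum => k.
have sk : csummable (fun x : 'rV[int]_n =>
    gterm (s ^+ 2) (schur (A : 'M[R]_(1 + n))) (zrow x + u') (zk k)).
  exact: gterm_summable.
rewrite csumZ// mulrCA /D (IH _ S)// -csumZ; last first.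
  apply: (eq_csummable (fun y => mulrC (cex (2 * pi%:C * ii * (dot (zk k) u')%:C))
     (gterm (s ^- 2) S (zrow y - zk k) u'))).
  apply: csummableZ; apply: gterm_summable => //.
  by apply: posdef_inv SS St.
apply: eq_csum => y; rewrite /gterm -!cexD; congr cex.
have -> : zrow (consz (k, y)) - z = row_mx (k%:~R - z0)%:M (zrow y - z') :> 'rV[R]_(1 + n).
  by rewrite zrowD_consz/= mxE [rsubmx _]raddfN.
rewrite (@qf_schur_inv R n A Ai pA AAi _ _ Ait) -/a -/c -/S.
rewrite (_ : zrow y - z' - (k%:~R - z0) *: c = zrow y - zk k); last first.
  by rewrite /zk opprD addrA.
have uE : u = row_mx u0%:M u' := row_scalar (u : 'rV[R]_(1 + n)).
have zE : z = row_mx z0%:M z' := row_scalar (z : 'rV[R]_(1 + n)).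
have -> : dot (row_mx (k%:~R - z0)%:M (zrow y - z')) u =
    (k%:~R - z0) * u0 + dot (zrow y - z') u'.
  by rewrite {1}uE dot_row dot_scalar.
have -> : dot z u = z0 * u0 + dot z' u'.
  transitivity (dot (row_mx z0%:M z') (row_mx u0%:M u')); first by rewrite -uE -zE.
  by rewrite dot_row dot_scalar.
rewrite !(dotDl, dotNl) !(rmorphD, rmorphN, rmorphM) /=.
ring.
Qed.

End PoissonForms.

(** * Theta series with a harmonic quadratic weight *)

Section SecondDifferences.
Context {R : realType}.
Local Notation C := R[i].

Lemma pow_le_exp (c : R) k : 0 <= c -> c ^+ k <= expR (k%:R * c).
Proof.
move=> c0; rewrite expRM_natl lerXn2r ?nnegrE ?expR_ge0//.
by have := expR_ge1Dx c; lra.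
Qed.

Lemma csummableB (T : choiceType) (f g : T -> C) : csummable f -> csummable g ->
  csummable (fun x => f x - g x).
Proof. by move=> sf sg; exact: csummableD sf (csummableN sg). Qed.

Definition second_quotient (a b : C) (e : R) : C :=
  (cex (a * e%:C + b * e%:C ^+ 2) + cex (- (a * e%:C) + b * e%:C ^+ 2) - 2)
  / e%:C ^+ 2.

Lemma second_quotient_approx (a b : C) (e : R) : 0 < e -> e <= 1 ->
  cabs (second_quotient a b e - (a ^+ 2 + 2 * b)) <= 13 * e * expR (4 * (cabs a + cabs b)).
Proof.
move=> e0 e1; set c := cabs a + cabs b.
have e0' := ltW e0.
have c0 : 0 <= c by rewrite addr_ge0 ?cabs_ge0.
have eC : e%:C != 0 :> C by rewrite fmorph_eq0 gt_eqF.
pose d1 := a * e%:C + b * e%:C ^+ 2; pose d2 := - (a * e%:C) + b * e%:C ^+ 2.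
have e21 : e ^+ 2 <= e by rewrite expr2 ler_piMr.
have db (d : C) : d = d1 \/ d = d2 -> cabs d <= c * e.
  have aux : cabs (a * e%:C) + cabs (b * e%:C ^+ 2) <= c * e.
    rewrite !(cabsM a, cabsM b) cabsX cabsR ger0_norm// /c mulrDl lerD2l.
    by rewrite ler_wpM2l ?cabs_ge0.
  by move=> [->|->]; apply: (le_trans (cabsD _ _)); rewrite ?cabsN.
pose r (d : C) := cex d - 1 - d - d ^+ 2 / 2.
have rb (d : C) : d = d1 \/ d = d2 -> cabs (r d) <= 6 * e ^+ 3 * expR (4 * c).
  move=> /db dc; apply: (le_trans (cex_bound3 d)).
  have ce : c * e <= c by rewrite ler_piMr.
  apply: (@le_trans _ _ (6 * (c * e) ^+ 3 * expR c)).
    apply: ler_pM; rewrite ?mulr_ge0 ?exprn_ge0 ?cabs_ge0 ?expR_ge0//.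
      by rewrite ler_wpM2l// lerXn2r ?nnegrE ?cabs_ge0// mulr_ge0.
    by rewrite ler_expR (le_trans dc).
  rewrite exprMn (_ : 6 * (c ^+ 3 * e ^+ 3) * expR c = 6 * e ^+ 3 * (c ^+ 3 * expR c)); last by ring.
  rewrite ler_wpM2l ?mulr_ge0 ?exprn_ge0//.
  rewrite (_ : 4 * c = 3%:R * c + c); last by ring.
  by rewrite (expRD (_ * c)); apply: ler_wpM2r; rewrite ?expR_ge0 ?pow_le_exp.
have -> : second_quotient a b e - (a ^+ 2 + 2 * b) =
    (r d1 + r d2) / e%:C ^+ 2 + b ^+ 2 * e%:C ^+ 2.
  by rewrite /second_quotient /r -/d1 -/d2 /d1 /d2; field.
apply: (le_trans (cabsD _ _)).
have h1 : cabs ((r d1 + r d2) / e%:C ^+ 2) <= 12 * e * expR (4 * c).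
  rewrite cabsM cabsV cabsX cabsR ger0_norm// ler_pdivrMr ?exprn_gt0//.
  apply: (le_trans (cabsD _ _)).
  apply: (le_trans (lerD (rb d1 (or_introl erefl)) (rb d2 (or_intror erefl)))).
  by apply: eqr_lex; ring.
have h2 : cabs (b ^+ 2 * e%:C ^+ 2) <= e * expR (4 * c).
  rewrite cabsM !cabsX cabsR ger0_norm// mulrC ler_pM ?exprn_ge0 ?cabs_ge0//.
  apply: (@le_trans _ _ (c ^+ 2)).
    by rewrite lerXn2r ?nnegrE ?cabs_ge0// /c lerDr cabs_ge0.
  apply: (le_trans (pow_le_exp 2 c0)); rewrite ler_expR.
  by rewrite ler_wpM2r// ler_nat.
by apply: (le_trans (lerD h1 h2)); apply: eqr_lex; ring.
Qed.

(** Differentiating a family of exponentials twice under the summation sign,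
    by second differences and dominated convergence. *)
Lemma csum_second_quotient (T : choiceType) (f : T -> C) (a : T -> C) (b : C) :
  summ (fun x => cabs (f x) * expR (4 * (cabs (a x) + cabs b))) ->
  csummable (fun x => f x * (a x ^+ 2 + 2 * b)) /\
  cabs (csum (fun x => f x * second_quotient (a x) b n.+1%:R^-1) -
        csum (fun x => f x * (a x ^+ 2 + 2 * b))) @[n --> \oo] --> (0 : R).
Proof.
set g := fun x => _; move=> sg.
have s1 : csummable (fun x => f x * (a x ^+ 2 + 2 * b)).
  apply: csummable_le (summZ 3 sg) => x; rewrite cabsM /g mulrCA.
  rewrite ler_wpM2l ?cabs_ge0//; set c := cabs (a x) + cabs b.
  have c0 : 0 <= c by rewrite addr_ge0 ?cabs_ge0.
  apply: (le_trans (cabsD _ _)); rewrite cabsX cabsM cabs_natr.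
  have h1 : cabs (a x) ^+ 2 <= expR (4 * c).
    apply: (@le_trans _ _ (c ^+ 2)).
      by rewrite lerXn2r ?nnegrE ?cabs_ge0// /c lerDl cabs_ge0.
    by apply: (le_trans (pow_le_exp 2 c0)); rewrite ler_expR ler_wpM2r// ler_nat.
  have h2 : cabs b <= expR (4 * c).
    apply: (@le_trans _ _ c); first by rewrite /c lerDr cabs_ge0.
    by rewrite -[leLHS]expr1; apply: (le_trans (pow_le_exp 1 c0)); rewrite ler_expR ler_wpM2r// ler_nat.
  by lra.
have en (n : nat) : 0 < (n.+1%:R^-1 : R) /\ (n.+1%:R^-1 : R) <= 1.
  by rewrite invr_gt0 ltr0n invf_le1// ler1n.
have hd n x : cabs (f x * second_quotient (a x) b n.+1%:R^-1 - f x * (a x ^+ 2 + 2 * b)) <=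
    13 * g x * n.+1%:R^-1.
  rewrite -mulrBr cabsM.
  have := @second_quotient_approx (a x) b _ (en n).1 (en n).2.
  move=> /(ler_wpM2l (cabs_ge0 (f x))) h; apply: (le_trans h).
  by apply: eqr_lex; rewrite /g; ring.
have hd1 n x : cabs (f x * second_quotient (a x) b n.+1%:R^-1 - f x * (a x ^+ 2 + 2 * b)) <= 13 * g x.
  apply: (le_trans (hd n x)); rewrite ler_piMr ?(en n).2//.
  by rewrite !mulr_ge0 ?cabs_ge0 ?expR_ge0.
have sn n : csummable (fun x => f x * second_quotient (a x) b n.+1%:R^-1).
  have s3 : csummable (fun x => f x * second_quotient (a x) b n.+1%:R^-1 - f x * (a x ^+ 2 + 2 * b)).
    by apply: csummable_le (summZ 13 sg) => x; exact: hd1.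
  apply: eq_csummable (csummableD s3 s1) => x; ring.
split => //.
have E n : csum (fun x => f x * second_quotient (a x) b n.+1%:R^-1) -
    csum (fun x => f x * (a x ^+ 2 + 2 * b)) =
    csum (fun x => f x * second_quotient (a x) b n.+1%:R^-1 - f x * (a x ^+ 2 + 2 * b)).
  by rewrite csumB.
under eq_fun do rewrite E.
apply: (csum_tannery (g := fun x => 13 * g x)) => //; first exact: summZ.
move=> x; apply: (@squeeze_cvgr _ _ _ _ (cst 0) (fun n => 13 * g x * n.+1%:R^-1)).
- by near=> n; rewrite /cst cabs_ge0 hd.
- exact: cvg_cst.
- rewrite -[X in _ --> X](mulr0 (13 * g x)); apply: cvgM; first exact: cvg_cst.
  exact: (@cvg_harmonic R).
Unshelve. all: by end_near. Qed.

End SecondDifferences.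

Section LatticeTheta.
Context {R : realType}.
Local Notation C := R[i].
Variables (m : nat) (B : 'M[R]_m).
Hypothesis uB : B \in unitmx.

(** Its rows form a basis of the dual lattice. *)
Definition dualmx : 'M[R]_m := (invmx B)^T.

Lemma gram_posdef : posdef (B *m B^T).
Proof.
split; first by rewrite trmx_mul trmxK.
move=> x x0; have -> : qf (B *m B^T) x = dot (x *m B) (x *m B).
  by rewrite /qf /dot trmx_mul !mulmxA.
rewrite lt_neqAle dot_ge0 eq_sym dot_eq0 andbT.
apply: contra x0 => /eqP h; apply/eqP.
by rewrite -(mulmxK uB x) h mul0mx.
Qed.

Lemma gram_inv : (B *m B^T) *m (dualmx *m dualmx^T) = 1%:M.
Proof.
rewrite /dualmx trmxK -mulmxA (mulmxA B^T) -trmx_mul mulVmx// trmx1 mul1mx.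
by rewrite mulmxV.
Qed.

Lemma qf_gram (x : 'rV[R]_m) : qf (B *m B^T) x = dot (x *m B) (x *m B).
Proof. by rewrite /qf /dot trmx_mul !mulmxA. Qed.

Lemma lattice_summ (b : R) (w : 'rV[R]_m) : 0 < b ->
  summ (fun x : 'rV[int]_m => expR (- (b * dot (zrow x *m B + w) (zrow x *m B + w)))).
Proof.
move=> b0; have := qf_summ (w *m invmx B) gram_posdef b0.
by under eq_fun do rewrite qf_gram mulmxDl mulmxKV//.
Qed.

Lemma dot_amgm (d : R) (x v : 'rV[R]_m) : 0 < d ->
  `|dot x v| <= d * dot x x + dot v v / (4 * d).
Proof.
move=> d0; have d1 := lt0r_neq0 d0.
have h (e : R) : e ^+ 2 = 1 -> 0 <= d * dot x x + dot v v / (4 * d) - e * dot x v.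
  move=> e2; have := mulr_ge0 (ltW d0) (dot_ge0 (x - (e / (2 * d)) *: v)).
  rewrite !(dotDl, dotDr, dotNl, dotNr, dotZl, dotZr) (dotC v x).
  move: (dot x x) (dot x v) (dot v v) => xx xv vv.
  move=> h; apply: (le_trans h); apply: eqr_lex.
  have -> : vv / (4 * d) = e ^+ 2 * vv / (4 * d) by rewrite e2 mul1r.
  by field.
have := h 1 (expr1n _ _); have := h (-1); rewrite sqrrN expr1n => /(_ erefl).
by rewrite ler_norml => ? ?; apply/andP; split; lra.
Qed.

Lemma gauss_lin_summ (b c : R) (w v : 'rV[R]_m) : 0 < b -> 0 <= c ->
  summ (fun x : 'rV[int]_m => let X := zrow x *m B + w in
    expR (- (b * dot X X)) * expR (c * `|dot X v|)).
Proof.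
move=> b0 c0; pose d := b / (2 * (c + 1)).
have c1 : 0 < c + 1 by lra.
have d0 : 0 < d by rewrite divr_gt0// mulr_gt0.
have b2 : 0 < b / 2 by rewrite divr_gt0.
apply: summ_le (summZ (expR (c * (dot v v / (4 * d)))) (lattice_summ w b2)) => x.
set X := _ + w; rewrite /= -!expRD ger0_norm ?expR_ge0// ler_expR.
have h := ler_wpM2l c0 (dot_amgm X v d0).
have h2 : c * (d * dot X X) <= b / 2 * dot X X.
  rewrite mulrA ler_wpM2r ?dot_ge0// /d mulrA ler_pdivrMr ?mulr_gt0//.
  have := ltW b0; nra.
by rewrite mulrDr in h; lra.
Qed.

Lemma gauss_sq_summ (b : R) (w : 'rV[R]_m) : 0 < b ->
  summ (fun x : 'rV[int]_m => let X := zrow x *m B + w in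
    dot X X * expR (- (b * dot X X))).
Proof.
move=> b0; have b2 : 0 < b / 2 by rewrite divr_gt0.
apply: summ_le (summZ (2 / b) (lattice_summ w b2)) => x.
set X := _ + w; rewrite /= ger0_norm ?mulr_ge0 ?dot_ge0 ?expR_ge0//.
rewrite (_ : - (b * dot X X) = - (b / 2 * dot X X) + - (b / 2 * dot X X)); last by field.
rewrite expRD mulrA; apply: ler_wpM2r; rewrite ?expR_ge0//.
have h := expR_ge1Dx (b / 2 * dot X X).
rewrite expRN ler_pdivrMr ?expR_gt0// -ler_pdivrMl ?divr_gt0// invf_div; lra.
Qed.


(** Both sides of an identity between families of Gaussians, depending on a real
    parameter, may be differentiated twice at the origin. *)
Lemma csum_second_derivative (T U : choiceType) (K : C) (F : T -> C) (G : U -> C)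
    (a : T -> C) (a' : U -> C) (b' : C) :
  summ (fun x => cabs (F x) * expR (4 * (cabs (a x) + cabs 0))) ->
  summ (fun y => cabs (G y) * expR (4 * (cabs (a' y) + cabs b'))) ->
  (forall t : R, K * csum (fun x => F x * cex (a x * t%:C)) =
     csum (fun y => G y * cex (a' y * t%:C + b' * t%:C ^+ 2))) ->
  [/\ csummable (fun x => F x * a x ^+ 2),
      csummable (fun y => G y * (a' y ^+ 2 + 2 * b')) &
      K * csum (fun x => F x * a x ^+ 2) =
      csum (fun y => G y * (a' y ^+ 2 + 2 * b'))].
Proof.
have aux (S : choiceType) (H : S -> C) (al : S -> C) (be : C) (e : R) :
    summ (fun x => cabs (H x) * expR (4 * (cabs (al x) + cabs be))) ->
    0 < e -> e <= 1 ->
    csum (fun x => H x * second_quotient (al x) be e) =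
    (csum (fun x => H x * cex (al x * e%:C + be * e%:C ^+ 2)) +
     csum (fun x => H x * cex (al x * (- e)%:C + be * (- e)%:C ^+ 2)) -
     2 * csum (fun x => H x * cex (al x * (0 : R)%:C + be * (0 : R)%:C ^+ 2))) / e%:C ^+ 2.
  move=> sH e0 e1.
  have sE (t : R) : `|t| <= 1 ->
      csummable (fun x => H x * cex (al x * t%:C + be * t%:C ^+ 2)).
    move=> t1; apply: csummable_le sH => x; rewrite cabsM.
    rewrite ler_wpM2l ?cabs_ge0// cabs_cex ler_expR.
    apply: (le_trans (ler_norm _)); apply: (le_trans (cabs_Re _)).
    apply: (le_trans (cabsD _ _)).
    rewrite (cabsM (al x)) (cabsM be) cabsX cabsR.
    have h1 : cabs (al x) * `|t| <= cabs (al x) by rewrite ler_piMr ?cabs_ge0.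
    have h2 : cabs be * `|t| ^+ 2 <= cabs be by rewrite ler_piMr ?cabs_ge0 ?exprn_ile1.
    have := cabs_ge0 (al x); have := cabs_ge0 be; lra.
  have ea : `|e| <= 1 by rewrite ger0_norm// ltW.
  have s1 := sE e ea; have s3 := sE 0.
  have := sE (- e); rewrite normrN => /(_ ea) s2.
  move: s3; rewrite normr0 => /(_ ler01) s3.
  have s12 := csummableD s1 s2; have s3' := csummableZ 2 s3.
  rewrite -csumZ// -csumD// -csumB// mulrC -csumZ; last exact: csummableB.
  apply: eq_csum => x; rewrite /second_quotient.
  rewrite rmorphN sqrrN mulrN rmorph0 expr0n !mulr0 addr0 cex0; ring.
move=> sF sG E.
have [s1 c1] := csum_second_quotient sF; have [s2 c2] := csum_second_quotient sG.
have EE n : K * csum (fun x => F x * second_quotient (a x) 0 n.+1%:R^-1) =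
    csum (fun y => G y * second_quotient (a' y) b' n.+1%:R^-1).
  rewrite !aux ?invr_gt0 ?ltr0n ?invf_le1 ?ler1n// mulrA; congr (_ / _).
  rewrite -!E mulrBr mulrDr [X in _ - X]mulrCA.
  by congr (K * _ + K * _ - 2 * (K * _)); apply: eq_csum => x; rewrite mul0r addr0.
have Fa x : F x * (a x ^+ 2 + 2 * 0) = F x * a x ^+ 2 by rewrite mulr0 addr0.
split; [exact: (eq_csummable Fa)|exact: s2|].
rewrite -(eq_csum Fa).
set p := csum _ in c1 *; set q := csum _ in c2 *.
apply/eqP; rewrite -subr_eq0; apply/eqP; apply: cabs_eq0.
have tri (w z : C) : K * w = z ->
    cabs (K * p - q) <= cabs K * cabs (w - p) + cabs (z - q).
  move=> <-; have -> : K * p - q = - (K * (w - p)) + (K * w - q) by ring.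
  by apply: (le_trans (cabsD _ _)); rewrite cabsN cabsM.
have c3 : (fun n => cabs K * cabs (csum (fun x => F x * second_quotient (a x) 0 n.+1%:R^-1) - p) +
   cabs (csum (fun y => G y * second_quotient (a' y) b' n.+1%:R^-1) - q)) @ \oo --> (0 : R).
  rewrite -[X in _ --> X](addr0 0) -[X in _ --> X + _](mulr0 (cabs K)).
  by apply: cvgD; [apply: cvgM; [exact: cvg_cst|exact: c1]|exact: c2].
apply/eqP; rewrite eq_le cabs_ge0 andbT.
apply: (ler_cvg_to (cvg_cst _) c3); near=> n.
exact: tri (EE n).
Unshelve. all: by end_near. Qed.

Lemma dualmx_unit : dualmx \in unitmx.
Proof. by rewrite /dualmx unitmx_tr unitmx_inv. Qed.

Lemma dot_dualmx (x y : 'rV[R]_m) : dot (x *m B) (y *m dualmx) = dot x y.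
Proof. by rewrite /dot /dualmx trmx_mul trmxK !mulmxA mulmxK. Qed.

Lemma dot_mulmx (x v : 'rV[R]_m) : dot x (v *m B^T) = dot (x *m B) v.
Proof. by rewrite /dot trmx_mul trmxK !mulmxA. Qed.

Lemma qf_dual (x : 'rV[R]_m) : qf (dualmx *m dualmx^T) x = dot (x *m dualmx) (x *m dualmx).
Proof. by rewrite /qf /dot trmx_mul !mulmxA. Qed.

Lemma mulmx_dual (v : 'rV[R]_m) : v *m B^T *m dualmx = v.
Proof. by rewrite /dualmx trmx_inv mulmxK// unitmx_tr. Qed.

End LatticeTheta.

Section WeightedInversion.
Context {R : realType}.
Local Notation C := R[i].

Lemma Re_gauss (t : C) (x : R) : Re (- (pi%:C * t * x%:C)) = - (pi * Re t * x).
Proof. by rewrite ReN ReZr ReZ. Qed.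

Lemma cabs_2piii (x : R) : cabs (2 * pi%:C * ii * x%:C) = 2 * pi * `|x|.
Proof.
rewrite cabsM (cabsM (2 * _)) (cabsM 2) cabs_natr !cabsR.
have -> : cabs ii = 1 :> R by rewrite /cabs /normc expr0n/= add0r expr1n sqrtr1.
by rewrite mulr1 (ger0_norm (pi_ge0 R)).
Qed.

Definition moment_lhs m (B : 'M[R]_m) (t : C) (u v : 'rV[R]_m) (x : 'rV[int]_m) : C :=
  cex (- (pi%:C * t * (dot ((zrow x + u) *m B) ((zrow x + u) *m B))%:C)) *
  (2 * pi%:C * ii * (dot ((zrow x + u) *m B) v)%:C) ^+ 2.

Definition moment_rhs m (B : 'M[R]_m) (t : C) (u v : 'rV[R]_m) (y : 'rV[int]_m) : C :=
  cex (- (pi%:C * t^-1 * (dot (zrow y *m dualmx B) (zrow y *m dualmx B))%:C)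
       + 2 * pi%:C * ii * (dot (zrow y) u)%:C) *
  ((2 * pi%:C * t^-1 * (dot (zrow y *m dualmx B) v)%:C) ^+ 2
   + 2 * (- (pi%:C * t^-1 * (dot v v)%:C))).

(** The second derivative at t = 0 of [qf_inversion] at the characteristic
    t *: v B^T; the weight on the dual side acquires a constant term. *)
Lemma moment_inversion m (B : 'M[R]_m) (s : C) (u v : 'rV[R]_m) :
  B \in unitmx -> cone s ->
  [/\ csummable (moment_lhs B (s ^+ 2) u v), csummable (moment_rhs B (s ^+ 2) u v) &
      s ^+ m * `|\det B|%:C * csum (moment_lhs B (s ^+ 2) u v) =
      csum (moment_rhs B (s ^+ 2) u v)].
Proof.
move=> uB cs; have s0 := cone_Re cs; have t0 := ReV_gt0 s0.
have pi0 := pi_gt0 R.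
apply: csum_second_derivative.
- have := @gauss_lin_summ _ _ B uB _ _ (u *m B) v (mulr_gt0 pi0 s0) (ltW (mulr_gt0 (ltr0n _ 8) pi0)).
  apply: summ_le => x; cbv zeta beta; rewrite mulmxDl cabs_cex Re_gauss cabs0 addr0 cabs_2piii.
  rewrite ger0_norm ?mulr_ge0 ?expR_ge0//; apply: eqr_lex.
  by congr (_ * expR _); ring.
- pose c := 8 * pi * cabs (s ^- 2).
  have c0 : 0 <= c by rewrite !mulr_ge0 ?cabs_ge0 ?pi_ge0.
  have := summZ (expR (4 * cabs (- (pi%:C * s ^- 2 * (dot v v)%:C))))
    (gauss_lin_summ (dualmx_unit uB) 0 v (mulr_gt0 pi0 t0) c0).
  apply: summ_le => y; cbv zeta beta; rewrite addr0 cabs_cex ReD Re_gauss Re_ii addr0.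
  rewrite ger0_norm ?mulr_ge0 ?expR_ge0// [leRHS]mulrCA -(expRD (4 * _)); apply: eqr_lex.
  congr (_ * expR _).
  rewrite addrC mulrDr; congr (_ + _).
  rewrite (cabsM (2 * _ * _)) (cabsM (2 * _)) (cabsM 2) cabs_natr !cabsR.
  by rewrite (ger0_norm (pi_ge0 R)) /c; ring.
- move=> t; have Ait : (dualmx B *m (dualmx B)^T)^T = dualmx B *m (dualmx B)^T.
    by rewrite trmx_mul trmxK.
  have := qf_inversion u ((t *: v) *m B^T) (gram_posdef uB) (gram_inv uB) Ait cs.
  rewrite det_mulmx det_tr -expr2 sqrtr_sqr.
  set l1 := csum _; set l2 := csum _ => h; transitivity (s ^+ m * `|\det B|%:C * l1).
    congr (_ * _); apply: eq_csum => x; rewrite /gterm qf_gram dot_mulmx dotZr cexD.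
    by congr (_ * cex _); rewrite (rmorphM (real_complex R) t)/=; ring.
  rewrite h; apply: eq_csum => y; rewrite /gterm qf_dual mulmxBl mulmx_dual// -!cexD.
  congr cex; set Y := zrow y *m _.
  rewrite !(dotDl, dotDr, dotNl, dotNr, dotZl, dotZr) (dotC v Y).
  rewrite !(rmorphD, rmorphN, rmorphM)/=; ring.
Qed.

(** The harmonic weight; it is the square of a linear form that is isotropic
    for the complexified inner product. *)
Definition hweight m (i j : 'I_m) (X : 'rV[R]_m) : C := (Complex (X 0 i) (X 0 j)) ^+ 2.

Lemma cabs_hweight m (i j : 'I_m) X : i != j -> cabs (hweight i j X) <= dot X X.
Proof.
move=> ij; rewrite /hweight cabsX.
have -> : cabs (Complex (X 0 i) (X 0 j)) ^+ 2 = X 0 i ^+ 2 + X 0 j ^+ 2.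
  by rewrite /cabs /normc sqr_sqrtr// addr_ge0 ?sqr_ge0.
rewrite dotE (bigD1 i)//= (bigD1 j)/=; last by rewrite eq_sym.
by rewrite addrA -!expr2 lerDl sumr_ge0// => k _; rewrite -expr2 sqr_ge0.
Qed.

(** A linear combination of squares of linear forms, as [moment_inversion]
    requires. *)
Lemma hweight_moments m (i j : 'I_m) X : let e (k : 'I_m) : 'rV[R]_m := delta_mx 0 k in
  hweight i j X = (1 - ii) * (dot X (e i))%:C ^+ 2 + (- 1 - ii) * (dot X (e j))%:C ^+ 2
   + ii * (dot X (e i + e j))%:C ^+ 2.
Proof.
move=> e; have de k : dot X (e k) = X 0 k.
  rewrite dotE (bigD1 k)//= mxE !eqxx mulr1 big1 ?addr0// => l lk.
  by rewrite mxE eqxx (negPf lk) mulr0.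
rewrite dotDr !de /hweight !expr2; simpc; congr (Complex _ _); ring.
Qed.

Lemma hweight_summable m (B : 'M[R]_m) (i j : 'I_m) (w : 'rV[R]_m) (t : C) (f : 'rV[int]_m -> C) :
  i != j -> B \in unitmx -> 0 < Re t ->
  (forall x, cabs (f x) <= 1) ->
  csummable (fun x : 'rV[int]_m => let X := zrow x *m B + w in
    hweight i j X * cex (- (pi%:C * t * (dot X X)%:C)) * f x).
Proof.
move=> ij uB t0 f1; have := gauss_sq_summ uB w (mulr_gt0 (pi_gt0 R) t0).
apply: csummable_le => x /=; rewrite 2!cabsM cabs_cex Re_gauss -[leRHS]mulr1.
apply: ler_pM; rewrite ?mulr_ge0 ?cabs_ge0 ?expR_ge0//.
by rewrite ler_wpM2r ?expR_ge0 ?cabs_hweight.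
Qed.


(** One of the two square roots has a positive real part. *)
Lemma cone_sqrt (z : C) : 0 < Re z -> exists s, cone s /\ s ^+ 2 = z.
Proof.
move=> z0; have E : sqrtc z ^+ 2 = z by exact: sqr_sqrtc.
have : cone (sqrtc z) \/ cone (- sqrtc z).
  move: z0; rewrite -[in X in X -> _]E /cone; case: (sqrtc z) => a b.
  rewrite expr2; simpc => /= h.
  have h2 : `|b| < `|a| by rewrite -ltr_sqr ?nnegrE// !real_normK ?num_real// !expr2 -subr_gt0.
  rewrite normrN; case: (lerP 0 a) => a0; [left|right].
    by rewrite -(ger0_norm a0).
  by rewrite -(ltr0_norm a0).
by case=> c; [exists (sqrtc z)|exists (- sqrtc z); rewrite sqrrN].
Qed.

(** Combine the moments along e_i, e_j and e_i + e_j.  The constant terms of the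
    dual side cancel, which is the harmonicity of the weight. *)
Lemma hweight_inversion k (B : 'M[R]_(k.*2)) (i j : 'I_(k.*2)) (u : 'rV[R]_(k.*2)) (t : C) :
  i != j -> B \in unitmx -> 0 < Re t ->
  t ^+ (k + 2) * `|\det B|%:C *
  csum (fun x : 'rV[int]_(k.*2) => let X := (zrow x + u) *m B in
    hweight i j X * cex (- (pi%:C * t * (dot X X)%:C))) =
  - csum (fun y : 'rV[int]_(k.*2) => let Y := zrow y *m dualmx B in
    hweight i j Y * cex (- (pi%:C * t^-1 * (dot Y Y)%:C)
      + 2 * pi%:C * ii * (dot (zrow y) u)%:C)).
Proof.
move=> ij uB t0; have [s [cs E]] := cone_sqrt t0.
have tn0 : t != 0 by apply: contraTneq t0 => ->; rewrite ltxx.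
pose e (l : 'I_k.*2) : 'rV[R]_k.*2 := delta_mx 0 l.
have MI v := moment_inversion u v uB cs; rewrite E in MI.
have [l1 r1 E1] := MI (e i); have [l2 r2 E2] := MI (e j).
have [l3 r3 E3] := MI (e i + e j).
have pin0 : pi%:C != 0 :> C by rewrite fmorph_eq0 gt_eqF ?pi_gt0.
pose P : C := 4 * pi%:C ^+ 2.
have P0 : P != 0 by rewrite mulf_neq0 ?expf_neq0 ?pnatr_eq0.
set lhs := csum _; set rhs := csum _.
have EL : lhs = - P^-1 * ((1 - ii) * csum (moment_lhs B t u (e i)) +
     (- 1 - ii) * csum (moment_lhs B t u (e j)) + ii * csum (moment_lhs B t u (e i + e j))).
  rewrite -!csumZ//; have l1' := csummableZ (1 - ii) l1.
  have l2' := csummableZ (- 1 - ii) l2; have l3' := csummableZ ii l3.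
  have l12 := csummableD l1' l2'.
  rewrite -csumD// -csumD// -csumZ; last exact: csummableD.
  apply: eq_csum => x; cbv zeta; rewrite hweight_moments -/(e i) -/(e j) /moment_lhs.
  set X := _ *m B; set G := cex _.
  have i2 : ii ^+ 2 = -1 :> C by rewrite expr2; simpc.
  rewrite !exprMn i2 /P.
  clear P0; clearbody G; move: pin0; move: (pi%:C : C) => q q0.
  by field.
have ER : rhs = P^-1 * t ^+ 2 * ((1 - ii) * csum (moment_rhs B t u (e i)) +
     (- 1 - ii) * csum (moment_rhs B t u (e j)) + ii * csum (moment_rhs B t u (e i + e j))).
  rewrite -!csumZ//; have l1' := csummableZ (1 - ii) r1.
  have l2' := csummableZ (- 1 - ii) r2; have l3' := csummableZ ii r3.
  have l12 := csummableD l1' l2'.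
  rewrite -csumD// -csumD// -csumZ; last exact: csummableD.
  apply: eq_csum => x; cbv zeta; rewrite hweight_moments -/(e i) -/(e j) /moment_rhs.
  have dd p q : dot (e p) (e q) = (p == q)%:R.
    rewrite dotE (bigD1 p)//= !mxE !eqxx mul1r big1 ?addr0// => l lk.
    by rewrite mxE eqxx (negPf lk) mul0r.
  have -> : dot (e i + e j) (e i + e j) = 1 + 1.
    rewrite dotDl !dotDr !dd !eqxx (eq_sym j) (negPf ij).
    by rewrite addr0 add0r.
  rewrite !dd !eqxx.
  set X := _ *m _; set G := cex _.
  have -> : (1 + 1 : R)%:C = 2 by rewrite rmorphD rmorph1.
  rewrite rmorph1 /P.
  clear P0; clearbody G; move: pin0; move: (pi%:C : C) => q q0.
  (* (1 - i) + (- 1 - i) + 2 i = 0: the constant terms disappear *)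
  by field; rewrite ?tn0 ?q0.
rewrite EL ER -E1 -E2 -E3 (exprD t).
have -> : s ^+ (k.*2) = t ^+ k by rewrite -mul2n exprM E.
move: (P^-1) => q; ring.
Qed.

End WeightedInversion.

(** * Theta series at rational points *)

Section ResidueClasses.
Context {R : realType}.
Local Notation C := R[i].
Variables (m : nat) (B : 'M[R]_m).
Hypothesis evenB : forall x : 'rV[int]_m, exists z : int,
  dot (zrow x *m B) (zrow x *m B) = 2 * z%:~R.

Lemma zrowD (x y : 'rV[int]_m) : zrow (x + y) = zrow x + zrow y :> 'rV[R]_m.
Proof. by apply/rowP => a; rewrite !mxE intrD. Qed.

Lemma zrowN (x : 'rV[int]_m) : zrow (- x) = - zrow x :> 'rV[R]_m.
Proof. by apply/rowP => a; rewrite !mxE intrN. Qed.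

Lemma zrowMn (x : 'rV[int]_m) n : zrow (x *+ n) = n%:R *: zrow x :> 'rV[R]_m.
Proof. by elim: n => [|n IH]; [apply/rowP => a; rewrite !mxE mul0r|rewrite mulrSr zrowD IH -natr1 scalerDl scale1r]. Qed.

Lemma zrowMz (x : 'rV[int]_m) (q : int) : zrow (x *~ q) = q%:~R *: zrow x :> 'rV[R]_m.
Proof.
case: q => q; first by rewrite -pmulrn zrowMn.
by rewrite NegzE !mulrNz zrowN zrowMn scaleNr.
Qed.

Lemma zrow0 : zrow (0 : 'rV[int]_m) = 0 :> 'rV[R]_m.
Proof. by apply/rowP => e; rewrite !mxE. Qed.

(** Exact for an even lattice: the floor only turns the value into an integer. *)
Definition halfnorm (x : 'rV[int]_m) : int :=
  Num.floor (dot (zrow x *m B) (zrow x *m B) / 2).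

Lemma halfnormE x : dot (zrow x *m B) (zrow x *m B) = 2 * (halfnorm x)%:~R.
Proof.
have [z e] := evenB x; rewrite /halfnorm e mulrAC divff ?pnatr_eq0// mul1r.
by rewrite intrKfloor.
Qed.

Lemma halfnorm_ge0 x : 0 <= halfnorm x.
Proof. by have := dot_ge0 (zrow x *m B); rewrite halfnormE pmulr_rge0// ler0z. Qed.

(** The inner product of lattice vectors, obtained by polarisation. *)
Definition zdot (x y : 'rV[int]_m) : int := halfnorm (x + y) - halfnorm x - halfnorm y.

Lemma zdotE x y : dot (zrow x *m B) (zrow y *m B) = (zdot x y)%:~R.
Proof.
have := halfnormE (x + y); rewrite zrowD mulmxDl dotDl !dotDr !halfnormE (dotC (zrow y *m B)).
by rewrite /zdot !intrB; lra.
Qed.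

Lemma halfnorm_affine (x h : 'rV[int]_m) n :
  halfnorm (x *+ n + h) = halfnorm h + n%:Z * zdot x h + n%:Z * n%:Z * halfnorm x.
Proof.
apply: (@intr_inj R); rewrite !intrD !intrM.
apply: (@mulfI _ (2 : R)); first by rewrite pnatr_eq0.
rewrite -halfnormE zrowD zrowMn mulmxDl -scalemxAl dotDl !dotDr !dotZl !dotZr !halfnormE.
by rewrite (dotC (zrow h *m B)) !zdotE; ring.
Qed.

Definition residue (n : nat) (h : 'rV['I_n.+1]_m) : 'rV[int]_m :=
  \row_a (nat_of_ord (h 0 a))%:Z.

Lemma residue_bij n :
  bijective (fun z : 'rV[int]_m * 'rV['I_n.+1]_m => z.1 *+ n.+1 + residue z.2).
Proof.
have [g gK Kg] := edivz_bij n.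
exists (fun x : 'rV[int]_m => (\row_a (g (x 0 a)).1, \row_a (g (x 0 a)).2)).
  move=> [x h]; congr (_, _); apply/rowP => a; rewrite !mxE mulmxnE.
    by have := gK (x 0 a, h 0 a); rewrite /= -mulr_natr natz => ->.
  by have := gK (x 0 a, h 0 a); rewrite /= -mulr_natr natz => ->.
by move=> x; apply/rowP => a; rewrite !mxE mulmxnE mxE -[RHS]Kg -mulr_natr natz.
Qed.

Lemma ce_add_int (x : R) (z : int) : ce (x + z%:~R) = ce x.
Proof. by rewrite ceD ce_int mulr1. Qed.

Lemma ce_halfnorm_periodic (al : int) n (x h : 'rV[int]_m) :
  ce (al%:~R * (halfnorm (x *+ n.+1 + h))%:~R / n.+1%:R) =
  ce (al%:~R * (halfnorm h)%:~R / n.+1%:R) :> C.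
Proof.
rewrite halfnorm_affine -[RHS](ce_add_int _ (al * zdot x h + al * n.+1%:Z * halfnorm x)).
congr ce; rewrite !(intrD, intrM) -!pmulrn; field.
by rewrite nat1r pnatr_eq0.
Qed.

(** Shifting the argument permutes the residue classes. *)
Lemma sum_residue_shift n (F : 'rV[int]_m -> C) (w : 'rV[int]_m) :
  (forall x h, F (x *+ n.+1 + h) = F h) ->
  \sum_h F (residue (n := n) h - w) = \sum_h F (residue (n := n) h).
Proof.
move=> perF; have [g gK Kg] := residue_bij n.
have Fg x : F x = F (residue (g x).2) by rewrite -{1}(Kg x) perF.
pose s (h : 'rV['I_n.+1]_m) := (g (residue h - w)).2.
under eq_bigr do rewrite Fg -/(s _).
rewrite [RHS](reindex s)//=; apply: onW_bij; apply: injF_bij => h h' e.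
have : residue h + (g (residue h' - w)).1 *+ n.+1 = residue h' + (g (residue h - w)).1 *+ n.+1.
  have e1 := Kg (residue h - w); have e2 := Kg (residue h' - w).
  rewrite /s in e; rewrite /= e in e1; rewrite /= in e2.
  move: (residue (g (residue h' - w)).2) e1 e2 => r.
  move: (g (residue h - w)).1 (g (residue h' - w)).1 => p q.
  move: (residue h) (residue h') => a a' e1 e2.
  by rewrite -[a](subrK w) -e1 -[a'](subrK w) -e2; apply/rowP => l; rewrite !mxE; ring.
rewrite !(addrC (residue _)) => e'.
by have := @bij_inj _ _ _ (residue_bij n) (_, h) (_, h') e' => -[].
Qed.

End ResidueClasses.

Section ThetaRational.
Context {R : realType}.
Local Notation C := R[i].

(** In the variable - i tau, of positive real part, of the inversion
    formulas. *)
Definition theta m (B : 'M[R]_m) (i j : 'I_m) (tau : C) : C :=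
  csum (fun x : 'rV[int]_m => hweight i j (zrow x *m B) *
    cex (- (pi%:C * (- ii * tau) * (dot (zrow x *m B) (zrow x *m B))%:C))).

Definition gauss_sum m (B : 'M[R]_m) (al : int) n (y : 'rV[int]_m) : C :=
  \sum_(h : 'rV['I_n.+1]_m) ce (al%:~R * (halfnorm B (residue h))%:~R / n.+1%:R) *
     ce (n.+1%:R^-1 * dot (zrow y) (zrow (residue h))).

Lemma hweightZ m (i j : 'I_m) (a : R) X : hweight i j (a *: X) = a%:C ^+ 2 * hweight i j X.
Proof.
rewrite /hweight !mxE -exprMn; congr (_ ^+ 2); simpc; by [].
Qed.

Lemma Re_mii (t : C) : Re (- ii * t) = Im t.
Proof. by case: t => a b; simpc. Qed.

Variables (k : nat) (B : 'M[R]_(k.*2)) (i j : 'I_(k.*2)).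
Hypothesis (ij : i != j) (uB : B \in unitmx).
Hypothesis evenB : forall x : 'rV[int]_(k.*2), exists z : int,
  dot (zrow x *m B) (zrow x *m B) = 2 * z%:~R.

Lemma theta_summable (tau : C) : upper tau ->
  csummable (fun x : 'rV[int]_(k.*2) => hweight i j (zrow x *m B) *
    cex (- (pi%:C * (- ii * tau) * (dot (zrow x *m B) (zrow x *m B))%:C))).
Proof.
move=> ut; have t0 : 0 < Re (- ii * tau) by rewrite Re_mii.
have := hweight_summable 0 ij uB t0 (f := fun=> 1) (fun _ => _).
move=> h; apply: (eq_csummable _ (h _)); last by rewrite cabs1.
by move=> x; cbv zeta; rewrite addr0 mulr1.
Qed.

(** Behaviour of theta near the rational number al / D: the summation is split
    into residue classes modulo D, and each class is inverted. *)
Lemma theta_rational (al : int) n (sg : C) : upper sg ->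
  let t := - ii * sg * n.+1%:R ^+ 2 in
  theta B i j (al%:~R / n.+1%:R + sg) =
  - n.+1%:R ^+ 2 * (t ^+ (k + 2) * `|\det B|%:C)^-1 *
  csum (fun y : 'rV[int]_(k.*2) => let Y := zrow y *m dualmx B in
    hweight i j Y * cex (- (pi%:C * t^-1 * (dot Y Y)%:C)) * gauss_sum B al n y).
Proof.
move=> us t; set D : R := n.+1%:R; have D0 : D != 0 by rewrite pnatr_eq0.
have DC : D%:C = n.+1%:R :> C by rewrite rmorph_nat.
have t0 : 0 < Re t.
  have -> : t = (D ^+ 2)%:C * (- ii * sg) by rewrite /t mulrC rmorphXn/= DC.
  by rewrite ReZ Re_mii mulr_gt0// exprn_gt0// ltr0n.
pose u (h : 'rV['I_n.+1]_k.*2) : 'rV[R]_k.*2 := D^-1 *: zrow (residue h).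
pose g (h : 'rV['I_n.+1]_k.*2) : C := ce (al%:~R * (halfnorm B (residue h))%:~R / D).
pose G (z : 'rV[int]_k.*2 * 'rV['I_n.+1]_k.*2) : C :=
  g z.2 * D%:C ^+ 2 * (let X := (zrow z.1 + u z.2) *m B in
    hweight i j X * cex (- (pi%:C * t * (dot X X)%:C))).
have uts : upper (al%:~R / n.+1%:R + sg).
  have -> : al%:~R / n.+1%:R = (al%:~R / D)%:C :> C.
    by rewrite fmorph_div/= rmorph_int DC.
  by move: us; rewrite /upper; case: (sg) => a b /=; rewrite add0r.
have FG z : hweight i j (zrow (z.1 *+ n.+1 + residue z.2) *m B) *
    cex (- (pi%:C * (- ii * (al%:~R / n.+1%:R + sg)) *
      (dot (zrow (z.1 *+ n.+1 + residue z.2) *m B) (zrow (z.1 *+ n.+1 + residue z.2) *m B))%:C))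
    = G z.
  case: z => x h; rewrite /G /=; set X := zrow _ *m B.
  have e1 : cex (- (pi%:C * (- ii * (al%:~R / n.+1%:R + sg)) * (dot X X)%:C)) =
      cex (- (pi%:C * (- ii * sg) * (dot X X)%:C)) * g h.
    rewrite /g -(ce_halfnorm_periodic evenB _ n x) /ce -cexD; congr cex.
    rewrite /X (halfnormE evenB); move: (halfnorm B _) => q.
    have -> : (2 * q%:~R : R)%:C = 2 * q%:~R :> C by rewrite rmorphM/= rmorph_int rmorph_nat.
    have -> : (al%:~R * q%:~R / n.+1%:R : R)%:C = al%:~R * q%:~R / n.+1%:R :> C.
      by rewrite fmorph_div/= rmorphM/= !rmorph_int rmorph_nat.
    move: (n.+1%:R^-1) => dd; ring.
  rewrite e1; have -> : X = D *: ((zrow x + u h) *m B).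
    by rewrite /X zrowD zrowMn -/D /u scalemxAl scalerDr scalerA divff// scale1r.
  set V := _ *m B; rewrite hweightZ dotZl dotZr /t -DC.
  have -> : (D * (D * dot V V))%:C = D%:C ^+ 2 * (dot V V)%:C :> C.
    by rewrite !rmorphM/= expr2 mulrA.
  rewrite (_ : pi%:C * (- ii * sg * D%:C ^+ 2) * (dot V V)%:C =
     pi%:C * (- ii * sg) * (D%:C ^+ 2 * (dot V V)%:C)); last by ring.
  by move: (cex _) => E; ring.
have sF := theta_summable uts.
rewrite /theta -(csum_bij _ (residue_bij k.*2 n)).
have sG : csummable G.
  by apply: (eq_csummable FG); have := (csummable_bij _ (residue_bij k.*2 n)).2 sF.
rewrite (eq_csum (g := G)); last exact: FG.
rewrite csum_pair// csum_swap// (csum_fin _).2.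
pose K : C := (t ^+ (k + 2) * `|\det B|%:C)^-1.
have K0 : t ^+ (k + 2) * `|\det B|%:C != 0.
  rewrite mulf_neq0 ?expf_neq0//; first by apply: contraTneq t0 => ->; rewrite ltxx.
  by rewrite fmorph_eq0 normr_eq0 -unitfE -unitmxE.
pose a (y : 'rV[int]_k.*2) : C := let Y := zrow y *m dualmx B in
  hweight i j Y * cex (- (pi%:C * t^-1 * (dot Y Y)%:C)).
have tV := ReV_gt0 t0.
have sa (h : 'rV['I_n.+1]_k.*2) : csummable (fun y => a y * ce (D^-1 * dot (zrow y) (zrow (residue h)))).
  have := hweight_summable 0 ij (dualmx_unit uB) tV
    (f := fun y => ce (D^-1 * dot (zrow y) (zrow (residue h)))) (fun _ => _).
  move=> s; apply: (eq_csummable _ (s _)); last by move=> y; rewrite cabs_ce.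
  by move=> y; cbv zeta; rewrite addr0.
have inner h : csum (fun x => G (x, h)) = - D%:C ^+ 2 * K *
    csum (fun y => a y * (g h * ce (D^-1 * dot (zrow y) (zrow (residue h))))).
  have sx : csummable (fun x : 'rV[int]_k.*2 => let X := (zrow x + u h) *m B in
      hweight i j X * cex (- (pi%:C * t * (dot X X)%:C))).
    have := hweight_summable (u h *m B) ij uB t0 (f := fun=> 1) (fun _ => _).
    move=> s; apply: (eq_csummable _ (s _)); last by rewrite cabs1.
    by move=> y; cbv zeta; rewrite mulr1 mulmxDl.
  have := hweight_inversion (u h) ij uB t0; rewrite /G /= csumZ//.
  have {}sa := sa h.
  set l := csum _ => E; rewrite -[l](mulKf K0) E -/K.
  have -> : csum (fun y => a y * (g h * ce (D^-1 * dot (zrow y) (zrow (residue h)))))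
     = g h * csum (fun y => a y * ce (D^-1 * dot (zrow y) (zrow (residue h)))).
    by rewrite -csumZ//; apply: eq_csum => y; ring.
  set r := csum _; set r' := csum _; have -> : r = r'.
    apply: eq_csum => y; cbv zeta; rewrite cexD -/(ce _) dotZr /a; by rewrite mulrA.
  ring.
under eq_bigr do rewrite inner.
rewrite -mulr_sumr -DC; congr (_ * _).
rewrite -(csum_sum _ _).2.
  by apply: eq_csum => y; cbv zeta; rewrite -mulr_sumr.
by move=> h; apply: (eq_csummable _ (csummableZ (g h) (sa h))) => y; rewrite mulrCA.
Qed.

End ThetaRational.

(** * Transformation under the modular group *)

Lemma int_sgn (d : int) : d != 0 ->
  exists s : int, exists n : nat, d = s * n.+1%:Z /\ s * s = 1.
Proof.
case: d => [[|n]//|n] _; first by exists 1, n; rewrite !mul1r.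
by exists (-1), n; rewrite NegzE mulN1r mulrNN mulr1.
Qed.

Section Moebius.
Context {R : realType}.
Local Notation C := R[i].

Lemma moebius_denom_neq0 (c d : int) (tau : C) : upper tau -> (c != 0) || (d != 0) ->
  c%:~R * tau + d%:~R != 0.
Proof.
rewrite /upper; case: tau => x y /= y0 cd; apply/eqP.
rewrite -!(rmorph_int (real_complex R)); simpc => -[e1 e2].
have c0 : c%:~R = 0 :> R by apply/eqP; move/eqP: e2; rewrite mulf_eq0 (gt_eqF y0) orbF.
move: e1 cd; rewrite c0 mul0r add0r => /eqP; rewrite intr_eq0 => ->; rewrite orbF.
by move/eqP: c0; rewrite intr_eq0 => ->.
Qed.

Lemma moebius_upper (a b c d : int) (tau : C) : upper tau -> a * d - b * c = 1 ->
  upper ((a%:~R * tau + b%:~R) / (c%:~R * tau + d%:~R)).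
Proof.
move=> ut dt; have cd : (c != 0) || (d != 0).
  by apply/negP => /negP; rewrite negb_or !negbK => /andP[/eqP c0 /eqP d0]; move: dt; rewrite c0 d0 !mulr0 subrr.
have := moebius_denom_neq0 ut cd; move: ut; rewrite /upper; case: tau => x y /= y0.
have dR : a%:~R * d%:~R - b%:~R * c%:~R = 1 :> R by rewrite -!intrM -intrB dt.
rewrite -!(rmorph_int (real_complex R)) !(mulrC _%:C).
clear cd dt; move: (a%:~R) (b%:~R) (c%:~R) (d%:~R) dR => {}a {}b {}c {}d dR.
simpc => /=; rewrite eq_complex /= negb_and => h.
have N0 : 0 < (x * c + d) ^+ 2 + (y * c) ^+ 2.
  by case/orP: h => h; [apply: ltr_wpDr|apply: ltr_wpDl]; rewrite ?sqr_ge0// exprn_even_gt0.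
set N := _ + _ in N0 *; clearbody N; rewrite (_ : _ + _ = y * (a * d - b * c) / N).
  by rewrite dR mulr1 divr_gt0.
by field; rewrite gt_eqF.
Qed.

End Moebius.

Section QExpansions.
Context {R : realType}.
Local Notation C := R[i].

Lemma qroot_cex h (tau : C) j : qroot h tau ^+ j =
  cex (2 * pi%:C * ii * (j%:R / h%:R) * tau).
Proof.
rewrite /qroot cexE -cexMn; congr cex.
rewrite (_ : Complex 0 (2 * pi / h%:R) = 2 * pi%:C * ii * h%:R^-1).
  move: (h%:R^-1) => hh; ring.
have -> : h%:R^-1 = (h%:R^-1 : R)%:C :> C by rewrite fmorphV rmorph_nat.
have -> : (2 : C) = (2 : R)%:C by rewrite rmorph_nat.
by simpc.
Qed.

(** Grouping the terms of a series of exponentials by their exponents. *)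
Lemma fiber_q_expansion (T : choiceType) (A : T -> C) (v : T -> nat) l (f : C -> C) :
  (forall tau, upper tau -> csummable (fun x => A x * qroot l tau ^+ v x) /\
     f tau = csum (fun x => A x * qroot l tau ^+ v x)) ->
  q_expansion l f (fun j => csum (fun x => if v x == j then A x else 0)).
Proof.
move=> H tau ut; have [sF ->] := H tau ut.
have [su ->] := csum_fiber v sF.
set u := fun j => csum _ in su *.
rewrite (_ : (fun j => _) = u); first exact: csum_has_sum.
apply/funext => j; rewrite /u.
have q0 : qroot l tau ^+ j != 0 by rewrite qroot_cex cex_neq0.
have s1 : csummable (fun x => if v x == j then A x * qroot l tau ^+ v x else 0).
  by apply: csummable_le sF => x; case: ifP; rewrite ?cabs0 ?cabs_ge0.
rewrite mulrC -csumZ.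
  by apply: eq_csum => x; case: eqP => [->|_]; rewrite ?mulr0// mulrC.
apply: (eq_csummable _ (csummableZ (qroot l tau ^+ j)^-1 s1)) => x.
by case: eqP => [->|_]; rewrite ?mulr0// mulrCA mulVf// mulr1.
Qed.

End QExpansions.

Section ThetaGamma0.
Context {R : realType}.
Local Notation C := R[i].
Variables (k : nat) (B : 'M[R]_(k.*2)) (i j : 'I_(k.*2)).
Hypothesis (ij : i != j) (uB : B \in unitmx).
Hypothesis evenB : forall x : 'rV[int]_(k.*2), exists z : int,
  dot (zrow x *m B) (zrow x *m B) = 2 * z%:~R.
Variable l : nat.
Hypothesis lev1 : forall y : 'rV[int]_(k.*2), exists z : int,
  l%:R * dot (zrow y *m dualmx B) (zrow y *m dualmx B) = 2 * z%:~R.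
Hypothesis lev2 : forall y : 'rV[int]_(k.*2), exists w : 'rV[int]_(k.*2),
  l%:R *: (zrow y *m dualmx B) = zrow w *m B.

(** Completing the square: up to a Gaussian factor, the twisted Gauss sum does
    not depend on y. *)
Lemma gauss_sum_twist (a b c d s : int) n (y : 'rV[int]_(k.*2)) :
  a * d - b * c = 1 -> (c = 0 %[mod l])%Z -> d = s * n.+1%:Z -> s * s = 1 ->
  ce (- (c%:~R / d%:~R * (dot (zrow y *m dualmx B) (zrow y *m dualmx B) / 2))) *
    gauss_sum B (s * b) n y = gauss_sum B (s * b) n 0.
Proof.
move=> dt cl dE ss; set Y := _ *m _.
have [q qE] : exists q, c = q * l%:Z by apply/dvdzP/dvdz_mod0P; rewrite cl mod0z.
have [z0 z0E] := lev1 y; have [w0 w0E] := lev2 y; rewrite -/Y in z0E w0E.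
have wE : c%:~R *: Y = zrow (w0 *~ q) *m B.
  rewrite zrowMz.
  by rewrite -scalemxAl -w0E scalerA qE intrM.
set w := w0 *~ q in wE.
pose F (x : 'rV[int]_k.*2) : C := ce ((s * b)%:~R * (halfnorm B x)%:~R / n.+1%:R).
have perF x h : F (x *+ n.+1 + h) = F h by exact: ce_halfnorm_periodic.
have sR : s%:~R * s%:~R = 1 :> R by rewrite -intrM ss.
have s0 : s%:~R != 0 :> R by apply: contra_eq_neq sR => ->; rewrite mul0r eq_sym oner_neq0.
have sC : s%:~R = 1 :> R \/ s%:~R = -1 :> R.
  have : (s%:~R : R) ^+ 2 == 1 by rewrite expr2 sR.
  by rewrite sqrf_eq1 => /orP[/eqP ->|/eqP ->]; [left|right].
have n0 : n.+1%:R != 0 :> R by rewrite pnatr_eq0.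
have dR : d%:~R = s%:~R * n.+1%:R :> R by rewrite dE intrM.
have d0 : d%:~R != 0 :> R by rewrite dR mulf_neq0.
have nE : n.+1%:R^-1 = s%:~R / d%:~R :> R by rewrite dR invfM mulrA divff// mul1r.
have dtR : a%:~R * d%:~R = 1 + b%:~R * c%:~R :> R.
  have e : a * d = 1 + b * c by rewrite -dt; ring.
  by rewrite -!intrM e intrD.
transitivity (\sum_h F (residue (n := n) h - w *~ s)); last first.
  by rewrite (sum_residue_shift _ perF); apply: eq_bigr => h _; rewrite /F zrow0 dot0l mulr0 ce0 mulr1.
rewrite /gauss_sum mulr_sumr; apply: eq_bigr => h _; rewrite /F -!ceD.
pose p : int := \sum_e (residue h) 0 e * y 0 e.
have pE : dot (zrow y) (zrow (residue h)) = p%:~R :> R.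
  by rewrite dotC dotE rmorph_sum; apply: eq_bigr => e _; rewrite rmorphM/= !mxE.
have qE2 : (halfnorm B (residue h - w *~ s))%:~R = (halfnorm B (residue h))%:~R -
    s%:~R * c%:~R * p%:~R + c%:~R ^+ 2 * dot Y Y / 2 :> R.
  have := halfnormE evenB (residue h - w *~ s); have := halfnormE evenB (residue h).
  rewrite zrowD zrowN zrowMz mulmxBl -scalemxAl -wE.
  rewrite !(dotDl, dotDr, dotNl, dotNr, dotZl, dotZr).
  rewrite (dotC Y) dot_dualmx// (dotC (zrow (residue h))) pE => -> e.
  apply: (@mulfI _ (2 : R)); first by rewrite pnatr_eq0.
  by rewrite -e; case: sC => ->; field.
rewrite qE2 pE -[RHS](ce_add_int _ (s * a * p - a * q * z0)); congr ce.
have aE : a%:~R = (1 + b%:~R * c%:~R) / d%:~R :> R by rewrite -dtR mulfK.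
have cE : c%:~R * dot Y Y = 2 * q%:~R * z0%:~R by rewrite qE intrM -mulrA z0E; ring.
rewrite !(intrB, intrM) nE aE.
have -> : c%:~R ^+ 2 * dot Y Y = 2 * q%:~R * z0%:~R * c%:~R by rewrite -cE expr2; ring.
have -> : c%:~R / d%:~R * (dot Y Y / 2) = q%:~R * z0%:~R / d%:~R.
  transitivity ((c%:~R * dot Y Y) / (2 * d%:~R)); first by field.
  by rewrite cE; field.
case: sC => ->.
- by field.
- by field.
Qed.

Lemma upperD_real (x : R) (z : C) : upper (x%:C + z) -> upper z.
Proof. by rewrite /upper; case: z => u v /=; rewrite add0r. Qed.

Lemma intrC (z : int) : (z%:~R : R)%:C = z%:~R :> C. Proof. exact: rmorph_int. Qed.

Lemma detB_neq0 : `|\det B|%:C != 0 :> C.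
Proof. by rewrite fmorph_eq0 normr_eq0 -unitfE -unitmxE. Qed.

(** On Gamma_0(l) theta transforms with a Gauss sum as a multiplier: the inner
    sums over residue classes no longer depend on the dual vector, so that a
    second inversion brings theta back. *)
Lemma theta_Gamma0 (a b c d s : int) n (tau : C) : upper tau ->
  a * d - b * c = 1 -> (c = 0 %[mod l])%Z -> d = s * n.+1%:Z -> s * s = 1 ->
  theta B i j ((a%:~R * tau + b%:~R) / (c%:~R * tau + d%:~R)) =
  (c%:~R * tau + d%:~R) ^+ (k + 2) * (d%:~R ^+ k)^-1 * gauss_sum B (s * b) n 0 *
  theta B i j tau.
Proof.
move=> ut dt cl dE ss.
have s0 : s != 0 by apply: contra_eq_neq ss => ->; rewrite mul0r eq_sym oner_neq0.
have d0 : d != 0 by rewrite dE mulf_neq0.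
have w0 := @moebius_denom_neq0 R c d tau ut _.
have {w0} : c%:~R * tau + d%:~R != 0 by apply: w0; rewrite d0 orbT.
have up := moebius_upper ut dt.
set w := c%:~R * tau + d%:~R in up * => w0.
have dC0 : d%:~R != 0 :> C by rewrite intr_eq0.
have sC0 : s%:~R != 0 :> C by rewrite intr_eq0.
have sC : s%:~R * s%:~R = 1 :> C by rewrite -intrM ss.
have dC : d%:~R = s%:~R * n.+1%:R :> C by rewrite dE intrM.
have nE : n.+1%:R^-1 = s%:~R / d%:~R :> C by rewrite dC invfM mulrA divff// mul1r.
have aE : a%:~R = (1 + b%:~R * c%:~R) / d%:~R :> C.
  have e : a * d = 1 + b * c by rewrite -dt; ring.
  by rewrite -intrM -[1]/(1%:~R) -intrD -e intrM mulfK.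
pose sg := tau / (d%:~R * w).
have E : (a%:~R * tau + b%:~R) / w = (s * b)%:~R / n.+1%:R + sg.
  rewrite intrM nE (_ : s%:~R * b%:~R * _ = s%:~R * s%:~R * b%:~R / d%:~R); last by ring.
  by rewrite sC aE /sg /w; field; rewrite -/w w0 dC0.
have us : upper sg.
  apply: (@upperD_real ((s * b)%:~R / n.+1%:R)).
  by rewrite fmorph_div/= intrC rmorph_nat -E.
rewrite E theta_rational//; set t := - ii * sg * _.
pose T : C := - ii * tau.
have T0 : 0 < Re T by rewrite Re_mii.
have Tn0 : T != 0 by apply: contraTneq T0 => ->; rewrite ltxx.
have tauE : tau = ii * T by rewrite /T mulrA mulrN -expr2 (_ : ii ^+ 2 = -1) ?opprK ?mul1r// expr2; simpc.
have n2 : n.+1%:R ^+ 2 = d%:~R ^+ 2 :> C.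
  by rewrite dC exprMn (expr2 s%:~R) sC mul1r.
have tE : t = T * d%:~R / w.
  by rewrite /t n2 /sg /T; field; rewrite w0 dC0.
have tVE : t^-1 = T^-1 + ii * (c%:~R / d%:~R).
  have aux (z : C) : z != 0 -> (z * d%:~R / (c%:~R * (ii * z) + d%:~R))^-1 =
      z^-1 + ii * (c%:~R / d%:~R).
    by move=> z0; rewrite !invfM invrK; field; rewrite dC0 z0.
  by rewrite tE -aux// -tauE.
have -> : csum (fun y : 'rV[int]_(k.*2) => let Y := zrow y *m dualmx B in
    hweight i j Y * cex (- (pi%:C * t^-1 * (dot Y Y)%:C)) * gauss_sum B (s * b) n y) =
  gauss_sum B (s * b) n 0 * - (T ^+ (k + 2) * `|\det B|%:C * theta B i j tau).
  have := hweight_inversion 0 ij uB T0; rewrite -[X in csum X]/(fun x => _).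
  rewrite (_ : csum (fun x : 'rV[int]_k.*2 => _) = theta B i j tau); last first.
    by apply: eq_csum => x; cbv zeta; rewrite addr0.
  move=> ->; rewrite opprK -csumZ.
    apply: eq_csum => y; cbv zeta; set Y := _ *m _.
    rewrite -(gauss_sum_twist y dt cl dE ss) -/Y.
    have -> : dot (zrow y) (0 : 'rV[R]_k.*2) = 0 by rewrite dotC dot0l.
    rewrite rmorph0 mulr0 addr0 tVE.
    rewrite (_ : - (pi%:C * (T^-1 + ii * (c%:~R / d%:~R)) * (dot Y Y)%:C) =
      - (pi%:C * T^-1 * (dot Y Y)%:C) + - (pi%:C * ii * (c%:~R / d%:~R) * (dot Y Y)%:C)); last by ring.
    have ceY : cex (- (pi%:C * ii * (c%:~R / d%:~R) * (dot Y Y)%:C)) =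
        ce (- (c%:~R / d%:~R * (dot Y Y / 2))).
      rewrite /ce; congr cex.
      have -> : (- (c%:~R / d%:~R * (dot Y Y / 2)))%:C = - (c%:~R / d%:~R * ((dot Y Y)%:C / 2)) :> C.
        by rewrite rmorphN rmorphM/= !fmorph_div/= !intrC rmorph_nat.
      by move: (pi%:C : C) => q; field.
    rewrite cexD ceY; move: (cex _) (ce _) (gauss_sum _ _ _ _) (hweight _ _ _) => x1 x2 x3 x4; ring.
  have tV := ReV_gt0 T0.
  have := hweight_summable 0 ij (dualmx_unit uB) tV (f := fun=> 1) (fun _ => _).
  move=> h; apply: (eq_csummable _ (h _)); last by rewrite cabs1.
  move=> x; cbv zeta; rewrite addr0 mulr1.
  have -> : dot (zrow x) (0 : 'rV[R]_k.*2) = 0 by rewrite dotC dot0l.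
  by rewrite rmorph0 mulr0 addr0.
rewrite n2 tE; have D0 := detB_neq0.
rewrite expr_div_n (_ : (T * d%:~R) ^+ (k + 2) = T ^+ (k + 2) * (d%:~R ^+ k * d%:~R ^+ 2)); last first.
  by rewrite -exprD -exprMn.
rewrite !invfM !invrK.
have : d%:~R ^+ k != 0 :> C by rewrite expf_neq0.
have : T ^+ (k + 2) != 0 by rewrite expf_neq0.
move: (T ^+ (k + 2)) (w ^+ (k + 2)) (`|\det B|%:C) D0 => T' w' D' D'0 T'0.
move: (d%:~R ^+ k) => d' d'0.
by field; rewrite ?D'0 ?T'0 ?d'0 ?dC0.
Qed.

(** The exponent of a dual vector in the expansions at the cusps. *)
Definition dual_halfnorm (y : 'rV[int]_(k.*2)) : nat :=
  `|Num.floor (l%:R * dot (zrow y *m dualmx B) (zrow y *m dualmx B) / 2)|%N.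

Lemma dual_halfnormE y : l%:R * dot (zrow y *m dualmx B) (zrow y *m dualmx B) = 2 * (dual_halfnorm y)%:R.
Proof.
have [z e] := lev1 y; rewrite /dual_halfnorm e mulrAC divff ?pnatr_eq0// mul1r intrKfloor.
have : 0 <= 2 * z%:~R :> R by rewrite -e mulr_ge0 ?dot_ge0.
by rewrite pmulr_rge0// ler0z => z0; rewrite natr_absz ger0_norm.
Qed.

Hypothesis l0 : (0 < l)%N.

Lemma qroot_dual_halfnorm (tau : C) y :
  cex (- (pi%:C * (- ii * tau) * (dot (zrow y *m dualmx B) (zrow y *m dualmx B))%:C)) =
  qroot l tau ^+ dual_halfnorm y.
Proof.
rewrite qroot_cex; congr cex; have lC : l%:R != 0 :> C by rewrite pnatr_eq0 -lt0n.
have -> : (dot (zrow y *m dualmx B) (zrow y *m dualmx B))%:C = 2 * ((dual_halfnorm y)%:R / l%:R) :> C.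
  have lR : l%:R != 0 :> R by rewrite pnatr_eq0 -lt0n.
  rewrite -[dot _ _](mulKf lR) dual_halfnormE rmorphM/= fmorphV rmorphM/= !rmorph_nat; ring.
move: (_ / _) => q; ring.
Qed.

Lemma cabs_gauss_sum (al : int) n y : cabs (gauss_sum B al n y) <= #|'rV['I_n.+1]_(k.*2)|%:R.
Proof.
rewrite /gauss_sum; apply: (le_trans (le_cabs_sum _ _ _)).
rewrite -sum1_card natr_sum; apply: ler_sum => h _.
by rewrite cabsM !cabs_ce mulr1.
Qed.

(** Near a / c the theta series is a series over the dual lattice, whose norms
    lie in (2 / l) Z by definition of the level. *)
Lemma theta_cusp (a b c d : int) : a * d - b * c = 1 -> c != 0 ->
  exists A : nat -> C, q_expansion l (fun tau =>
    (c%:~R * tau + d%:~R) ^- (k + 2) *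
    theta B i j ((a%:~R * tau + b%:~R) / (c%:~R * tau + d%:~R))) A.
Proof.
move=> dt c0; have [s [n [cE ss]]] := int_sgn c0.
have s0 : s != 0 by apply: contra_eq_neq ss => ->; rewrite mul0r eq_sym oner_neq0.
have sC : s%:~R * s%:~R = 1 :> C by rewrite -intrM ss.
have cC : c%:~R = s%:~R * n.+1%:R :> C by rewrite cE intrM.
have cC0 : c%:~R != 0 :> C by rewrite intr_eq0.
have sC0 : s%:~R != 0 :> C by rewrite intr_eq0.
have nE : n.+1%:R^-1 = s%:~R / c%:~R :> C by rewrite cC invfM mulrA divff// mul1r.
have n2 : n.+1%:R ^+ 2 = c%:~R ^+ 2 :> C.
  by rewrite cC exprMn (expr2 s%:~R) sC mul1r.
have bE : b%:~R = (a%:~R * d%:~R - 1) / c%:~R :> C.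
  have e : b * c = a * d - 1 by rewrite -dt; ring.
  by rewrite -intrM -[1]/(1%:~R) -intrB -e intrM mulfK.
pose A y : C := hweight i j (zrow y *m dualmx B) * (gauss_sum B (s * a) n y *
   ce (d%:~R / c%:~R * (dot (zrow y *m dualmx B) (zrow y *m dualmx B) / 2))).
pose K0 : C := - c%:~R ^+ 2 * ((ii * c%:~R) ^+ (k + 2) * `|\det B|%:C)^-1.
exists (fun e => csum (fun y => if dual_halfnorm y == e then K0 * A y else 0)).
apply: fiber_q_expansion => tau ut.
have sA : csummable (fun y => A y * qroot l tau ^+ dual_halfnorm y).
  pose M : R := #|'rV['I_n.+1]_(k.*2)|%:R.
  have M0 : 0 < M by rewrite ltr0n card_mx card_ord expn_gt0.
  have T0 : 0 < Re (- ii * tau) by rewrite Re_mii.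
  have := gauss_sq_summ (dualmx_unit uB) 0 (mulr_gt0 (pi_gt0 R) T0).
  move=> /(summZ M); apply: csummable_le => y /=; rewrite addr0 /A -qroot_dual_halfnorm.
  rewrite cabsM (cabsM (hweight _ _ _)) (cabsM (gauss_sum _ _ _ _)) cabs_ce mulr1 cabs_cex Re_gauss.
  rewrite [leRHS]mulrA; apply: ler_wpM2r; rewrite ?expR_ge0//.
  rewrite mulrC; apply: ler_pM; rewrite ?cabs_ge0 ?cabs_gauss_sum//.
  exact: cabs_hweight.
split; first by apply: (eq_csummable _ (csummableZ K0 sA)) => y; rewrite mulrA.
rewrite (eq_csum (g := fun y => K0 * (A y * qroot l tau ^+ dual_halfnorm y))); last by move=> y; rewrite mulrA.
rewrite csumZ//.
have w0 : c%:~R * tau + d%:~R != 0 by apply: moebius_denom_neq0; rewrite ?c0.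
set w := c%:~R * tau + d%:~R in w0 *.
pose sg := - (c%:~R * w)^-1.
have E : (a%:~R * tau + b%:~R) / w = (s * a)%:~R / n.+1%:R + sg.
  rewrite intrM nE (_ : s%:~R * a%:~R * _ = s%:~R * s%:~R * a%:~R / c%:~R); last by ring.
  by rewrite sC bE /sg /w; field; rewrite -/w w0 cC0.
have us : upper sg.
  apply: (@upperD_real ((s * a)%:~R / n.+1%:R)).
  by rewrite fmorph_div/= intrC rmorph_nat -E; exact: moebius_upper.
rewrite E theta_rational//; set t := - ii * sg * _.
have i0 : ii != 0 :> C by rewrite eq_complex/= oner_eq0 andbF.
have i2 : ii * ii = -1 :> C by simpc.
have tE : t = ii * c%:~R / w by rewrite /t n2 /sg; field; rewrite w0 cC0.
have tVE : t^-1 = - ii * tau + - (ii * (d%:~R / c%:~R)).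
  have iV : ii^-1 = - ii :> C by apply: (mulfI i0); rewrite divff// mulrN i2 opprK.
  by rewrite tE !invfM invrK iV /w; field.
rewrite (_ : csum (fun y => _) = csum (fun y => A y * qroot l tau ^+ dual_halfnorm y)); last first.
  apply: eq_csum => y; cbv zeta; rewrite -qroot_dual_halfnorm /A; set Y := _ *m _.
  have -> : - (pi%:C * t^-1 * (dot Y Y)%:C) = - (pi%:C * (- ii * tau) * (dot Y Y)%:C) +
     pi%:C * ii * (d%:~R / c%:~R) * (dot Y Y)%:C by rewrite tVE; ring.
  have ceY : cex (pi%:C * ii * (d%:~R / c%:~R) * (dot Y Y)%:C) =
      ce (d%:~R / c%:~R * (dot Y Y / 2)).
    rewrite /ce; congr cex.
    have -> : (d%:~R / c%:~R * (dot Y Y / 2))%:C = d%:~R / c%:~R * ((dot Y Y)%:C / 2) :> C.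
      by rewrite rmorphM/= !fmorph_div/= !intrC rmorph_nat.
    by move: (pi%:C : C) => q; field.
  rewrite cexD ceY; move: (cex _) (ce _) (gauss_sum _ _ _ _) (hweight _ _ _) => x1 x2 x3 x4; ring.
rewrite mulrA; congr (_ * _); rewrite n2 tE /K0 expr_div_n.
have D0 := detB_neq0.
have : (ii * c%:~R) ^+ (k + 2) != 0 :> C by rewrite expf_neq0// mulf_neq0.
have : w ^+ (k + 2) != 0 by rewrite expf_neq0.
move: ((ii * c%:~R) ^+ (k + 2)) (w ^+ (k + 2)) (`|\det B|%:C) D0 => T' w' D' D'0 w'0 T'0.
by field; rewrite ?D'0 ?T'0 ?w'0.
Qed.

End ThetaGamma0.

(** * The multiplier is trivial on Gamma_1 *)

Section GaloisConjugation.
Variable F : numFieldType.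

Let intQ := map_poly (intr : int -> rat).
Let ratF := map_poly (ratr : rat -> F).

Lemma root_Cyclotomic n (z : F) : n.-primitive_root z ->
  root (map_poly intr 'Phi_n : {poly F}) z.
Proof.
move=> pz; have n0 := prim_order_gt0 pz.
have : root (map_poly intr ('X^n - 1 : {poly int}) : {poly F}) z.
  rewrite rmorphB/= map_polyXn rmorph1 rootE !hornerE.
  by rewrite prim_expr_order// subrr.
rewrite -prod_Cyclotomic// rmorph_prod rootE horner_prod prodf_seq_eq0 => /hasP[d].
rewrite -dvdn_divisors// => dn /= /eqP dz.
suff -> : n = d by rewrite rootE dz.
apply/eqP; rewrite eqn_dvd dn andbT (prim_order_dvd pz).
have d0 : (0 < d)%N := dvdn_gt0 n0 dn.
have : root (map_poly intr ('X^d - 1 : {poly int}) : {poly F}) z.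
  rewrite -prod_Cyclotomic// rmorph_prod rootE horner_prod prodf_seq_eq0.
  by apply/hasP; exists d; rewrite ?dz ?eqxx// -dvdn_divisors.
by rewrite rmorphB/= map_polyXn rmorph1 rootE !hornerE subr_eq0.
Qed.

(** The cyclotomic polynomial is the minimal polynomial of a primitive root of
    unity among the algebraic numbers. *)
Lemma Cyclotomic_irreducible n : (0 < n)%N -> irreducible_poly (intQ 'Phi_n).
Proof.
move=> n0; have [z pz] := C_prim_root_exists n0.
have [p [pE pm] pP] := minCpolyP z.
have eC : map_poly (ratr : rat -> algC) (intQ 'Phi_n) = minCpoly z.
  rewrite (minCpoly_cyclotomic pz) -(Cintr_Cyclotomic pz) -map_poly_comp.
  by apply: eq_map_poly => b; rewrite /= ratr_int.
have -> : intQ 'Phi_n = p.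
  by apply: (map_inj_poly (fmorph_inj (ratr : {rmorphism rat -> algC}))); rewrite ?rmorph0// eC pE.
have p0 : p != 0 by exact: monic_neq0.
have rp : root (map_poly (ratr : rat -> algC) p) z by rewrite pP dvdpp.
split; first by have := size_minCpoly z; rewrite pE size_map_poly.
move=> q q1 /dvdpP[h ph].
move: (p0); rewrite {1}ph mulf_eq0 negb_or => /andP[h0 q0].
move: rp; rewrite {1}ph rmorphM/= rootM !pP => /orP[ph'|pq]; last first.
  by rewrite /eqp pq andbT ph dvdp_mull.
have := dvdp_leq h0 ph'; rewrite ph size_mul//; move: h0 q0 q1.
rewrite -!size_poly_gt0; lia.
Qed.

(** A polynomial relation with integer coefficients satisfied by one primitive
    root of unity is satisfied by its conjugates. *)
Lemma root_conjugate n t (z : F) (P : {poly int}) : n.-primitive_root z ->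
  coprime t n -> root (map_poly intr P : {poly F}) z ->
  root (map_poly intr P : {poly F}) (z ^+ t).
Proof.
move=> pz tn rz; have n0 := prim_order_gt0 pz.
have mE (Q : {poly int}) : map_poly intr Q = ratF (intQ Q) :> {poly F}.
  by rewrite /ratF /intQ -map_poly_comp; apply: eq_map_poly => b; rewrite /= ratr_int.
have pzt : n.-primitive_root (z ^+ t) by rewrite prim_root_exp_coprime.
have r1 := root_Cyclotomic pz; have r2 := root_Cyclotomic pzt.
rewrite !mE in rz r1 r2 *.
have [/dvdpP[q ->]|nd] := boolP (intQ 'Phi_n %| intQ P).
  by rewrite /ratF rmorphM/= rootM r2 orbT.
have := irreducible_poly_coprime (intQ P) (Cyclotomic_irreducible n0).
rewrite nd -(coprimep_map (ratr : {rmorphism rat -> F})) => /coprimep_root /(_ r1).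
by rewrite -rootE rz.
Qed.

End GaloisConjugation.

Section Multiplier.
Context {R : realType}.
Local Notation C := R[i].

Lemma ce_prim_root n : n.+1.-primitive_root (ce n.+1%:R^-1 : C).
Proof.
apply/andP; split => //; apply/forallP => e; rewrite unity_rootE -ceMn.
apply/eqP; have nR : 0 < n.+1%:R :> R by rewrite ltr0n.
have ce1 : ce (1 : R) = 1 by exact: (ce_int 1).
have [ei|ne] := eqVneq e.+1 n.+1; first by rewrite ei divff ?pnatr_eq0// ce1 !eqxx.
apply/negbTE/ce_neq1; first by rewrite divr_gt0 ?ltr0n.
rewrite ltr_pdivrMr// mul1r ltr_nat.
by move: ne; have := ltn_ord e; lia.
Qed.

Lemma ce_modz n (z : int) : ce (z%:~R / n.+1%:R) =
  (ce n.+1%:R^-1 : C) ^+ `|(z %% n.+1%:Z)%Z|%N.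
Proof.
rewrite -ceMn [in LHS](divz_eq z n.+1%:Z) natr_absz ger0_norm ?modz_ge0//.
have n0 : n.+1%:R != 0 :> R by rewrite pnatr_eq0.
rewrite intrD intrM mulrDl mulfK// addrC ce_add_int//.
Qed.

Variables (m : nat) (B : 'M[R]_m).

Lemma gauss_sum0E al n : gauss_sum B al n 0 =
  \sum_(h : 'rV['I_n.+1]_m) ce ((al * halfnorm B (residue h))%:~R / n.+1%:R).
Proof.
apply: eq_bigr => h _; rewrite intrM (_ : zrow 0 = 0) ?dot0l ?mulr0 ?ce0 ?mulr1//.
by apply/rowP => e; rewrite !mxE.
Qed.

Lemma gauss_sum_modz (al al' : int) n : (al = al' %[mod n.+1])%Z ->
  gauss_sum B al n 0 = gauss_sum B al' n 0.
Proof.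
move=> e; rewrite !gauss_sum0E; apply: eq_bigr => h _; rewrite !ce_modz.
by rewrite -modzMml e modzMml.
Qed.

(** A Gauss sum is an integral polynomial in a primitive root of unity; when its
    value is an integer, conjugation fixes it. *)
Lemma gauss_sum_conjugate (al z : int) n t : coprime t n.+1 ->
  gauss_sum B al n 0 = z%:~R -> gauss_sum B (t%:Z * al) n 0 = z%:~R.
Proof.
pose P : {poly int} := \sum_(h : 'rV['I_n.+1]_m) 'X^(`|((al * halfnorm B (residue h)) %% n.+1%:Z)%Z|%N) - z%:P.
have PE x : (map_poly intr P : {poly C}).[x] =
    \sum_(h : 'rV['I_n.+1]_m) x ^+ (`|((al * halfnorm B (residue h)) %% n.+1%:Z)%Z|%N) - z%:~R.
  rewrite /P rmorphB rmorph_sum/= map_polyC/= !hornerE horner_sum; congr (_ - _).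
  by apply: eq_bigr => h _; rewrite map_polyXn hornerXn.
move=> tn ge; have := root_conjugate (ce_prim_root n) tn (P := P).
rewrite !rootE !PE !subr_eq0 => h; apply/eqP; rewrite -[X in X == _]/(_) gauss_sum0E.
rewrite (eq_bigr (fun h => (ce n.+1%:R^-1 ^+ t) ^+ (`|((al * halfnorm B (residue h)) %% n.+1%:Z)%Z|%N))).
  apply: h; rewrite -ge gauss_sum0E; apply/eqP/eq_bigr => h _; by rewrite ce_modz.
move=> e _; rewrite -exprM mulnC exprM -ce_modz -ceMn; congr ce.
by rewrite -mulrA (intrM _ t%:Z) -pmulrn mulrA.
Qed.

End Multiplier.

Lemma det22 (A : 'M[int]_2) : \det A = A 0 0 * A 1 1 - A 0 1 * A 1 0.
Proof.
rewrite (expand_det_row _ 0) !big_ord_recl big_ord0 /cofactor !det_mx11 !mxE.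
rewrite (_ : lift 0 0 = 1 :> 'I_2); last exact: val_inj.
rewrite (_ : lift 1 0 = 0 :> 'I_2); last exact: val_inj.
by rewrite /= expr0 expr1 mul1r mulN1r addr0 mulrN.
Qed.

Lemma int_mul_eq1 (x y : int) : x * y = 1 -> x = y /\ y * y = 1.
Proof.
move=> xy; have : absz (x * y) == 1%N by rewrite xy.
rewrite abszM muln_eq1 => /andP[_ /eqP v].
have [e|e] : y = 1 \/ y = -1 by lia.
  by move: xy; rewrite e mulr1 => ->.
have x1 : x = -1 by lia.
by rewrite x1 e.
Qed.

Lemma pow_gauss {R : realType} (b q : R) e : 0 < b -> 0 <= q -> (e <= 4)%N ->
  q ^+ e * expR (- (b * q)) <= (b / 8) ^- e * expR (- (b / 2 * q)).
Proof.
move=> b0 q0 e4; have b8 : 0 < b / 8 by rewrite divr_gt0.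
rewrite (_ : - (b * q) = - (b / 2 * q) + - (b / 2 * q)); last by field.
rewrite expRD mulrA; apply: ler_wpM2r; rewrite ?expR_ge0//.
rewrite expRN ler_pdivrMr ?expR_gt0// ler_pdivlMl ?exprn_gt0// -exprMn.
apply: (le_trans (pow_le_exp e _)); first by rewrite mulr_ge0// ltW.
rewrite ler_expR mulrA ler_wpM2r//.
have : (e%:R : R) <= 4 by rewrite ler_nat.
by have := ltW b0; nra.
Qed.

Section ThetaModular.
Context {R : realType}.
Local Notation C := R[i].
Variables (k : nat) (B : 'M[R]_(k.*2)) (i j : 'I_(k.*2)).
Hypothesis (ij : i != j) (uB : B \in unitmx).
Hypothesis evenB : forall x : 'rV[int]_(k.*2), exists z : int,
  dot (zrow x *m B) (zrow x *m B) = 2 * z%:~R.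
Variable l : nat.
Hypothesis lev1 : forall y : 'rV[int]_(k.*2), exists z : int,
  l%:R * dot (zrow y *m dualmx B) (zrow y *m dualmx B) = 2 * z%:~R.
Hypothesis lev2 : forall y : 'rV[int]_(k.*2), exists w : 'rV[int]_(k.*2),
  l%:R *: (zrow y *m dualmx B) = zrow w *m B.
Hypothesis l1 : (1 < l)%N.

Local Notation theta := (theta B i j).

Lemma theta_qroot (tau : C) h : (0 < h)%N -> upper tau ->
  csummable (fun x => hweight i j (zrow x *m B) *
    qroot h tau ^+ (h * `|halfnorm B x|)%N) /\
  theta tau = csum (fun x => hweight i j (zrow x *m B) *
    qroot h tau ^+ (h * `|halfnorm B x|)%N).
Proof.
move=> h0 ut; have E x : hweight i j (zrow x *m B) *
    cex (- (pi%:C * (- ii * tau) * (dot (zrow x *m B) (zrow x *m B))%:C)) =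
    hweight i j (zrow x *m B) * qroot h tau ^+ (h * `|halfnorm B x|)%N.
  congr (_ * _); rewrite qroot_cex; congr cex.
  have -> : (h * `|halfnorm B x|)%:R / h%:R = (halfnorm B x)%:~R :> C.
    by rewrite natrM mulrAC divff ?pnatr_eq0 -?lt0n// mul1r natr_absz ger0_norm ?(halfnorm_ge0 evenB).
  rewrite (halfnormE evenB) rmorphM/= rmorph_int rmorph_nat; ring.
split; first exact: (eq_csummable E (theta_summable ij uB ut)).
exact: eq_csum.
Qed.

Lemma theta_translate (tau : C) (z : int) : theta (tau + z%:~R) = theta tau.
Proof.
apply: eq_csum => x; congr (_ * _).
have e := @cex_2piz R (z * halfnorm B x).
rewrite (halfnormE evenB) -[RHS]mulr1 -[X in _ = _ * X]e -cexD; congr cex.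
rewrite intrM rmorphM/= rmorph_int rmorph_nat; ring.
Qed.

Lemma gauss_sum_trivial : gauss_sum B 0 0 0 = 1.
Proof.
rewrite gauss_sum0E; under eq_bigr do rewrite mul0r mul0r ce0.
by rewrite sumr_const card_mx card_ord exp1n.
Qed.

Lemma ImD (z w : C) : Im (z + w) = Im z + Im w. Proof. by case: z w => ? ? []. Qed.

(** Differentiation under the sum, with a remainder that is linear in h because
    the exponential is expanded to second order. *)
Lemma theta_difference (tau : C) : upper tau -> exists D : C, exists2 M : R, 0 <= M &
  forall h : C, h != 0 -> cabs h <= Im tau / 4 ->
    cabs (D - h^-1 * (theta (h + tau) - theta tau)) <= M * cabs h.
Proof.
move=> ut; set y := Im tau; have y0 : 0 < y by [].
pose Q (x : 'rV[int]_(k.*2)) : R := dot (zrow x *m B) (zrow x *m B).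
have Q0 x : 0 <= Q x by exact: dot_ge0.
pose E x : C := cex (- (pi%:C * (- ii * tau) * (Q x)%:C)).
pose a x : C := pi%:C * ii * (Q x)%:C.
pose b : R := pi * y; have b0 : 0 < b by rewrite mulr_gt0 ?pi_gt0.
have cE x : cabs (E x) = expR (- (b * Q x)).
  by rewrite /E cabs_cex Re_gauss Re_mii.
have ca x : cabs (a x) = pi * Q x.
  rewrite /a cabsM (cabsM pi%:C) !cabsR !ger0_norm ?pi_ge0//.
  have -> : cabs ii = 1 :> R by rewrite /cabs /normc expr0n/= add0r expr1n sqrtr1.
  by rewrite mulr1.
pose g x : R := expR (- (3 / 4 * b / 2 * Q x)).
have b3 : 0 < 3 / 4 * b by rewrite mulr_gt0// divr_gt0.
have sg : summ g.
  have := lattice_summ uB 0 (divr_gt0 b3 (ltr0n _ 2)).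
  by apply: summ_le => x; rewrite addr0 ger0_norm ?expR_ge0.
have sD : csummable (fun x => hweight i j (zrow x *m B) * E x * a x).
  apply: csummable_le (summZ (pi * (b / 8) ^- 2) sg) => x; rewrite cabsM (cabsM (hweight _ _ _)) cE ca.
  have h1 := @pow_gauss _ b (Q x) 2 b0 (Q0 x) isT.
  apply: (@le_trans _ _ (pi * (Q x ^+ 2 * expR (- (b * Q x))))); last first.
    rewrite -mulrA ler_wpM2l ?pi_ge0//; apply: (le_trans h1).
    rewrite ler_wpM2l ?invr_ge0 ?exprn_ge0 ?divr_ge0 ?(ltW b0)// ler_expR lerN2.
    by rewrite ler_wpM2r//; have := ltW b0; lra.
  rewrite (_ : pi * (Q x ^+ 2 * expR (- (b * Q x))) = Q x * (expR (- (b * Q x)) * (pi * Q x))); last by ring.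
  rewrite -mulrA; apply: ler_wpM2r; first by rewrite !mulr_ge0 ?expR_ge0 ?pi_ge0.
  exact: cabs_hweight.
exists (csum (fun x => hweight i j (zrow x *m B) * E x * a x)).
(* A quarter of the exponent b pays for the growth of exp (a x h), three
   quarters remain. *)
pose M : R := 4 * pi ^+ 2 * ((3 / 4) * b / 8) ^- 3.
have M0 : 0 <= M.
  have b8 : 0 <= 3 / 4 * b / 8 by rewrite divr_ge0// ltW.
  by apply: divr_ge0; [rewrite mulr_ge0 ?exprn_ge0 ?pi_ge0|rewrite exprn_ge0].
have g0 x : 0 <= g x by exact: expR_ge0.
exists (2 * (M * psum g)); first by apply: mulr_ge0 => //; apply: mulr_ge0 => //; exact: psum_ge0.
move=> h h0 hy.
have uh : upper (h + tau).
  have := cabs_Im h; rewrite /upper ler_norml => /andP[+ _].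
  by rewrite ImD -/y; move: hy y0; lra.
pose r x : C := - (hweight i j (zrow x *m B) * E x * h^-1 * (cex (a x * h) - 1 - a x * h)).
have rb x : cabs (r x) <= M * cabs h * g x.
  rewrite /r cabsN 3!cabsM cE cabsV.
  have h3 := cex_bound2 (a x * h); rewrite (cabsM (a x)) ca in h3.
  have h4 : expR (pi * Q x * cabs h) <= expR (b / 4 * Q x).
    rewrite ler_expR /b (_ : pi * y / 4 * Q x = pi * Q x * (y / 4)); last by ring.
    by rewrite ler_wpM2l ?mulr_ge0 ?pi_ge0.
  have h1 := @pow_gauss _ (3 / 4 * b) (Q x) 3 b3 (Q0 x) isT.
  have hn0 : cabs h != 0 by rewrite gt_eqF// cabs_gt0.
  apply: (@le_trans _ _ (Q x * expR (- (b * Q x)) / cabs h *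
      (4 * (pi * Q x * cabs h) ^+ 2 * expR (b / 4 * Q x)))).
    apply: ler_pM; rewrite ?mulr_ge0 ?cabs_ge0 ?expR_ge0 ?invr_ge0 ?cabs_ge0//.
      by rewrite !ler_wpM2r ?expR_ge0 ?invr_ge0 ?cabs_ge0// cabs_hweight.
    by apply: (le_trans h3); rewrite ler_wpM2l// mulr_ge0// sqr_ge0.
  have eE : expR (- (b * Q x)) * expR (b / 4 * Q x) = expR (- (3 / 4 * b * Q x)).
    by rewrite -expRD; congr expR; field.
  rewrite (_ : _ * _ = 4 * pi ^+ 2 * cabs h * (Q x ^+ 3 * expR (- (3 / 4 * b * Q x)))); last first.
    by rewrite -eE; move: (pi : R) => q; field.
  rewrite (_ : M * _ * _ = 4 * pi ^+ 2 * cabs h * ((3 / 4 * b / 8) ^- 3 * g x)); last first.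
    by rewrite /M; move: (_ ^- 3) => q; ring.
  apply: ler_wpM2l; last exact: h1.
  by rewrite !mulr_ge0 ?exprn_ge0 ?pi_ge0 ?cabs_ge0.
have s1 := theta_summable ij uB ut; have s2 := theta_summable ij uB uh.
have -> : csum (fun x => hweight i j (zrow x *m B) * E x * a x) - h^-1 * (theta (h + tau) - theta tau)
    = csum r.
  rewrite /theta -csumB// -csumZ; last exact: csummableB.
  rewrite -csumB//; last by apply: csummableZ; exact: csummableB.
  apply: eq_csum => x; rewrite /r.
  have -> : cex (- (pi%:C * (- ii * (h + tau)) * (dot (zrow x *m B) (zrow x *m B))%:C)) =
      E x * cex (a x * h).
    by rewrite /E -cexD; congr cex; rewrite /a /Q; ring.
  set e1 := cex (a x * h); set e2 := cex (- _); rewrite -[E x]/e2.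
  move: e1 e2 (a x) (hweight _ _ _) => x1 x2 x3 x4.
  by field.
have sr : csummable r.
  by apply: csummable_le (summZ (M * cabs h) sg) => x; exact: rb.
apply: (le_trans (cabs_csum_le sr)).
rewrite (_ : 2 * (M * psum g) * cabs h = 2 * (M * cabs h * psum g)); last by clearbody M; ring.
apply: ler_wpM2l => //; rewrite -psumZ//; last by rewrite mulr_ge0 ?cabs_ge0.
apply: le_psum => [x|x|]; [exact: cabs_ge0|exact: rb|exact: summZ].
Qed.

Lemma theta_differentiable (tau : C) : upper tau -> differentiable_at theta tau.
Proof.
move=> ut; have [D [M M0 hM]] := theta_difference ut.
rewrite /differentiable_at /derivable; apply/cvg_ex; exists D.
apply/cvgrPdist_le => e e0.
have M1 : 0 < M + 1 by lra.
have eE : e = (Re e)%:C by move: e0; case: (e) => a b; rewrite ltcE/= => /andP[/eqP -> _].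
have Re0 : 0 < Re e by move: e0; rewrite {1}eE ltcR.
near=> h.
have h0 : h != 0 by near: h; exact: nbhs_dnbhs_neq.
have nE (z : C) : `|z| = (cabs z)%:C by [].
have hs : `|h| <= (Num.min (Im tau / 4) (Re e / (M + 1)))%:C.
  near: h; apply: dnbhs0_le; rewrite ltcR lt_min !divr_gt0//.
rewrite nE lecR le_min in hs; case/andP: hs => hs1 hs2.
rewrite nE eE lecR; rewrite /= in hM *.
have := hM h h0 hs1; rewrite [h *: 1]mulr1 => /le_trans; apply.
rewrite ler_pdivlMr// in hs2; apply: le_trans hs2.
by rewrite mulrC ler_wpM2l ?cabs_ge0//; lra.
Unshelve. all: by end_near. Qed.

(** Write d = 1 + z l.  The Gauss sum of the given matrix is a Galois conjugate
    of that of (1 z; l d) = (1 0; l 1) (1 z; 0 1), a product of two matrices with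
    multiplier 1; the latter sum is therefore the integer d ^+ k, and so is the
    former. *)
Lemma theta_Gamma1 (a b c d : int) (tau : C) : a * d - b * c = 1 ->
  (c = 0 %[mod l])%Z -> (d = 1 %[mod l])%Z -> upper tau ->
  theta ((a%:~R * tau + b%:~R) / (c%:~R * tau + d%:~R)) =
  (c%:~R * tau + d%:~R) ^+ (k + 2) * theta tau.
Proof.
move=> dt cl dl ut.
have [z dz] : exists z, d = 1 + z * l%:Z.
  have : (l%:Z %| d - 1)%Z by rewrite -eqz_mod_dvd; apply/eqP.
  by move=> /dvdzP[z e]; exists z; rewrite -e addrC subrK.
have d0 : d != 0.
  apply/eqP => d0; move: dl; rewrite d0 mod0z modz_small//; lia.
have [s [n [dE ss]]] := int_sgn d0.
rewrite (theta_Gamma0 ij uB evenB lev1 lev2 ut dt cl dE ss).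
have [[t0 [ut0 tn0]]|H] := pselect (exists t0, upper t0 /\ theta t0 != 0); last first.
  have -> : theta tau = 0 by apply: contrapT => /eqP h; apply: H; exists tau.
  by rewrite !mulr0.
suff -> : gauss_sum B (s * b) n 0 = (d ^+ k)%:~R.
  by rewrite rmorphXn/= mulfVK// expf_neq0// intr_eq0.
(* (1 z; l d) = (1 0; l 1) (1 z; 0 1) determines the sum of s z. *)
have g1 : gauss_sum B (s * z) n 0 = (d ^+ k)%:~R.
  have dt1 : 1 * d - z * l%:Z = 1 by rewrite dz; ring.
  have ll : (l%:Z = 0 %[mod l])%Z by rewrite modzz mod0z.
  have dt2 : 1 * 1 - 0 * l%:Z = 1 :> int by ring.
  have h1 := theta_Gamma0 ij uB evenB lev1 lev2 ut0 dt1 ll dE ss.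
  have ut1 : upper (t0 + z%:~R).
    move: ut0; rewrite /upper -(rmorph_int (real_complex R)); case: (t0) => u v /=.
    by rewrite addr0.
  have h2 := @theta_Gamma0 _ _ _ _ _ ij uB evenB _ lev1 lev2 1 0 l 1 1 0 _ ut1 dt2 ll erefl erefl.
  have E : (1%:~R * t0 + z%:~R) / (l%:~R * t0 + d%:~R) =
      (1%:~R * (t0 + z%:~R) + 0%:~R) / (l%:~R * (t0 + z%:~R) + 1%:~R).
    rewrite dz !mul1r addr0 intrD intrM; congr (_ / _); ring.
  rewrite E h2 expr1n invr1 mulr1 mulr0 gauss_sum_trivial mulr1 theta_translate in h1.
  have wE : l%:~R * (t0 + z%:~R) + 1%:~R = l%:~R * t0 + d%:~R :> C.
    by rewrite dz intrD intrM; ring.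
  have w0 : l%:~R * t0 + d%:~R != 0 :> C by apply: moebius_denom_neq0; rewrite ?d0 ?orbT.
  rewrite wE in h1; move: h1; set w := _ ^+ (k + 2) => h1.
  have {}w0 : w != 0 by rewrite expf_neq0.
  have : d%:~R ^+ k != 0 :> C by rewrite expf_neq0// intr_eq0.
  rewrite rmorphXn/=; move: (d%:~R ^+ k) h1 => D h1 D0.
  have {}h1 : w * theta t0 * 1 = w * theta t0 * (D^-1 * gauss_sum B (s * z) n 0).
    by rewrite mulr1 [LHS]h1; ring.
  by move/(mulfI (mulf_neq0 w0 tn0)): h1 => /(congr1 ( *%R D)); rewrite mulr1 mulVKf.
(* The two Gauss sums are conjugate: b = (- l b) z modulo d. *)
pose t := `|((- l%:Z * b) %% n.+1%:Z)%Z|%N.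
have tE : t%:Z = ((- l%:Z * b) %% n.+1%:Z)%Z by rewrite /t gez0_abs ?modz_ge0.
have nd : (n.+1%:Z %| d)%Z by rewrite dE dvdz_mull.
rewrite -(gauss_sum_conjugate (t := t) _ g1); last first.
  rewrite /coprime -dvdn1; set g := gcdn _ _.
  have gt : (g%:Z %| t%:Z)%Z by rewrite dvdzE/= dvdn_gcdl.
  have gn : (g%:Z %| n.+1%:Z)%Z by rewrite dvdzE/= dvdn_gcdr.
  have gd : (g%:Z %| d)%Z := dvdz_trans gn nd.
  have glb : (g%:Z %| l%:Z * b)%Z.
    have := divz_eq (- l%:Z * b) n.+1%:Z; rewrite -tE mulNr => /eqP; rewrite eqr_oppLR => /eqP ->.
    by rewrite rpredN rpredD// dvdz_mull.
  have e : d * (a * (d - z * l%:Z) - b * c) + l%:Z * b * (c * z) = 1.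
    transitivity ((a * d - b * c) * (d - z * l%:Z)); first by ring.
    by rewrite dt mul1r dz; ring.
  have : (g%:Z %| d * (a * (d - z * l%:Z) - b * c) + l%:Z * b * (c * z))%Z.
    by rewrite rpredD// dvdz_mulr.
  by rewrite e dvdzE/= dvdn1.
apply: gauss_sum_modz; rewrite tE modzMml; apply/eqP; rewrite eqz_mod_dvd.
have -> : s * b - - l%:Z * b * (s * z) = s * b * d by rewrite dz; ring.
by rewrite dvdz_mull.
Qed.

Lemma theta_cusps (g : 'M[int]_2) : \det g = 1 ->
  exists a : nat -> C, q_expansion l (slash (k + 2) g theta) a.
Proof.
rewrite det22 => dt; have l0 : (0 < l)%N by exact: ltnW.
have [c0|c0] := eqVneq (g 1 0) 0; last exact: (theta_cusp ij uB evenB lev1 l0 dt c0).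
have da : g 0 0 * g 1 1 = 1 by move: dt; rewrite c0 mulr0 subr0.
have [zE s1] := int_mul_eq1 da.
have sC : (g 1 1)%:~R * (g 1 1)%:~R = 1 :> C by rewrite -intrM s1.
have s0 : (g 1 1)%:~R != 0 :> C by apply: contra_eq_neq sC => ->; rewrite mul0r eq_sym oner_neq0.
pose K : C := (g 1 1)%:~R ^- (k + 2).
exists (fun e => csum (fun x => if (l * `|halfnorm B x|)%N == e then K * hweight i j (zrow x *m B) else 0)).
apply: fiber_q_expansion => tau ut.
have [sm E] := theta_qroot l0 ut.
split; first by apply: (eq_csummable _ (csummableZ K sm)) => x; rewrite mulrA.
rewrite (eq_csum (g := fun x => K * (hweight i j (zrow x *m B) *
  qroot l tau ^+ (l * `|halfnorm B x|)))); last by move=> x; rewrite mulrA.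
rewrite csumZ// -E /slash c0 mul0r add0r; congr (_ * _).
rewrite zE mulrDl mulrAC divff// mul1r -(theta_translate tau (g 0 1 * g 1 1)).
congr (theta (_ + _)); rewrite intrM; congr (_ * _).
by apply: (mulfI s0); rewrite divff.
Qed.

Lemma theta_modular : modular_form (k + 2) l theta.
Proof.
split; last exact: theta_cusps.
  exact: theta_differentiable.
move=> g tau [dt g00 g11 g10] ut; rewrite /slash theta_Gamma1//; last first.
  by rewrite -dt det22.
rewrite mulrA mulVf ?mul1r// expf_neq0// moebius_denom_neq0//.
apply/negP => /negP; rewrite negb_or !negbK => /andP[/eqP e1 /eqP e2].
by move: dt; rewrite det22 e1 e2 !mulr0 subrr.
Qed.

End ThetaModular.

(** * Rotation invariant probability on the sphere *)

Section BorelCoordinates.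
Context {R : realType}.

Lemma ball_rVE n (x y : 'rV[R]_n) e : 0 < e ->
  ball x e y <-> forall i, ball (x 0 i) e (y 0 i).
Proof.
move=> e0; split => [[_ h] i|h]; first exact: h.
by split => // i j; rewrite ord1.
Qed.

Let box n (p : 'rV[rat]_n * nat) : set 'rV[R]_n :=
  ball (map_mx ratr p.1 : 'rV[R]_n) p.2.+1%:R^-1.

Lemma open_rat_boxes n (U : set 'rV[R]_n) : open U ->
  U = \bigcup_p (if `[< box p `<=` U >] then box p else set0).
Proof.
move=> oU; apply/seteqP; split => [x Ux|x [p _]]; last first.
  by case: asboolP => // h /h.
have := open_nbhs_nbhs (conj oU Ux); rewrite -nbhs_ballE => -[e /= e0 xe].
have [k ke] : exists k : nat, k.+1%:R^-1 < e / 2.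
  have e2 : 0 < e / 2 by rewrite divr_gt0.
  exists (Num.trunc (e / 2)^-1); rewrite invf_plt ?posrE ?ltr0n//.
  exact: truncnS_gt.
have k0 : 0 < k.+1%:R^-1 :> R by rewrite invr_gt0 ltr0n.
have q (i : 'I_n) : {q : rat | ball (x 0 i) k.+1%:R^-1 (ratr q : R)}.
  apply: cid; have [|q] := @rat_in_itvoo R (x 0 i - k.+1%:R^-1) (x 0 i + k.+1%:R^-1).
    by rewrite ltrBlDr -addrA ltrDl addr_gt0.
  by rewrite in_itv/= => h; exists q; rewrite ball_itv /= in_itv/=.
pose c : 'rV[rat]_n := \row_i sval (q i).
have cx : box (c, k) x.
  apply/ball_rVE => // i; rewrite !mxE; exact/ball_sym/(svalP (q i)).
exists (c, k) => //; case: asboolP => // -[] y /= yb; apply: xe.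
apply: (@le_ball _ _ x (k.+1%:R^-1 + k.+1%:R^-1)).
  by apply/ltW; rewrite [ltRHS](splitr e) ltrD.
exact: ball_triangle (ball_sym cx) yb.
Qed.

(** A map into R^n is Borel as soon as its coordinates are: open sets are
    countable unions of boxes. *)
Lemma measurable_borelRV d (T : measurableType d) n (F : T -> borelRV n) :
  (forall i, measurable_fun setT (fun t => (F t : 'rV[R]_n) 0 i)) ->
  measurable_fun setT F.
Proof.
move=> mF; apply: (@measurability _ _ _ _ _ F (@open 'rV[R]_n)) => //.
move=> _ [U oU <-]; rewrite setTI (open_rat_boxes oU) preimage_bigcup.
apply: countable_bigcupT_measurable => // p; case: ifP => _; last first.
  by rewrite preimage_set0.
have k0 : 0 < p.2.+1%:R^-1 :> R by rewrite invr_gt0 ltr0n.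
rewrite (_ : _ @^-1` _ = \bigcap_(i in [set: 'I_n])
    ((fun t => (F t : 'rV[R]_n) 0 i) @^-1` ball ((map_mx ratr p.1 : 'rV[R]_n) 0 i) p.2.+1%:R^-1)).
  apply: fin_bigcap_measurable => // i _; rewrite -[X in measurable X]setTI.
  by apply: mF => //; rewrite ball_itv; exact: measurable_itv.
apply/seteqP; split => t /=; first by move=> /(ball_rVE _ _ k0) h i _; exact: h.
by move=> h; apply/(ball_rVE _ _ k0) => i; exact: h.
Qed.

Lemma continuous_borelRV n (f : 'rV[R]_n -> R) : continuous f ->
  measurable_fun setT (f : borelRV n -> R).
Proof.
move=> cf; apply: (measurability _ (RGenOInfty.measurableE R)) => //.
move=> _ [_ [x ->] <-]; rewrite setTI; apply: sub_sigma_algebra.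
by move/continuousP: cf; apply; exact: rray_open.
Qed.

Lemma measurable_coord n i : measurable_fun setT ((fun x : 'rV[R]_n => x 0 i) : borelRV n -> R).
Proof. by apply: continuous_borelRV; exact: coord_continuous. Qed.

Lemma measurable_dot n : measurable_fun setT ((fun x : 'rV[R]_n => dot x x) : borelRV n -> R).
Proof.
under eq_fun do rewrite dotE.
by apply: measurable_sum => i; apply: measurable_funM; exact: measurable_coord.
Qed.

Lemma measurable_mulmx n (g : 'M[R]_n) :
  measurable_fun setT ((fun x : 'rV[R]_n => x *m g) : borelRV n -> borelRV n).
Proof.
apply: measurable_borelRV => i; under eq_fun do rewrite mxE.
apply: measurable_sum => j; apply: measurable_funM; first exact: measurable_coord.
exact: measurable_cst.
Qed.

Lemma measurable_ballRV n (x : 'rV[R]_n) r : measurable (ball x r : set (borelRV n)).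
Proof. by apply: sub_sigma_algebra; exact: ball_open. Qed.

End BorelCoordinates.

Section AsSigmaFinite.
Context d (T : measurableType d) (R : realType) (mu : {measure set T -> \bar R}).

(** An alias of [mu] on which sigma-finiteness, a hypothesis about [mu],
    becomes a canonical instance. *)
Definition as_sigma_finite (sf : sigma_finite setT mu) : set T -> \bar R := mu.

Hypothesis sf : sigma_finite setT mu.

HB.instance Definition _ := Measure.copy (as_sigma_finite sf) mu.

HB.instance Definition _ := Measure_isSigmaFinite.Build _ _ _ (as_sigma_finite sf) sf.

End AsSigmaFinite.

Lemma row_mx_translate {R : realType} n (t : R) (x : 'rV[R]_n) (a : 'rV[R]_(1 + n)) :
  row_mx t%:M x + a = row_mx (t + lsubmx a 0 0)%:M (x + rsubmx a).
Proof.
rewrite -[X in _ + X]hsubmxK add_row_mx; congr row_mx.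
by rewrite [X in _ + X = _]mx11_scalar -raddfD.
Qed.

Section LebesgueRV.
Context {R : realType}.

Definition ball0 {n} (r : R) : set (borelRV (R := R) n) := ball (0 : 'rV[R]_n) r.

Local Open Scope ereal_scope.

Definition translation_invariant n (mu : set (borelRV (R := R) n) -> \bar R) :=
  forall (a : 'rV[R]_n) (A : set (borelRV n)), measurable A ->
    mu ((fun x : 'rV[R]_n => (x + a)%R) @^-1` A) = mu A.

Definition lebesgue_like n (mu : set (borelRV (R := R) n) -> \bar R) :=
  [/\ sigma_finite setT mu, translation_invariant mu &
      forall r : R, (0 < r)%R -> 0 < mu (ball0 r) < +oo].

Lemma ball_cover n : \bigcup_k (ball0 k.+1%:R : set (borelRV n)) = setT.
Proof.
apply/seteqP; split => // x _; exists (Num.trunc (\sum_i `|x 0%R i|)%R) => //.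
apply/ball_rVE => [|i]; first by rewrite ltr0n.
rewrite /ball/= mxE sub0r normrN; apply: le_lt_trans (truncnS_gt _).
by rewrite (bigD1 i)//= lerDl sumr_ge0.
Qed.

Lemma balls_sigma_finite n (mu : {measure set (borelRV (R := R) n) -> \bar R}) :
  (forall r : R, (0 < r)%R -> mu (ball0 r) < +oo) -> sigma_finite setT mu.
Proof.
move=> h; exists (fun k => ball0 k.+1%:R); first by rewrite ball_cover.
by move=> k; split; [exact: measurable_ballRV|apply: h; rewrite ltr0n].
Qed.

(** The translate of Lebesgue measure gives intervals their length. *)
Lemma lebesgue_translation (a : R) (A : set (measurableTypeR R)) : measurable A ->
  lebesgue_measure ((fun t : R => (t + a)%R) @^-1` A) = lebesgue_measure A.
Proof.
move=> mA; have mf : measurable_fun setT (fun t : measurableTypeR R => (t + a)%R : measurableTypeR R).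
  by apply: measurable_funD => //; exact: measurable_cst.
pose mu : {measure set (measurableTypeR R) -> \bar R} :=
  measure_function_pushforward__canonical__measure_function_Measure lebesgue_measure mf.
apply/esym; apply: (@lebesgue_measure_unique R mu _ A mA) => X -[[b c] _ <-] /=.
rewrite /pushforward (_ : _ @^-1` _ = `]b - a, c - a]%classic)%R; last first.
  by apply/seteqP; split => t /=; rewrite !in_itv/= ltrBlDr lerBrDr.
rewrite !lebesgue_measure_itv/= !lte_fin ltrD2r; case: ifP => // _.
by rewrite -!EFinD; congr (_%:E); ring.
Qed.

(** Iterated products of the measure of the line. *)
Lemma lebesgue_like_exists n : exists mu : {measure set (borelRV (R := R) n) -> \bar R},
  lebesgue_like mu.
Proof.
elim: n => [|n [mu [sf ti bl]]].
  pose z0 : borelRV 0 := (0 : 'rV[R]_0)%R.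
  exists (dirac z0 : {measure set (borelRV 0) -> \bar R}).
  have b r : (0 < r)%R -> 0 < (dirac z0 (ball0 r) : \bar R) < +oo.
    by move=> r0; rewrite diracE mem_set ?lte01 ?ltey//; exact: ballxx.
  split => //; first by apply: balls_sigma_finite => r /b /andP[].
  move=> a A mA; rewrite (_ : _ @^-1` A = A)//.
  by apply/seteqP; split => x /=; rewrite (rV0_eq (x + a)%R x).
pose mu' : {sigma_finite_measure set (borelRV n) -> \bar R} := as_sigma_finite sf.
pose pm := (lebesgue_measure \x mu').
pose F (z : measurableTypeR R * borelRV (R := R) n) : borelRV (R := R) n.+1 :=
  row_mx (z.1)%:M (z.2 : 'rV[R]_n) : 'rV[R]_(1 + n).
have FL t x : (F (t, x) : 'rV[R]_(1 + n)) ord0 (lshift n ord0) = t.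
  by rewrite /F row_mxEl mxE eqxx mulr1n.
have FR t (x : 'rV[R]_n) i : (F (t, x) : 'rV[R]_(1 + n)) ord0 (rshift 1 i) = x ord0 i.
  by rewrite /F row_mxEr.
have mF : measurable_fun setT F.
  apply: (@measurable_borelRV R _ _ n.+1) => i; rewrite /F.
  under eq_fun do rewrite mxE.
  case: (fintype.split (i : 'I_(1 + n))) => e.
    under eq_fun do rewrite mxE ord1 eqxx mulr1n.
    exact: measurable_fst.
  apply: (measurableT_comp (f := fun x : borelRV n => (x : 'rV[R]_n) 0%R e)).
    exact: measurable_coord.
  exact: measurable_snd.
pose nu : {measure set (borelRV (R := R) n.+1) -> \bar R} :=
  measure_function_pushforward__canonical__measure_function_Measure pm mF.
have bl' r : (0 < r)%R -> 0 < nu (ball0 r) < +oo.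
  move=> r0; rewrite /nu/= /pushforward.
  rewrite (_ : F @^-1` _ = ball (0 : R)%R r `*` ball0 r).
    have mb : measurable (ball (0 : R)%R r : set (measurableTypeR R)).
      by rewrite ball_itv; exact: measurable_itv.
    rewrite /pm product_measure1E//; last exact: measurable_ballRV.
    have [b1 b2] := andP (bl r r0).
    change (0 < lebesgue_measure (ball (0 : R)%R r) * mu (ball0 r) < +oo).
    rewrite (lebesgue_measure_ball 0 (ltW r0)); apply/andP; split.
      by rewrite mule_gt0// lte_fin mulrn_wgt0.
    by rewrite lte_mul_pinfty// ?lee_fin ?mulrn_wge0 ?ltW.
  apply/seteqP; split => -[t x] /=.
    move=> /(ball_rVE _ _ r0) h; split.
      by rewrite -(FL t x); have := h (@lshift 1 n ord0); rewrite [X in ball X]mxE.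
    apply/(ball_rVE _ _ r0) => i; have := h (rshift 1 i : 'I_(1 + n)%N).
    by rewrite -(FR t x) mxE [X in _ -> ball X _ _]mxE.
  move=> [h1 /(ball_rVE _ _ r0) h2]; apply/(ball_rVE _ _ r0) => i.
  rewrite /F !mxE; case: splitP => e _; first by rewrite !mxE ord1 eqxx mulr1n.
  by have := h2 e; rewrite mxE.
exists nu; split => //; first by apply: balls_sigma_finite => r /bl' /andP[].
move=> a A mA; rewrite /nu/= /pushforward.
pose al := lsubmx (a : 'rV[R]_(1 + n)) 0%R 0%R; pose be := rsubmx (a : 'rV[R]_(1 + n)).
have mE : measurable (F @^-1` A) by rewrite -[X in measurable X]setTI; exact (mF measurableT _ mA).
set E := F @^-1` A in mE *.
have -> : F @^-1` ((fun x : 'rV[R]_n.+1 => (x + a)%R) @^-1` A) =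
    [set z | E ((z.1 + al)%R, ((z.2 : 'rV[R]_n) + be)%R)].
  by apply/funext => -[t x]; congr (A _); exact: row_mx_translate.
transitivity (\int[lebesgue_measure]_t mu (xsection E (t + al)%R)).
  rewrite /pm /product_measure1; apply: eq_integral => t _ /=.
  rewrite -(ti be (xsection E (t + al)%R)); last exact: measurable_xsection.
  congr (mu _); apply/seteqP; split => x; by rewrite /xsection /= !inE.
have mh : measurable_fun setT (fun t : measurableTypeR R => mu (xsection E t)).
  exact: (@measurable_fun_xsection _ _ _ _ _ mu').
have mf : measurable_fun setT (fun t : measurableTypeR R => (t + al)%R : measurableTypeR R).
  by apply: measurable_funD => //; exact: measurable_cst.
have := @ge0_integral_pushforward _ _ _ _ R _ mf lebesgue_measure setT _ measurableT mh.
rewrite preimage_setT => <-; last by move=> *; exact: measure_ge0.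
rewrite /pm /product_measure1; apply: eq_measure_integral => X mX _.
exact: lebesgue_translation.
Qed.

End LebesgueRV.

Section Rotations.
Context {R : realType} (n : nat) (mu : {measure set (borelRV (R := R) n) -> \bar R}).
Hypothesis lmu : lebesgue_like mu.

Lemma continuous_dot : continuous (fun x : 'rV[R]_n => dot x x).
Proof.
have -> : (fun x : 'rV[R]_n => dot x x) = fun x => \sum_i x 0 i * x 0 i.
  by apply/funext => x; rewrite dotE.
elim: (index_enum _) => [|i s IH] x.
  under eq_fun do rewrite big_nil; exact: cst_continuous.
have -> : (fun y : 'rV[R]_n => \sum_(j <- i :: s) y 0 j * y 0 j) =
    fun y => y 0 i * y 0 i + \sum_(j <- s) y 0 j * y 0 j.
  by apply/funext => y; rewrite big_cons.
have ci : (fun y : 'rV[R]_n => y 0 i) @ x --> x 0 i by exact: coord_continuous.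
have c1 : (fun y : 'rV[R]_n => y 0 i * y 0 i) @ x --> x 0 i * x 0 i by exact (cvgM ci ci).
exact (cvgD c1 (IH x)).
Qed.

Lemma dot_mulmx_orth (g : 'M[R]_n) (x y : 'rV[R]_n) : g *m g^T = 1%:M ->
  dot (x *m g) (y *m g) = dot x y.
Proof. by move=> gg; rewrite /dot trmx_mul mulmxA -(mulmxA x) gg mulmx1. Qed.

Local Open Scope ereal_scope.

Definition shell (a b : R) : set (borelRV (R := R) n) :=
  [set x : 'rV[R]_n | (a < dot x x < b)%R].

Lemma shell_open a b : open (shell a b : set 'rV[R]_n).
Proof.
rewrite (_ : shell a b = (fun x : 'rV[R]_n => dot x x) @^-1` `]a, b[%classic).
  by move/continuousP: continuous_dot; apply; exact: itv_open.
by apply/seteqP; split => x /=; rewrite in_itv.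
Qed.

Lemma measurable_shell a b : measurable (shell a b).
Proof. by apply: sub_sigma_algebra; exact: shell_open. Qed.

Lemma shell_ltoo a b : mu (shell a b) < +oo.
Proof.
have [_ _ bl] := lmu; have b1 : (0 < Num.max 1 b + 1 :> R)%R.
  by rewrite ltr_wpDl// le_max ler01.
have [_] := andP (bl _ b1); apply: le_lt_trans; apply: le_measure.
- by apply/mem_set; exact: measurable_shell.
- by apply/mem_set; exact: measurable_ballRV.
move=> x /andP[_ xb]; apply/ball_rVE => // i; rewrite mxE /ball/= sub0r normrN.
have : (x 0 i ^+ 2 <= dot x x)%R.
  by rewrite dotE (bigD1 i)//= -expr2 lerDl sumr_ge0// => j _; rewrite -expr2 sqr_ge0.
move=> h; rewrite ltNge; apply/negP => h2.
have h3 : (`|x ord0 i| ^+ 2 < b)%R by rewrite real_normK ?num_real//; apply: le_lt_trans xb.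
have m1 : (1 <= Num.max 1 b)%R by rewrite le_max lexx.
have m2 : (b <= Num.max 1 b)%R by rewrite le_max lexx orbT.
by move: (Num.max 1%R b) m1 m2 h2 => M m1 m2 h2; nra.
Qed.

(** An open set contains the translate of a ball. *)
Lemma open_gt0 (U : set 'rV[R]_n) : open U -> U !=set0 ->
  0 < mu (U : set (borelRV n)).
Proof.
move=> oU [x Ux]; have [_ ti bl] := lmu.
have := open_nbhs_nbhs (conj oU Ux); rewrite -nbhs_ballE => -[e /= e0 xe].
have [b0 _] := andP (bl e e0); apply: (lt_le_trans b0).
rewrite -(ti (- x)%R); last exact: measurable_ballRV.
apply: le_measure.
- apply/mem_set; rewrite (_ : _ @^-1` _ = ball x e); first exact: measurable_ballRV.
  apply/seteqP; split => y /=.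
    move=> /(ball_rVE _ _ e0) h; apply/(ball_rVE _ _ e0) => i; have := h i.
    by rewrite !mxE /ball/= sub0r opprD opprK addrC.
  move=> /(ball_rVE _ _ e0) h; apply/(ball_rVE _ _ e0) => i; have := h i.
  by rewrite !mxE /ball/= sub0r opprD opprK [in X in _ -> X]addrC.
- by apply/mem_set; exact: sub_sigma_algebra.
move=> y /(ball_rVE _ _ e0) h; apply: xe; apply/(ball_rVE _ _ e0) => i; have := h i.
by rewrite !mxE /ball/= sub0r opprD opprK addrC.
Qed.

Lemma sections_exchange (E : set (borelRV (R := R) n * borelRV (R := R) n)) : measurable E ->
  \int[mu]_x mu (xsection E x) = \int[mu]_y mu (ysection E y).
Proof.
have [sf _ _] := lmu; move=> mE.
have := @product_measure_unique _ _ _ _ R (as_sigma_finite sf) (as_sigma_finite sf)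
  (as_sigma_finite sf \x^ as_sigma_finite sf) _ E mE.
by apply=> *; exact: product_measure2E.
Qed.

(** Let D be the unit ball.  The pairs (x, y) with x + y g in A and y in D form a
    set of measure mu A * mu D; the translation y |-> y - x g^-1 on every
    slice turns it into the pairs with y g in A and y - x g^-1 in D, whose
    measure is mu D times that of the preimage of A, as D is invariant. *)
Lemma rotation_invariant (g : 'M[R]_n) (A : set (borelRV n)) : g *m g^T = 1%:M ->
  measurable A -> mu ((fun x : 'rV[R]_n => x *m g) @^-1` A) = mu A.
Proof.
move=> gg mA; have [_ ti _] := lmu; pose D := shell (-1) 1.
have mD : measurable D by exact: measurable_shell.
have mg := measurable_mulmx g.
have mgA : measurable ((fun x : 'rV[R]_n => x *m g) @^-1` A : set (borelRV n)).
  by rewrite -[X in measurable X]setTI; exact (mg measurableT _ mA).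
have gg' : g^T *m g = 1%:M by apply: mulmx1C.
pose E1 : set (borelRV (R := R) n * borelRV (R := R) n) :=
  [set z | A ((z.1 : 'rV[R]_n) + (z.2 : 'rV[R]_n) *m g)%R /\ D z.2].
pose E2 : set (borelRV (R := R) n * borelRV (R := R) n) :=
  [set z | A ((z.2 : 'rV[R]_n) *m g) /\ D ((z.2 : 'rV[R]_n) - (z.1 : 'rV[R]_n) *m g^T)%R].
have mfst i : measurable_fun setT (fun z : borelRV (R := R) n * borelRV (R := R) n => (z.1 : 'rV[R]_n) ord0 i).
  apply: (measurableT_comp (f := fun x : borelRV n => (x : 'rV[R]_n) ord0 i)).
    exact: measurable_coord.
  exact: measurable_fst.
have msnd i : measurable_fun setT (fun z : borelRV (R := R) n * borelRV (R := R) n => (z.2 : 'rV[R]_n) ord0 i).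
  apply: (measurableT_comp (f := fun x : borelRV n => (x : 'rV[R]_n) ord0 i)).
    exact: measurable_coord.
  exact: measurable_snd.
have mE1 : measurable E1.
  have m1 : measurable_fun setT (fun z : borelRV (R := R) n * borelRV (R := R) n =>
      ((z.1 : 'rV[R]_n) + (z.2 : 'rV[R]_n) *m g)%R : borelRV n).
    apply: measurable_borelRV => i.
    rewrite (_ : (fun _ => _) = (fun z : borelRV (R := R) n * borelRV (R := R) n =>
      (z.1 : 'rV[R]_n) ord0 i + \sum_j (z.2 : 'rV[R]_n) ord0 j * g j i)%R); last first.
      by apply/funext => z; rewrite !mxE.
    apply: measurable_funD => //; apply: measurable_sum => j.
    by apply: measurable_funM => //; exact: measurable_cst.
  have -> : E1 = (fun z : borelRV (R := R) n * borelRV (R := R) n =>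
      ((z.1 : 'rV[R]_n) + (z.2 : 'rV[R]_n) *m g)%R : borelRV n) @^-1` A `&` snd @^-1` D by [].
  apply: measurableI.
    by rewrite -[X in measurable X]setTI; exact (m1 measurableT _ mA).
  by rewrite -[X in measurable X]setTI; exact (measurable_snd measurableT _ mD).
have mE2 : measurable E2.
  have m1 : measurable_fun setT (fun z : borelRV (R := R) n * borelRV (R := R) n =>
      ((z.2 : 'rV[R]_n) - (z.1 : 'rV[R]_n) *m g^T)%R : borelRV n).
    apply: measurable_borelRV => i.
    rewrite (_ : (fun _ => _) = (fun z : borelRV (R := R) n * borelRV (R := R) n =>
      (z.2 : 'rV[R]_n) ord0 i - \sum_j (z.1 : 'rV[R]_n) ord0 j * g i j)%R); last first.
      apply/funext => z; rewrite !mxE; congr (_ - _)%R.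
      by apply: eq_bigr => j _; rewrite mxE.
    apply: measurable_funB => //; apply: measurable_sum => j.
    by apply: measurable_funM => //; exact: measurable_cst.
  have -> : E2 = snd @^-1` ((fun x : 'rV[R]_n => x *m g) @^-1` A) `&`
     (fun z : borelRV (R := R) n * borelRV (R := R) n =>
      ((z.2 : 'rV[R]_n) - (z.1 : 'rV[R]_n) *m g^T)%R : borelRV n) @^-1` D by [].
  apply: measurableI.
    by rewrite -[X in measurable X]setTI; exact (measurable_snd measurableT _ mgA).
  by rewrite -[X in measurable X]setTI; exact (m1 measurableT _ mD).
have I1 : \int[mu]_y mu (ysection E1 y) = mu A * mu D.
  rewrite (eq_integral (fun y => mu A * (\1_D y)%:E)); last first.
    move=> y _; rewrite indicE; have [yD|yD] := boolP (y \in D).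
      rewrite mule1 -(ti (y *m g)%R A mA); congr (mu _).
      apply/seteqP; split => x; rewrite ysectionE /=; first by case.
      by split => //; exact: (set_mem yD).
    rewrite mule0 (_ : ysection E1 y = set0) ?measure0//.
    apply/seteqP; split => x //; rewrite ysectionE /= => -[_].
    by move: yD; rewrite notin_setE.
  rewrite ge0_integralZl ?integral_indic ?setIT//; exact: measurableT_comp.
have I2 : \int[mu]_y mu (ysection E2 y) = mu D * mu ((fun x : 'rV[R]_n => x *m g) @^-1` A).
  rewrite (eq_integral (fun y => mu D * (\1_((fun x : 'rV[R]_n => x *m g) @^-1` A : set (borelRV n)) y)%:E)); last first.
    move=> y _; rewrite indicE; have [yD|yD] := boolP (y \in _).
      rewrite mule1 -(ti (- (y *m g))%R D mD); congr (mu _).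
      have dE (x : 'rV[R]_n) : dot (y - x *m g^T)%R (y - x *m g^T)%R =
          dot (x + - (y *m g))%R (x + - (y *m g))%R.
        rewrite -(dot_mulmx_orth _ _ gg) mulmxBl -(mulmxA x) gg' mulmx1.
        by rewrite -[RHS]opprK -dotNl -dotNr !opprD !opprK addrC.
      apply/seteqP; split => x; rewrite ysectionE /=.
        by case=> _; rewrite /D /shell /= dE.
      by rewrite /D /shell /= -dE => h; split => //; exact: (set_mem yD).
    rewrite mule0 (_ : ysection E2 y = set0) ?measure0//.
    apply/seteqP; split => x //; rewrite ysectionE /= => -[h _].
    by move: yD; rewrite notin_setE.
  rewrite ge0_integralZl ?integral_indic ?setIT//; exact: measurableT_comp.
have I12 : \int[mu]_x mu (xsection E1 x) = \int[mu]_x mu (xsection E2 x).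
  apply: eq_integral => x _.
  rewrite -(ti (- (x *m g^T))%R (xsection E1 x)); last exact: measurable_xsection.
  congr (mu _); apply/seteqP; split => y; rewrite !xsectionE /=.
    by rewrite /E1 /E2 /= mulmxDl mulNmx -(mulmxA x) gg' mulmx1 addrCA subrr addr0.
  by rewrite /E1 /E2 /= mulmxDl mulNmx -(mulmxA x) gg' mulmx1 addrCA subrr addr0.
have D0 : 0 < mu D.
  apply: open_gt0; first exact: shell_open.
  by exists 0%R; rewrite /D /shell /= dot0l oppr_lt0 ltr01.
have Dfin : mu D \is a fin_num by rewrite ge0_fin_numE ?shell_ltoo.
have := sections_exchange mE1; rewrite I1 I12 sections_exchange// I2.
rewrite [LHS]muleC -(fineK Dfin) => /(congr1 (fun z => z * (fine (mu D))^-1%:E)).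
rewrite -!muleA -EFinM divff ?mule1//.
by rewrite fine_eq0// gt_eqF.
Qed.

End Rotations.

Section SphereMeasure.
Context {R : realType}.
Local Open Scope ereal_scope.

(** The radial projection: the scalar is r / |x|. *)
Definition radial n (r : R) (x : 'rV[R]_n) : 'rV[R]_n :=
  (r * (dot x x) `^ (- 2^-1))%R *: x.

Lemma measurable_radial n r : measurable_fun setT (radial r : borelRV (R := R) n -> borelRV n).
Proof.
apply: measurable_borelRV => i.
rewrite (_ : (fun _ => _) = (fun x : borelRV n =>
  r * (dot (x : 'rV[R]_n) x) `^ (- 2^-1) * (x : 'rV[R]_n) ord0 i)%R); last first.
  by apply/funext => x; rewrite mxE.
apply: measurable_funM; last exact: measurable_coord.
apply: measurable_funM; first exact: measurable_cst.
apply: (measurableT_comp (f := fun t : R => t `^ (- 2^-1))%R).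
  exact: measurable_powR.
exact: measurable_dot.
Qed.

Lemma dot_radial n r (x : 'rV[R]_n) : (0 < dot x x)%R ->
  (dot (radial r x) (radial r x) = r ^+ 2)%R.
Proof.
move=> x0; rewrite /radial dotZl dotZr powRN powR12_sqrt ?ltW//.
rewrite -{3}(sqr_sqrtr (ltW x0)).
have s0 : (Num.sqrt (dot x x) != 0)%R by rewrite sqrtr_eq0 -ltNge.
by field.
Qed.

Lemma radial_mulmx n r (g : 'M[R]_n) (x : 'rV[R]_n) : (g *m g^T = 1%:M)%R ->
  radial r (x *m g) = (radial r x *m g)%R.
Proof. by move=> gg; rewrite /radial (dot_mulmx_orth _ _ gg) scalemxAl. Qed.

Lemma measurable_sphere n (r : R) : measurable (sphere r : set (borelRV (R := R) n)).
Proof.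
have := @measurable_dot R n measurableT [set (r ^+ 2)%R] (measurable_set1 _).
by rewrite setTI.
Qed.

(** Push the measure of the punctured unit ball, normalised, along the radial
    projection, which commutes with rotations. *)
Lemma sphere_measure_exists n (r : R) : (0 < r)%R -> (0 < n)%N ->
  exists mu : probability (borelRV (R := R) n) R, is_sphere_measure r mu.
Proof.
move=> r0 n0; have [lam llam] := @lebesgue_like_exists R n.
have mD := @measurable_shell R n 0 1.
pose D := @shell R n 0 1.
have D0 : 0 < lam D.
  apply: open_gt0 => //; first exact: shell_open.
  exists (2^-1 *: delta_mx ord0 (Ordinal n0))%R; rewrite /D /shell /= dotZl dotZr.
  have -> : dot (delta_mx ord0 (Ordinal n0)) (delta_mx ord0 (Ordinal n0)) = 1%R :> R.
    rewrite dotE (bigD1 (Ordinal n0))//= !mxE !eqxx mulr1 big1 ?addr0// => l lk.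
    by rewrite mxE eqxx (negPf lk) mulr0.
  by rewrite mulr1; lra.
have Doo : lam D < +oo by exact: shell_ltoo.
pose z0 : borelRV (R := R) n := (0%R : 'rV[R]_n).
pose P0 : probability (borelRV n) R := dirac z0.
pose res : {measure set (borelRV n) -> \bar R} := mrestr lam mD.
pose pr : probability (borelRV n) R := mnormalize res P0.
pose f : {mfun borelRV (R := R) n >-> borelRV (R := R) n} :=
  HB.pack (radial r : borelRV (R := R) n -> borelRV n)
   (isMeasurableFun.Build _ _ _ _ _ (@measurable_radial n r)).
pose mu : probability (borelRV (R := R) n) R := distribution pr f.
exists mu; have resT : res setT = lam D by rewrite /res /= /mrestr setTI.
have prE A : pr A = lam (A `&` D) * (fine (lam D))^-1%:E.
  by rewrite /pr /= /mnormalize resT gt_eqF//= lt_eqF.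
have Dfin : lam D \is a fin_num by rewrite ge0_fin_numE.
split.
  rewrite /mu /= /distribution /pushforward prE (_ : _ `&` D = D).
    by rewrite -{1}(fineK Dfin) -EFinM divff// fine_eq0// gt_eqF.
  apply/seteqP; split => x; first by case.
  by move=> Dx; split => //; rewrite /sphere /=; apply: dot_radial; case/andP: Dx.
move=> g gg A mA; rewrite /mu /= /distribution /pushforward !prE; congr (_ * _).
have mB : measurable ((f : _ -> _) @^-1` A `&` D).
  apply: measurableI => //; rewrite -[X in measurable X]setTI.
  exact (@measurable_radial n r measurableT _ mA).
rewrite -(rotation_invariant llam gg mB); congr (lam _).
apply/seteqP; split => x /=; rewrite /D /shell /= radial_mulmx// dot_mulmx_orth//.
Qed.

End SphereMeasure.

(* The names of mpoly, such as that of its structure of measures, would hide the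
   ones used above, and its notations clash. *)
From mathcomp Require Import -(notations) mpoly.

(** * Spherical 2-designs and second moments *)

Section SphereMoments.
Context {R : realType} (n : nat) (r : R) (mu : probability (borelRV (R := R) n) R).
Hypothesis (r0 : 0 < r) (sm : is_sphere_measure r mu).

Local Notation S := (sphere r : set (borelRV n)).

Let mS : measurable S := @measurable_sphere R n r.

Let mS1 : (mu S = 1)%E. Proof. by case: sm. Qed.

Lemma sphere_coord_le (x : 'rV[R]_n) i : sphere r x -> `|x 0 i| <= r.
Proof.
move=> xS; have : x 0 i ^+ 2 <= r ^+ 2.
  rewrite -xS dotE (bigD1 i)//= -expr2 lerDl sumr_ge0// => j _.
  by rewrite -expr2 sqr_ge0.
by rewrite -real_normK ?num_real// ler_sqr ?nnegrE// ltW.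
Qed.

Lemma sphere_integrable (f : borelRV (R := R) n -> R) (c : R) :
  measurable_fun setT f -> (forall x, S x -> `|f x| <= c) ->
  mu.-integrable S (EFin \o f).
Proof.
move=> mf fc; apply: measurable_bounded_integrable => //.
- by rewrite [X in (X < _)%E]mS1 ltry.
- exact: measurable_funTS.
exists c; split; first exact: num_real.
by move=> d cd x Sx; exact: (le_trans (fc x Sx) (ltW cd)).
Qed.

Lemma sphere_integral_rotate (g : 'M[R]_n) (f : borelRV (R := R) n -> R) (c : R) :
  g *m g^T = 1%:M -> measurable_fun setT f -> (forall x, S x -> `|f x| <= c) ->
  (\int[mu]_(x in S) (f ((x : 'rV[R]_n) *m g))%:E = \int[mu]_(x in S) (f x)%:E)%E.
Proof.
move=> gg mf fc; have mg := @measurable_mulmx R n g.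
have Sg : (fun x : 'rV[R]_n => x *m g) @^-1` S = S.
  by apply/seteqP; split => x; rewrite /sphere /= dot_mulmx_orth.
have mfE : measurable_fun setT (EFin \o f) by exact/measurable_EFinP.
have int' : mu.-integrable ((fun x : 'rV[R]_n => x *m g : borelRV n) @^-1` S)
    ((EFin \o f) \o (fun x : 'rV[R]_n => x *m g : borelRV n)).
  rewrite Sg; apply: (@sphere_integrable _ c).
    exact: measurableT_comp mf mg.
  by move=> x Sx; apply: fc; rewrite /sphere /= dot_mulmx_orth.
have := integral_pushforward mg mfE int' mS.
rewrite Sg => <-; apply: eq_measure_integral => A mA _.
by have [_ h] := sm; exact (h g gg A mA).
Qed.

Lemma measurable_coord2 (a b : 'I_n) :
  measurable_fun setT (fun x : borelRV (R := R) n => (x : 'rV[R]_n) 0 a * (x : 'rV[R]_n) 0 b).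
Proof. by apply: measurable_funM; exact: measurable_coord. Qed.

Lemma coord2_le (a b : 'I_n) x : S x -> `|x 0 a * x 0 b| <= r * r.
Proof. by move=> Sx; rewrite normrM ler_pM// sphere_coord_le. Qed.

Let refl (a : 'I_n) : 'M[R]_n := diag_mx (\row_k (if k == a then -1 else 1)).

Lemma refl_orth a : refl a *m (refl a)^T = 1%:M.
Proof.
rewrite tr_diag_mx mulmx_diag -diag_const_mx; congr diag_mx.
by apply/rowP => k; rewrite !mxE; case: eqP; rewrite ?mulrNN mulr1.
Qed.

Lemma reflE a (x : 'rV[R]_n) k : (x *m refl a) 0 k = (if k == a then - x 0 k else x 0 k).
Proof. by rewrite mul_mx_diag !mxE; case: ifP; rewrite ?mulrN mulr1. Qed.

(** Reflections in coordinate hyperplanes kill odd functions. *)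
Lemma odd_integral0 (f : borelRV (R := R) n -> R) (c : R) a :
  measurable_fun setT f -> (forall x, S x -> `|f x| <= c) ->
  (forall x : 'rV[R]_n, f (x *m refl a) = - f x) ->
  (\int[mu]_(x in S) (f x)%:E = 0)%E.
Proof.
move=> mf fc fN; have If := sphere_integrable mf fc.
have Ifin := integrable_fin_num mS If.
have := sphere_integral_rotate (refl_orth a) mf fc.
rewrite (eq_integral (fun x => - (f x)%:E))%E; last by move=> x _; rewrite fN.
rewrite integralN; last by apply: integrable_add_def.
move: Ifin; set I := integral _ _ _ => Ifin.
rewrite -(fineK Ifin) => -[e]; congr (_%:E); lra.
Qed.

Lemma sphere_moment1 a : (\int[mu]_(x in S) ((x : 'rV[R]_n) 0 a)%:E = 0)%E.
Proof.
apply: (@odd_integral0 (fun x : borelRV n => (x : 'rV[R]_n) 0 a) r a).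
- exact: measurable_coord.
- by move=> x; exact: sphere_coord_le.
- by move=> x; rewrite reflE eqxx.
Qed.

Lemma sphere_moment2_off a b : a != b ->
  (\int[mu]_(x in S) ((x : 'rV[R]_n) 0 a * (x : 'rV[R]_n) 0 b)%:E = 0)%E.
Proof.
move=> ab; apply: (@odd_integral0 (fun x : borelRV n => (x : 'rV[R]_n) 0 a * (x : 'rV[R]_n) 0 b) (r * r) a).
- exact: measurable_coord2.
- by move=> x; exact: coord2_le.
- by move=> x; rewrite !reflE eqxx eq_sym (negPf ab) mulNr.
Qed.

Lemma sphere_moment2_diag_eq a b :
  (\int[mu]_(x in S) ((x : 'rV[R]_n) 0 a * (x : 'rV[R]_n) 0 a)%:E =
   \int[mu]_(x in S) ((x : 'rV[R]_n) 0 b * (x : 'rV[R]_n) 0 b)%:E)%E.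
Proof.
have gg : (tperm_mx a b : 'M[R]_n) *m (tperm_mx a b)^T = 1%:M.
  by rewrite tr_tperm_mx -perm_mxM tperm2 perm_mx1.
rewrite -(sphere_integral_rotate gg (@measurable_coord2 a a) (@coord2_le a a)).
apply: eq_integral => x _; rewrite -xcolE !mxE.
by rewrite tpermL.
Qed.

(** The diagonal moments agree and add up to r ^+ 2. *)
Lemma sphere_moment2 a b :
  (\int[mu]_(x in S) ((x : 'rV[R]_n) 0 a * (x : 'rV[R]_n) 0 b)%:E =
   ((a == b)%:R * (r ^+ 2 / n%:R))%:E)%E.
Proof.
case: eqP => [<-|/eqP ab]; last by rewrite mul0r sphere_moment2_off.
rewrite mul1r; have IE c := sphere_integrable (@measurable_coord2 c c) (@coord2_le c c).
set I := (LHS); have Ifin : I \is a fin_num.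
  exact (integrable_fin_num mS (IE a)).
have h : (\int[mu]_(x in S) (\sum_(c < n) ((x : 'rV[R]_n) 0 c * (x : 'rV[R]_n) 0 c)%:E) = (r ^+ 2)%:E)%E.
  rewrite (eq_integral (fun=> (r ^+ 2)%:E)); last first.
    by move=> x /set_mem xS; rewrite sumEFin -dotE xS.
  rewrite integral_cst; last exact: mS.
  by rewrite [X in (_ * X)%E]mS1 mule1.
rewrite integral_sum// in h.
rewrite (eq_bigr (fun=> I)) in h; last by move=> c _; exact: sphere_moment2_diag_eq.
have n0 : n%:R != 0 :> R by rewrite pnatr_eq0 -lt0n (leq_ltn_trans (leq0n a) (ltn_ord a)).
move: h; rewrite -(fineK Ifin) sumEFin => -[]; rewrite sumr_const card_ord => h.
by congr (_%:E); rewrite -h -(mulr_natr (fine I) n) mulfK.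
Qed.

End SphereMoments.

Section Designs.
Context {R : realType} (n : nat).
Implicit Types X : set 'rV[R]_n.

Let mono (x : 'rV[R]_n) (m : multinom n) : R := \prod_i x 0 i ^+ m i.

Let monoU x a : mono x (mnm1 a) = x 0 a.
Proof. by rewrite -(mevalXU (fun i => x 0 i)) mevalX. Qed.

Let monoD x m1 m2 : mono x (mnm_add m1 m2) = mono x m1 * mono x m2.
Proof. by rewrite -big_split; apply: eq_bigr => i _; rewrite mnmDE exprD. Qed.

Lemma multinom_le2 (m : multinom n) : (mdeg m <= 2)%N ->
  [\/ m = mnm0, exists a, m = mnm1 a | exists a b, m = mnm_add (mnm1 a) (mnm1 b)].
Proof.
rewrite leq_eqVlt ltnS leq_eqVlt ltnS leqn0 => /or3P[/eqP m2|/mdeg1P[a /eqP ->]|].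
- have /existsP[a a0] : [exists a, m a != 0%N].
    apply: contra_eqT m2; rewrite negb_exists => /forallP h.
    rewrite (_ : m = mnm0) ?mdeg0//; apply/mnmP => a; rewrite mnm0E.
    by have := h a; rewrite negbK => /eqP.
  have am : lem (mnm1 a) m.
    by apply/mnm_lepP => e; rewrite mnm1E; case: eqP => // <-; rewrite lt0n.
  have := mdegD (mnm_sub m (mnm1 a)) (mnm1 a).
  rewrite submK// m2 mdeg1 addn1 => -[/esym/eqP/mdeg1P[b /eqP e]].
  by apply: Or33; exists b, a; rewrite -e submK.
- by apply: Or32; exists a.
- by rewrite mdeg_eq0 => /eqP ->; apply: Or31.
Qed.

Lemma design_moments X (a b : 'I_n) : spherical_design 2 X -> a != b ->
  \sum_(x <- fset_set X) x 0 a * x 0 b = 0 /\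
  \sum_(x <- fset_set X) x 0 a * x 0 a = \sum_(x <- fset_set X) x 0 b * x 0 b.
Proof.
move=> [fX X0 [r [r0 XS [mu [sm H]]]]] ab.
have card0 : (#|` fset_set X|%:R : R) != 0.
  rewrite pnatr_eq0 cardfs_eq0; apply/eqP => h; case: X0 => x Xx.
  by have : x \in fset_set X by [rewrite in_fset_set// mem_set]; rewrite h.
have sum0 (c e : 'I_n) (I : R) :
    (\int[mu]_(x in sphere r) ((x : 'rV[R]_n) 0 c * (x : 'rV[R]_n) 0 e)%:E = I%:E)%E ->
    \sum_(x <- fset_set X) x 0 c * x 0 e = #|` fset_set X|%:R * I.
  move=> hI; pose f := mpolyX R (mnm_add (mnm1 c) (mnm1 e)).
  have fE x : poly_eval f x = x 0 c * x 0 e.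
    by rewrite /poly_eval mevalX -/(mono x _) monoD !monoU.
  have hf : f \is ishomog1 2 mdeg by rewrite dhomogX /= mdegD !mdeg1.
  have := H 2%N f (leqnn 2) hf.
  under eq_integral do rewrite fE; rewrite hI => -[->].
  rewrite mulVKf// fsbig_finite//; by apply: eq_bigr => x _; rewrite fE.
have m2 := sphere_moment2 r0 sm; split.
  by rewrite (sum0 _ _ _ (m2 a b)) (negPf ab) mul0r mulr0.
by rewrite (sum0 _ _ _ (m2 a a)) (sum0 _ _ _ (m2 b b)) !eqxx.
Qed.

(** Averages over X and over the sphere agree on the monomials of degree at most
    2: those of degree 1 have mean 0 by symmetry, the mixed ones by hypothesis,
    and the squares all have the mean r ^+ 2 / n. *)
Lemma moments_design X (r : R) : finite_set X -> X !=set0 -> 0 < r ->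
  X `<=` sphere r -> (0 < n)%N -> (forall x, X x -> X (- x)) ->
  (forall a b : 'I_n, a != b ->
    \sum_(x <- fset_set X) x 0 a * x 0 b = 0 /\
    \sum_(x <- fset_set X) x 0 a * x 0 a = \sum_(x <- fset_set X) x 0 b * x 0 b) ->
  spherical_design 2 X.
Proof.
move=> fX X0 r0 XS n0 XN HX; split => //; exists r; split => //.
have [mu sm] := sphere_measure_exists r0 n0; exists mu; split => //.
have card0 : (#|` fset_set X|%:R : R) != 0.
  rewrite pnatr_eq0 cardfs_eq0; apply/eqP => h; case: X0 => x Xx.
  by have : x \in fset_set X by [rewrite in_fset_set// mem_set]; rewrite h.
set N := #|` fset_set X| in card0 *.
have XE x : x \in fset_set X -> X x by rewrite in_fset_set// => /set_mem.
pose avg (f : 'rV[R]_n -> R) := N%:R^-1 * \sum_(x <- fset_set X) f x.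
pose good (f : 'rV[R]_n -> R) := mu.-integrable (sphere r) (EFin \o f) /\
  (\int[mu]_(x in sphere r) (f x)%:E = (avg f)%:E)%E.
have mS := @measurable_sphere R n r.
have mS1 : mu (sphere r : set (borelRV n)) = 1%E by case: sm.
have goodM m : (mdeg m <= 2)%N -> good (fun x => mono x m).
  move=> /multinom_le2[->|[a ->]|[a [b ->]]].
  - have -> : (fun x => mono x mnm0) = cst 1.
      by apply/funext => x; rewrite /mono big1// => i _; rewrite mnm0E expr0.
    split.
      apply: (sphere_integrable sm (c := 1)); first exact: measurable_cst.
      by move=> x _; rewrite normr1.
    rewrite (eq_integral (fun=> 1%E))// integral_cst// [X in (_ * X)%E]mS1.
    by rewrite mule1 /avg big_const_seq count_predT iter_addr_0 -/N mulVf.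
  - have -> : (fun x => mono x (mnm1 a)) = (fun x : 'rV[R]_n => x 0 a).
      by apply/funext => x; rewrite monoU.
    split.
      apply: (sphere_integrable sm (c := r)); first exact: measurable_coord.
      by move=> x; exact: sphere_coord_le.
    rewrite (sphere_moment1 r0 sm) /avg.
    have e : \sum_(x <- fset_set X) x 0 a = - \sum_(x <- fset_set X) x 0 a.
      have pe : perm_eq (fset_set X) [seq - x | x <- fset_set X].
        apply: uniq_perm; first exact: fset_uniq.
          by rewrite map_inj_uniq ?fset_uniq//; exact: oppr_inj.
        move=> x; apply/idP/mapP => [/XE /XN xX|[y /XE /XN yX ->]].
          by exists (- x); rewrite ?opprK// in_fset_set// mem_set.
        by rewrite in_fset_set// mem_set.
      rewrite {1}(perm_big _ pe)/= big_map -sumrN; apply: eq_bigr => x _.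
      by rewrite mxE.
    by rewrite (_ : \sum_(x <- _) _ = 0) ?mulr0//; lra.
  have -> : (fun x => mono x (mnm_add (mnm1 a) (mnm1 b))) = (fun x : 'rV[R]_n => x 0 a * x 0 b).
    by apply/funext => x; rewrite monoD !monoU.
  split.
    apply: (sphere_integrable sm (c := r * r)); first exact: measurable_coord2.
    by move=> x; exact: coord2_le.
  rewrite (sphere_moment2 r0 sm) /avg; congr (_%:E).
  case: eqP => [<-|/eqP ab]; last by rewrite mul0r (HX a b ab).1 mulr0.
  have D c : \sum_(x <- fset_set X) x 0 c * x 0 c = \sum_(x <- fset_set X) x 0 a * x 0 a.
    by have [->//|ca] := eqVneq c a; rewrite (HX c a ca).2.
  have : \sum_(c < n) \sum_(x <- fset_set X) x 0 c * x 0 c = N%:R * r ^+ 2.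
    rewrite exchange_big/= big_seq (eq_bigr (fun=> r ^+ 2)).
      by rewrite -big_seq big_const_seq count_predT iter_addr_0 -/N mulr_natl.
    by move=> x /XE /XS xr; rewrite -dotE xr.
  rewrite (eq_bigr _ (fun c _ => D c)) sumr_const card_ord => h.
  have nn : n%:R != 0 :> R by rewrite pnatr_eq0 -lt0n.
  have -> : \sum_(x <- fset_set X) x 0 a * x 0 a = N%:R * r ^+ 2 / n%:R.
    by rewrite -h -(mulr_natr (\sum_(x <- _) _) n) mulfK.
  by rewrite mul1r -mulrA mulKf.
move=> j f j2 fj; rewrite fsbig_finite//.
have fm m : m \in msupp f -> (mdeg m <= 2)%N.
  by move: fj => /allP h /h /= /eqP ->.
have fE x : poly_eval f x = \sum_(m <- msupp f) mcoeff m f * mono x m.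
  by rewrite /poly_eval mevalE.
have goodZ c g : good g -> good (fun x => c * g x).
  move=> [ig Ig]; split.
    by apply: (eq_integrable mS (fun x => c%:E * (EFin \o g) x)%E); [|exact: integrableZl].
  under eq_integral do rewrite EFinM.
  by rewrite integralZl// Ig -EFinM /avg -mulr_sumr mulrCA.
have goodD g1 g2 : good g1 -> good g2 -> good (fun x => g1 x + g2 x).
  move=> [i1 I1] [i2 I2]; split.
    by apply: (eq_integrable mS ((EFin \o g1) \+ (EFin \o g2))%E); [|exact: integrableD].
  under eq_integral do rewrite EFinD.
  by rewrite integralD// I1 I2 -EFinD /avg big_split/= mulrDr.
have good0 : good (fun=> 0).
  split; first exact: integrable0.
  by rewrite integral0 /avg big1 ?mulr0.
have [_ ->] : good (poly_eval f); last by [].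
rewrite (_ : poly_eval f = fun x => \sum_(m <- msupp f) mcoeff m f * mono x m); last exact/funext.
elim: (msupp f) fm => [|m s IH] fm.
  by under eq_fun do rewrite big_nil.
under eq_fun do rewrite big_cons.
apply: goodD; first by apply/goodZ/goodM/fm; rewrite mem_head.
by apply: IH => m' m's; apply: fm; rewrite in_cons m's orbT.
Qed.

End Designs.

(** * Vanishing of modular forms *)

Section PowerSeries.
Context {R : realType}.
Local Notation C := R[i].

Lemma geometric_tail (x : R) e n : 0 < x -> x <= 2^-1 ->
  \sum_(e.+1 <= k < n) x ^+ k <= 2 * x ^+ e.+1.
Proof.
move=> x0 x1; have [ne|en] := leqP n e.+1.
  by rewrite big_geq// mulr_ge0 ?exprn_ge0// ltW.
suff h : \sum_(e.+1 <= k < n) x ^+ k <= 2 * x ^+ e.+1 - 2 * x ^+ n.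
  by apply: (le_trans h); rewrite gerBl mulr_ge0// exprn_ge0// ltW.
elim: n en => // n IH; rewrite ltnS leq_eqVlt => /predU1P[<-|en].
  rewrite big_nat1 (exprS x e.+1).
  by have := exprn_gt0 e.+1 x0; nra.
rewrite big_nat_recr/=; last exact: ltnW.
apply: (le_trans (lerD (IH en) (lexx _))); rewrite (exprS x n).
by have := exprn_gt0 n x0; nra.
Qed.

Lemma has_sum_near (u : nat -> C) e : has_sum u 0 -> 0 < e ->
  exists N, forall n, (N <= n)%N -> cabs (series u n) <= e.
Proof.
move=> /has_sumP h e0; have := cvgr_le (0 : R) h e e0 => -[N _ hN].
by exists N => n Nn; have := hN n Nn; rewrite /= subr0.
Qed.

Lemma seriesE (u : nat -> C) n : series u n = \sum_(0 <= k < n) u k.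
Proof. by []. Qed.

(** The first nonzero term would dominate the others near 0, since the terms at
    1 / 2 are bounded. *)
Lemma power_series_coef0 (c : nat -> C) :
  (forall x : R, 0 < x -> x < 1 -> has_sum (fun e => c e * x%:C ^+ e) 0) ->
  forall e, c e = 0.
Proof.
move=> H; elim/ltn_ind => e IH; apply/eqP; apply: contraT => ce.
pose x0 : R := 2^-1; have x00 : 0 < x0 by rewrite invr_gt0.
have x01 : x0 < 1 by rewrite invf_lt1// ltr1n.
pose u k := c k * x0%:C ^+ k.
have [M M0 uM] : exists2 M : R, 0 < M & forall k, cabs (u k) <= M.
  have [N hN] := has_sum_near (H x0 x00 x01) ltr01.
  exists (2 + \sum_(k < N) cabs (u k)).
    by rewrite ltr_wpDr// sumr_ge0// => k _; exact: cabs_ge0.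
  move=> k; have [Nk|kN] := leqP N k.
    have -> : u k = series u k.+1 - series u k.
      by rewrite !seriesE big_nat_recr//= addrAC subrr add0r.
    apply: (le_trans (cabsB _ _)); have := hN k Nk; have := hN k.+1 (leqW Nk).
    have : 0 <= \sum_(k < N) cabs (u k) by rewrite sumr_ge0// => ? _; exact: cabs_ge0.
    rewrite /u; lra.
  rewrite (bigD1 (Ordinal kN))//=.
  have : 0 <= \sum_(i < N | i != Ordinal kN) cabs (u i) by rewrite sumr_ge0// => ? _; exact: cabs_ge0.
  by have := cabs_ge0 (u k); lra.
have ue0 : 0 < cabs (u e).
  by rewrite cabs_gt0// mulf_neq0// expf_neq0// fmorph_eq0 gt_eqF.
suff h (rho : R) : 0 < rho -> rho <= 2^-1 -> cabs (u e) <= 3 * M * rho.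
  have M6 : 0 < 6 * M by rewrite mulr_gt0.
  pose rho := Num.min 2^-1 (cabs (u e) / (6 * M)).
  have r0 : 0 < rho by rewrite lt_min invr_gt0 ltr0n divr_gt0.
  have r1 : rho <= 2^-1 by rewrite ge_min lexx.
  have r2 : rho <= cabs (u e) / (6 * M) by rewrite ge_min lexx orbT.
  have := h rho r0 r1; rewrite ler_pdivlMr// in r2; nra.
move=> r0 r1; pose x := x0 * rho.
have xx0 : 0 < x by rewrite mulr_gt0.
have x1 : x < 1 by rewrite /x; nra.
pose w k := c k * x%:C ^+ k.
have wu k : w k = u k * rho%:C ^+ k.
  by rewrite /w /u /x (rmorphM (real_complex R)) exprMn mulrA.
have cw k : cabs (w k) = cabs (u k) * rho ^+ k.
  by rewrite wu cabsM cabsX cabsR ger0_norm// ltW.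
have e0 : 0 < M * rho ^+ e.+1 by rewrite mulr_gt0// exprn_gt0.
have [N hN] := has_sum_near (H x xx0 x1) e0.
have {hN} := hN (maxn N e.+1) (leq_maxl _ _); set n := maxn _ _.
have en : (e < n)%N by exact: leq_maxr.
have -> : series (fun e => c e * x%:C ^+ e) n = w e + \sum_(e.+1 <= k < n) w k.
  rewrite seriesE (big_cat_nat (n := e))//=; last exact: ltnW.
  rewrite big_nat_cond big1 ?add0r; last by move=> k /andP[/andP[_ ke] _]; rewrite IH// mul0r.
  by rewrite big_ltn.
move=> hS; have hT : cabs (\sum_(e.+1 <= k < n) w k) <= M * (2 * rho ^+ e.+1).
  apply: (le_trans (le_cabs_sum _ _ _)).
  apply: (@le_trans _ _ (\sum_(e.+1 <= k < n) M * rho ^+ k)).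
    apply: ler_sum => k _; rewrite cw ler_wpM2r ?uM// exprn_ge0//; exact: ltW.
  by rewrite -mulr_sumr ler_wpM2l ?geometric_tail// ltW.
have : cabs (w e) <= 3 * M * rho ^+ e.+1.
  have -> : w e = (w e + \sum_(e.+1 <= k < n) w k) - \sum_(e.+1 <= k < n) w k by rewrite addrK.
  by apply: (le_trans (cabsB _ _)); lra.
rewrite cw exprS mulrA ler_pM2r// exprn_gt0//.
Qed.

(** The values of the exponential exhaust a real interval, where expansions are
    ordinary power series. *)
Lemma qroot1_real (x : R) : 0 < x -> x < 1 ->
  exists tau : C, upper tau /\ qroot 1 tau = x%:C.
Proof.
move=> x0 x1; exists (Complex 0 (- ln x / (2 * pi))); split.
  by rewrite /upper /= divr_gt0 ?mulr_gt0 ?pi_gt0// oppr_gt0 ln_lt0// x0.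
have pin := lt0r_neq0 (pi_gt0 R).
rewrite -[LHS]expr1 qroot_cex -cexE /cexp.
have -> : 2 * pi%:C * ii * (1%:R / 1%:R) * Complex 0 (- ln x / (2 * pi)) = (ln x)%:C.
  have -> : (2 : C) = (2 : R)%:C by rewrite rmorph_nat.
  rewrite invr1 !mulr1; move: (pi : R) pin => q q0; simpc; congr (Complex _ _).
  by field; rewrite q0.
by rewrite /= lnK ?posrE// cos0 sin0; simpc.
Qed.

Lemma q_expansion_zero (f : C -> C) (a : nat -> C) :
  (forall tau, upper tau -> f tau = 0) -> q_expansion 1 f a -> forall e, a e = 0.
Proof.
move=> f0 fa; apply: power_series_coef0 => x x0 x1.
have [tau [ut <-]] := qroot1_real x0 x1.
by have := fa tau ut; rewrite f0.
Qed.

Lemma q_expansion_lincomb (I : Type) (s : seq I) (l : nat) (f : I -> C -> C)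
    (a : I -> nat -> C) (c : I -> C) : (forall i, q_expansion l (f i) (a i)) ->
  q_expansion l (fun tau => \sum_(i <- s) c i * f i tau)
    (fun e => \sum_(i <- s) c i * a i e).
Proof.
move=> fa tau ut; rewrite /has_sum; elim: s => [|i s IH].
  rewrite big_nil (_ : series _ = fun=> 0); first exact: cvg_cst.
  by apply/funext => n; rewrite seriesE big1// => k _; rewrite big_nil mul0r.
rewrite big_cons (_ : series _ = fun n => c i * series (fun e => a i e * qroot l tau ^+ e) n +
   series (fun e => (\sum_(i <- s) c i * a i e) * qroot l tau ^+ e) n).
  apply: cvgD; last exact: IH.
  by apply: cvgM; [exact: cvg_cst|exact: fa].
apply/funext => n; rewrite !seriesE mulr_sumr -big_split/=.
by apply: eq_bigr => k _; rewrite big_cons mulrDl mulrA.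
Qed.

Lemma q_expansion_unique (f : C -> C) (a a' : nat -> C) :
  q_expansion 1 f a -> q_expansion 1 f a' -> a =1 a'.
Proof.
move=> fa fa' e; apply/eqP; rewrite -subr_eq0; apply/eqP.
have := @q_expansion_lincomb bool [:: true; false] 1 (fun=> f)
  (fun b => if b then a else a') (fun b => if b then 1 else -1).
move=> /(_ (fun b => match b with true => fa | false => fa' end)).
move=> /q_expansion_zero /(_ e) /=; rewrite !big_cons !big_nil mul1r mulN1r addr0; apply.
by move=> tau _; rewrite !big_cons big_nil mul1r mulN1r addr0 subrr.
Qed.

(** The coefficients at the pivots determine those of the linear combination, by
    a triangular system. *)
Lemma echelon_vanish (k l d : nat) (b : 'I_d.+1 -> C -> C) (p : 'I_d.+1 -> nat)
    (f : C -> C) (A : nat -> C) :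
  row_echelon_basis k l b p -> modular_form k l f -> q_expansion 1 f A ->
  (forall e, (e <= p ord_max)%N -> A e = 0) -> forall e, A e = 0.
Proof.
move=> [[mb free span] [a aP] inc] mf fA A0.
have [c cf] := span f mf.
have fE : q_expansion 1 f (fun e => \sum_(i < d.+1) c i * a i e).
  move=> tau ut; rewrite (cf tau ut).
  have ba i : q_expansion 1 (b i) (a i) by have [] := aP i.
  exact (@q_expansion_lincomb 'I_d.+1 (index_enum _) 1 b a c ba tau ut).
have AE := q_expansion_unique fA fE.
have c0 m : forall i : 'I_d.+1, i = m :> nat -> c i = 0.
  elim/ltn_ind: m => m IH i im.
  have pm : (p i <= p ord_max)%N.
    have [->//|ne] := eqVneq i ord_max.
    by apply/ltnW/inc; rewrite ltn_neqAle -ltnS ltn_ord andbT.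
  have := AE (p i); rewrite A0// (bigD1 i)//= big1 ?addr0; last first.
    move=> j ji; have [ij|ij] := ltnP i j.
      by have [_ _ ->] := aP j; rewrite ?mulr0// inc.
    by rewrite (IH j)// ?mul0r// -im ltn_neqAle ij andbT.
  by have [_ -> _] := aP i; rewrite mulr1 => <-.
by move=> e; rewrite AE big1// => i _; rewrite (c0 i i erefl) mul0r.
Qed.

End PowerSeries.

(** * Sums over layers as coefficients *)

Section LayerSums.
Context {R : realType}.
Local Notation C := R[i].

Variables (n : nat) (B : 'M[R]_n).
Hypothesis uB : B \in unitmx.
Hypothesis evenB : forall x : 'rV[int]_n, exists z : int,
  dot (zrow x *m B) (zrow x *m B) = 2 * z%:~R.

Lemma finite_int_box (K : nat) :
  finite_set [set x : 'rV[int]_n | forall i, (`|x 0 i| <= K%:Z)%R].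
Proof.
apply: (@sub_finite_set _ _ ((fun h : 'rV['I_(K.*2.+1)]_n => \row_i ((h 0 i : nat)%:Z - K%:Z)) @` setT)).
  move=> x h; exists (\row_i inord (absz (x ord0 i + K%:Z))) => //; apply/rowP => i.
  rewrite !mxE; move: (h i); rewrite ler_norml; move: (x _ i) => a /andP[h1 h2].
  have h3 : 0 <= a + K%:Z by lia.
  by rewrite inordK; [rewrite gez0_abs//|]; lia.
by apply: finite_image; exact: finite_finset.
Qed.

(** Coordinates are inner products with the dual basis. *)
Lemma lattice_bounded (e : nat) : exists K : nat,
  forall x : 'rV[int]_n, dot (zrow x *m B) (zrow x *m B) = 2 * e%:R ->
  forall i, `|x 0 i| <= K%:Z.
Proof.
pose W : R := \sum_i dot (col i (invmx B))^T (col i (invmx B))^T.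
pose K := Num.trunc (2 * e%:R + W).
exists K.+1 => x xe i; rewrite -(@ler_int R) intr_norm.
have -> : (x 0 i)%:~R = dot (zrow x *m B) (col i (invmx B))^T.
  have -> : dot (zrow x *m B) (col i (invmx B))^T = (zrow x *m B *m invmx B) 0 i.
    by rewrite /dot trmxK !mxE; apply: eq_bigr => a _; rewrite !mxE.
  by rewrite mulmxK// mxE.
have := dot_amgm (zrow x *m B) (col i (invmx B))^T (ltr01 : 0 < 1 :> R).
rewrite xe mul1r mulr1 => h; apply: (le_trans h).
apply: (@le_trans _ _ (2 * e%:R + W)); last exact/ltW/truncnS_gt.
rewrite lerD2l; set v := _^T; apply: (@le_trans _ _ (dot v v)).
  by rewrite ler_piMr ?dot_ge0// invf_le1 ?ler1n// ltr0n.
by rewrite /W (bigD1 i)//= lerDl sumr_ge0// => j _; exact: dot_ge0.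
Qed.

Lemma layer_finite (e : nat) : let L := [set x | exists z : 'rV[int]_n, x = zrow z *m B] in
  finite_set (layer L (2 * e%:R)).
Proof.
move=> L; have [K hK] := lattice_bounded e.
apply: (@sub_finite_set _ _ ((fun x => zrow x *m B) @` [set x : 'rV[int]_n | forall i, `|x 0 i| <= K%:Z])).
  by move=> x [[z ->] ze]; exists z => //; exact: hK.
by apply: finite_image; exact: finite_int_box.
Qed.

Lemma zrow_inj (x y : 'rV[int]_n) : zrow x = zrow y :> 'rV[R]_n -> x = y.
Proof. by move=> e; apply/rowP => i; have /rowP/(_ i) := e; rewrite !mxE => /intr_inj. Qed.

Definition theta_coef (i j : 'I_n) (e : nat) : C :=
  csum (fun x => if `|halfnorm B x|%N == e then hweight i j (zrow x *m B) else 0).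

Lemma halfnorm_eq x e : (`|halfnorm B x|%N == e) = (dot (zrow x *m B) (zrow x *m B) == 2 * e%:R).
Proof.
rewrite (halfnormE evenB) (inj_eq (mulfI _)) ?pnatr_eq0//.
by rewrite pmulrn eqr_int -{2}(ger0_norm (halfnorm_ge0 evenB x)) -abszE.
Qed.

Lemma fiber_finite e : finite_set [set x : 'rV[int]_n | `|halfnorm B x|%N == e].
Proof.
have [K hK] := lattice_bounded e; apply: sub_finite_set (finite_int_box K).
by move=> x /=; rewrite halfnorm_eq => /eqP; exact: hK.
Qed.

Lemma fiber_summable (i j : 'I_n) e :
  csummable (fun x => if `|halfnorm B x|%N == e then hweight i j (zrow x *m B) else 0).
Proof.
have fW := fiber_finite e; set W := [set x | _] in fW.
apply: (csum_seq (fset_uniq (fset_set W)) _).1 => x.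
by rewrite in_fset_set// notin_setE /W /= => /negP/negPf ->.
Qed.

Lemma theta_coef_layer i j e : let L := [set x | exists z : 'rV[int]_n, x = zrow z *m B] in
  theta_coef i j e = \sum_(x <- fset_set (layer L (2 * e%:R))) hweight i j x.
Proof.
move=> L; have fL := layer_finite e; rewrite -/L in fL.
pose W := [set x : 'rV[int]_n | `|halfnorm B x|%N == e].
have fW : finite_set W := fiber_finite e.
rewrite /theta_coef (csum_seq (fset_uniq (fset_set W)) _).2; last first.
  by move=> x; rewrite in_fset_set// notin_setE /W /= => /negP/negPf ->.
have pe : perm_eq (fset_set (layer L (2 * e%:R))) [seq zrow x *m B | x <- fset_set W].
  apply: uniq_perm; first exact: fset_uniq.
    rewrite map_inj_in_uniq ?fset_uniq// => x y _ _ xy; apply: zrow_inj.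
    by rewrite -(mulmxK uB (zrow x)) xy mulmxK.
  move=> x; rewrite in_fset_set//; apply/idP/mapP.
    move=> /set_mem[[z ->] ze]; exists z => //.
    by rewrite in_fset_set// mem_set// /W /= halfnorm_eq ze.
  move=> [z]; rewrite in_fset_set// => /set_mem; rewrite /W /= halfnorm_eq => /eqP ze ->.
  by apply/mem_set; split => //; exists z.
rewrite (perm_big _ pe)/= big_map; apply: eq_big_seq => x.
by rewrite in_fset_set// => /set_mem; rewrite /W /= => ->.
Qed.

End LayerSums.

(** * Adding a copy of A_1 *)

Section AddA1.
Context {R : realType}.
Local Notation C := R[i].
Variables (n : nat) (B : 'M[R]_n).
Hypothesis uB : B \in unitmx.
Hypothesis evenB : forall x : 'rV[int]_n, exists z : int,
  dot (zrow x *m B) (zrow x *m B) = 2 * z%:~R.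

Definition addA1mx : 'M[R]_(n + 1) := block_mx B 0 0 (Num.sqrt 2)%:M.

Definition addz (p : 'rV[int]_n * int) : 'rV[int]_(n + 1) := row_mx p.1 p.2%:M.

Lemma addz_bij : bijective addz.
Proof.
exists (fun x => (lsubmx x, rsubmx x 0 0)) => [[x z]|x]; rewrite /addz/=.
  by rewrite row_mxKl row_mxKr mxE eqxx mulr1n.
rewrite -[RHS]hsubmxK; congr row_mx; apply/rowP => c.
by rewrite !ord1 mxE eqxx mulr1n.
Qed.

Lemma zrow_addz p :
  zrow (addz p) *m addA1mx = row_mx (zrow p.1 *m B) (p.2%:~R * Num.sqrt 2)%:M.
Proof.
rewrite /zrow /addz map_row_mx map_scalar_mx /addA1mx mul_row_block.
by rewrite !mulmx0 addr0 add0r -scalar_mxM.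
Qed.

Lemma dot_addz p : dot (zrow (addz p) *m addA1mx) (zrow (addz p) *m addA1mx) =
  2 * (halfnorm B p.1 + p.2 ^+ 2)%:~R.
Proof.
rewrite zrow_addz dot_row dot_scalar (halfnormE evenB) -expr2 exprMn sqr_sqrtr ?ler0n//.
by rewrite intrD rmorphXn/=; ring.
Qed.

Lemma addA1mx_unit : addA1mx \in unitmx.
Proof.
rewrite unitmxE det_ublock det_scalar expr1 unitrM -unitmxE uB unitfE.
by rewrite sqrtr_eq0 -ltNge ltr0n.
Qed.

Lemma addA1mx_even x : exists z : int,
  dot (zrow x *m addA1mx) (zrow x *m addA1mx) = 2 * z%:~R.
Proof.
have [f _ fK] := addz_bij; rewrite -(fK x).
by exists (halfnorm B (f x).1 + (f x).2 ^+ 2); exact: dot_addz.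
Qed.

Lemma halfnorm_addz p : `|halfnorm addA1mx (addz p)|%N = (`|halfnorm B p.1| + `|p.2| ^ 2)%N.
Proof.
have e : halfnorm addA1mx (addz p) = halfnorm B p.1 + p.2 ^+ 2.
  apply: (@intr_inj R); apply: (@mulfI _ (2 : R)); first by rewrite pnatr_eq0.
  by rewrite -(halfnormE addA1mx_even) dot_addz.
have := halfnorm_ge0 evenB p.1; have := sqr_ge0 p.2; rewrite e => h1 h2.
apply/eqP; rewrite -eqz_nat PoszD gez0_abs ?addr_ge0// gez0_abs//.
by rewrite -abszX gez0_abs.
Qed.

Lemma hweight_addz i j p : hweight (lshift 1 i) (lshift 1 j) (zrow (addz p) *m addA1mx) =
  hweight i j (zrow p.1 *m B).
Proof. by rewrite zrow_addz /hweight !row_mxEl. Qed.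

(** The weight only involves coordinates of the first summand, so that the theta
    series of the sum is that of the first lattice times the plain one of A_1. *)
Lemma theta_coef_addA1 i j e :
  theta_coef addA1mx (lshift 1 i) (lshift 1 j) e =
  csum (fun z : int =>
    if (`|z| ^ 2 <= e)%N then theta_coef B i j (e - `|z| ^ 2) else 0).
Proof.
have s := fiber_summable addA1mx_unit addA1mx_even (lshift 1 i) (lshift 1 j) e; rewrite /theta_coef.
rewrite -(csum_bij _ addz_bij); move/(csummable_bij _ addz_bij) : s => s.
rewrite csum_pair// csum_swap//; apply: eq_csum => z.
case: ifPn => ze.
  apply: eq_csum => x; rewrite /= hweight_addz halfnorm_addz/=.
  by rewrite -[in RHS](eqn_add2r (`|z| ^ 2)) subnK.
rewrite -[RHS](@csum0 R 'rV[int]_n); apply: eq_csum => x; rewrite /= halfnorm_addz/=.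
by case: eqP => // h; rewrite -h leq_addl in ze.
Qed.

Lemma theta_coef_addA1_eq0 i j e :
  (forall e', (e' <= e)%N -> theta_coef B i j e' = 0) ->
  theta_coef addA1mx (lshift 1 i) (lshift 1 j) e = 0.
Proof.
move=> h; rewrite theta_coef_addA1 -[RHS](@csum0 R int); apply: eq_csum => z.
by case: ifP => // _; rewrite h// leq_subr.
Qed.

(** The theta series of A_1 starts with 1 and can be divided by. *)
Lemma theta_coef_eq0 i j :
  (forall e, theta_coef addA1mx (lshift 1 i) (lshift 1 j) e = 0) ->
  forall e, theta_coef B i j e = 0.
Proof.
move=> h e; elim/ltn_ind: e => e IH.
have := h e; rewrite theta_coef_addA1; set F := fun z : int => _.
have Fz z : z != 0 -> F z = 0.
  move=> z0; rewrite /F; case: ifP => // ze; apply: IH.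
  have : (0 < `|z| ^ 2)%N by rewrite expn_gt0 absz_gt0 z0.
  lia.
have F0 : F 0 = theta_coef B i j e by rewrite /F leq0n subn0.
by rewrite (csum_single Fz).2 F0.
Qed.

End AddA1.

(** * Level, designs and the conclusion *)

Lemma level_dual (R : realType) n (L : set 'rV[R]_n) l y y' : is_level L l ->
  dual_lattice L y -> dual_lattice L y' ->
  l%:R * dot y y' \is a Num.int /\ exists z : int, l%:R * dot y y = 2 * z%:~R.
Proof.
case=> l0 [[_ h1] h2] _ dy dy'.
have E u v : dot (Num.sqrt l%:R *: u) (Num.sqrt l%:R *: v) = l%:R * dot u v :> R.
  by rewrite dotZl dotZr mulrA -expr2 sqr_sqrtr ?ler0n.
split; first by rewrite -E; apply: h1; [exists y|exists y'].
by rewrite -E; apply: h2; exists y.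
Qed.

Section Designs.
Context {R : realType}.
Local Notation C := R[i].
Variables (n : nat) (B : 'M[R]_n).
Hypothesis uB : B \in unitmx.
Hypothesis evenB : forall x : 'rV[int]_n, exists z : int,
  dot (zrow x *m B) (zrow x *m B) = 2 * z%:~R.

Let L : set 'rV[R]_n := [set x | exists z : 'rV[int]_n, x = zrow z *m B].

(** The weight sees both kinds of second moments, one in its real part and one in
    its imaginary part. *)
Lemma sum_hweight (i j : 'I_n) (s : seq 'rV[R]_n) : \sum_(x <- s) hweight i j x =
  Complex (\sum_(x <- s) x 0 i * x 0 i - \sum_(x <- s) x 0 j * x 0 j)
          (2 * \sum_(x <- s) x 0 i * x 0 j).
Proof.
elim: s => [|x s IH]; first by rewrite !big_nil subrr mulr0.
rewrite !big_cons IH /hweight expr2; simpc; congr (Complex _ _); ring.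
Qed.

(** For e = 0 the layer consists of the origin, where the weight vanishes. *)
Lemma design_theta_coef i j e : i != j ->
  ((0 < e)%N -> layer L (2 * e%:R) !=set0 ->
    spherical_design 2 (layer L (2 * e%:R))) ->
  theta_coef B i j e = 0.
Proof.
move=> ij; rewrite (theta_coef_layer uB evenB) -/L.
have fL : finite_set (layer L (2 * e%:R)) := layer_finite uB e.
case: e fL => [|e] fL H.
  rewrite big_seq big1// => x; rewrite in_fset_set// => /set_mem [_ /eqP].
  by rewrite mulr0 dot_eq0 => /eqP ->; rewrite /hweight !mxE (expr0n _ 2).
have [L0|/set0P/H h] := eqVneq (layer L (2 * e.+1%:R)) set0.
  by rewrite L0 fset_set0 big_seq_fset0.
rewrite sum_hweight; have [-> ->] := design_moments (h isT) ij.
by rewrite subrr mulr0.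
Qed.

Lemma theta_coef_design e : (0 < n)%N -> (0 < e)%N ->
  (forall i j, i != j -> theta_coef B i j e = 0) ->
  layer L (2 * e%:R) !=set0 -> spherical_design 2 (layer L (2 * e%:R)).
Proof.
move=> n0 e0 H L0; have fL : finite_set (layer L (2 * e%:R)) := layer_finite uB e.
have r0 : 0 < 2 * e%:R :> R by rewrite mulr_gt0 ?ltr0n.
apply: (@moments_design _ _ _ (Num.sqrt (2 * e%:R))) => //.
- by rewrite sqrtr_gt0.
- by move=> x [_ xe]; rewrite /sphere/= sqr_sqrtr// ltW.
- move=> x [[z ->] ze]; split; first by exists (- z); rewrite zrowN mulNmx.
  by rewrite dotNl dotNr opprK.
move=> i j ij; have := H i j ij.
rewrite (theta_coef_layer uB evenB) -/L sum_hweight => -[/eqP h1 /eqP h2].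
split; first by move: h2; rewrite mulf_eq0 pnatr_eq0 => /eqP.
by apply/eqP; rewrite -subr_eq0.
Qed.

Lemma dual_basis_mem (y : 'rV[int]_n) : dual_lattice L (zrow y *m dualmx B).
Proof.
move=> x [z ->]; rewrite dot_dualmx// dotE rpred_sum// => i _.
by rewrite !mxE rpredM ?intr_int.
Qed.

Variable l : nat.
Hypothesis lL : is_level L l.

Lemma level_even (y : 'rV[int]_n) : exists z : int,
  l%:R * dot (zrow y *m dualmx B) (zrow y *m dualmx B) = 2 * z%:~R.
Proof. by have dy := dual_basis_mem y; have [] := level_dual lL dy dy. Qed.

(** Multiplied by the level, the dual lattice is contained in the lattice: the
    coordinates are l times inner products of dual vectors. *)
Lemma level_lattice (y : 'rV[int]_n) :
  exists w : 'rV[int]_n, l%:R *: (zrow y *m dualmx B) = zrow w *m B.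
Proof.
set Y := _ *m _; pose E (a : 'I_n) : 'rV[int]_n := delta_mx 0 a.
exists (\row_a Num.floor (l%:R * dot Y (zrow (E a) *m dualmx B))).
rewrite -[LHS](mulmxKV uB); congr (_ *m _); apply/rowP => a; rewrite !mxE.
have [h _] := level_dual lL (dual_basis_mem y) (dual_basis_mem (E a)).
rewrite -/Y in h; rewrite (floorK h).
have -> : zrow (E a) = delta_mx 0 a :> 'rV[R]_n.
  exact: map_delta_mx.
rewrite -rowE dotE mulr_sumr; apply: eq_bigr => c _.
by rewrite !mxE mulrA.
Qed.

End Designs.

Lemma orth_sum_addA1 (R : realType) n (B : 'M[R]_n) :
  orth_sum [set x | exists z : 'rV[int]_n, x = zrow z *m B] latticeA1 =
  [set x | exists z : 'rV[int]_(n + 1), x = zrow z *m addA1mx B].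
Proof.
apply/seteqP; split=> [x [x1 [x2 [[z ->] [w ->] ->]]]|x [z ->]].
  exists (addz (z, w)); rewrite zrow_addz; congr row_mx.
  by apply/rowP => c; rewrite ord1 !mxE eqxx mulr1n mulrC.
have [f _ fK] := addz_bij n; rewrite -(fK z) zrow_addz.
exists (zrow (f z).1 *m B), (((f z).2%:~R * Num.sqrt 2)%:M); split => //.
  by exists (f z).1.
by exists (f z).2; apply/rowP => c; rewrite ord1 !mxE eqxx mulr1n mulrC.
Qed.

(** The dual of A_1 contains a vector of norm 1 / 2, so that 4 divides the
    level. *)
Lemma level_addA1_gt1 (R : realType) n (L : set 'rV[R]_n) l :
  is_level (orth_sum L latticeA1) l -> (1 < l)%N.
Proof.
move=> lL; pose y : 'rV[R]_(n + 1) := row_mx 0 (Num.sqrt 2)^-1%:M.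
have s2 : Num.sqrt 2 != 0 :> R by rewrite sqrtr_eq0 -ltNge ltr0n.
have dy : dual_lattice (orth_sum L latticeA1) y.
  move=> x [x1 [x2 [_ [z ->] ->]]].
  have -> : const_mx (Num.sqrt 2 * z%:~R) = (Num.sqrt 2 * z%:~R)%:M :> 'rV[R]_1.
    by apply/rowP => c; rewrite ord1 !mxE eqxx mulr1n.
  rewrite dot_row dotC dot0l dot_scalar add0r mulrAC divff// mul1r.
  exact: intr_int.
have [_ [z]] := level_dual lL dy dy.
rewrite /y dot_row dot0l dot_scalar add0r -invfM -expr2 sqr_sqrtr ?ler0n// => h.
have e : l%:Z = 4 * z.
  apply: (@intr_inj R); rewrite intrM -pmulrn.
  by move: h => /(congr1 (fun t => t * 2)); rewrite mulfVK ?pnatr_eq0// => ->; ring.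
have [l0 _ _] := lL; lia.
Qed.

Section ThetaAddA1.
Context {R : realType}.
Local Notation C := R[i].

Lemma theta_modular_dim m k (B : 'M[R]_m) (i j : 'I_m) l : m = k.*2 -> i != j ->
  B \in unitmx ->
  (forall x : 'rV[int]_m, exists z : int,
    dot (zrow x *m B) (zrow x *m B) = 2 * z%:~R) ->
  is_level [set x | exists z : 'rV[int]_m, x = zrow z *m B] l -> (1 < l)%N ->
  modular_form (k + 2) l (theta B i j) /\
  q_expansion 1 (theta B i j) (theta_coef B i j).
Proof.
move=> mk; subst m => ij uB evenB lL l1; split.
  apply: theta_modular => // y; first exact: level_even lL y.
  exact: level_lattice lL y.
have := fiber_q_expansion (fun tau => theta_qroot ij uB evenB (ltn0Sn 0) (tau := tau)).
congr q_expansion; apply/funext => e; apply: eq_csum => x.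
by rewrite mul1n.
Qed.

End ThetaAddA1.

Theorem proposition19 (R : realType) (n : nat) (L : set 'rV[R]_n) (l' d : nat)
    (b : 'I_d.+1 -> R[i] -> R[i]) (p : 'I_d.+1 -> nat) (N : nat) :
  odd n ->
  even_lattice L ->
  is_level (orth_sum L latticeA1) l' ->
  row_echelon_basis ((n + 1) %/ 2 + 2) l' b p ->
  N = p ord_max ->
  (forall m : R, 0 < m -> m <= 2 * N%:R -> layer L m !=set0 ->
     spherical_design 2 (layer L m)) ->
  forall m : R, 0 < m -> layer L m !=set0 -> spherical_design 2 (layer L m).
Proof.
move=> on [[[B [uB LE]] _] evenL] lL bp Np H m m0 Lm.
have evenB (x : 'rV[int]_n) : exists z : int,
    dot (zrow x *m B) (zrow x *m B) = 2 * z%:~R.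
  by apply: evenL; rewrite LE; exists x.
have n0 : (0 < n)%N by case: n on {L B LE uB lL bp H Lm evenL evenB}.
have nk : n + 1 = ((n + 1) %/ 2).*2 :> nat.
  by rewrite -muln2 divnK// dvdn2 addn1/= on.
(* Up to the last pivot, the coefficients for L _|_ A_1 only involve layers that
   are designs by hypothesis. *)
have coef0 i j : i != j -> forall e, theta_coef B i j e = 0.
  move=> ij; apply: theta_coef_eq0 => //.
  have ij' : lshift 1 i != lshift 1 j by rewrite (inj_eq (@lshift_inj _ _)).
  have l1 := level_addA1_gt1 lL.
  move: lL; rewrite LE orth_sum_addA1 => lL.
  have [fm fq] := theta_modular_dim nk ij' (addA1mx_unit uB) (addA1mx_even evenB) lL l1.
  apply: (echelon_vanish bp fm fq) => e ep.
  apply: theta_coef_addA1_eq0 => // e' ee'.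
  apply: design_theta_coef => // e0; rewrite -LE => L0.
  apply: H => //; first by rewrite mulr_gt0 ?ltr0n.
  by rewrite ler_pM2l ?ltr0n// ler_nat Np (leq_trans ee').
have [x [Lx xm]] := Lm; have [z ze] := evenL x Lx; rewrite xm in ze.
have z0 : 0 < z by move: m0; rewrite ze pmulr_rgt0// ltr0z.
have mE : m = 2 * `|z|%N%:R by rewrite ze natr_absz gtr0_norm.
rewrite mE LE; apply: theta_coef_design => //; first by rewrite absz_gt0 gt_eqF.
  by move=> i j /coef0.
by rewrite -mE -LE.
Qed.
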